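(* Let $\mathcal{A}$ be a von Neumann algebra with a state $\varphi$, and let $(x_j^\ell,x_j^r)_{j\in\mathbb{N}}$ be an infinite family of pairs of self-adjoint elements of $\mathcal{A}$ such that the restriction of $\varphi$ to the von Neumann algebra $M$ generated by all the $x_j^\ell,x_j^r$ is a non-degenerate normal state. Assume that the family is quantum bi-exchangeable, and let $B$ be its tail algebra. Let $\mathcal{N}$ be the algebra generated by $B$ and all the variables $x_j^\ell,x_j^r$, $j\in\mathbb{N}$. Then there exists a (not necessarily normal) conditional expectation $\mathbb{E}:\mathcal{N}\to B$ onto $B$ such that: (1) the pairs are strongly quantum bi-invariant with respect to $\mathbb{E}$: for all $N,n\in\mathbb{N}$, all $J=(j_1,\dots,j_n)\in\{1,\dots,N\}^n$, all $\chi\in\{\ell,r\}^n$ and all $b_1,\dots,b_{n+1}\in B$, $$\mathbb{E}(b_1x_{j_1}^{\chi(1)}b_2\cdots b_nx_{j_n}^{\chi(n)}b_{n+1})\otimes 1_{C(S_N^+)}=\sum_{I\in\{1,\dots,N\}^n}\mathbb{E}(b_1x_{i_1}^{\chi(1)}b_2\cdots b_nx_{i_n}^{\chi(n)}b_{n+1})\otimes u_{IJ}^\chi;$$ (2) for any $n$, any $\chi\in\{\ell,r\}^n$, any $n$ pairwise different indices $j_1,\dots,j_n$ and any $X_{j_i}^{\chi(i)}\in C_{j_i}^{\chi(i)}$, $$\mathbb{E}\left(X_{j_1}^{\chi(1)}\cdots X_{j_n}^{\chi(n)}\right)=\prod_{i=1}^n\mathbb{E}\left(X_{j_i}^{\chi(i)}\right)$$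 (ordered product, $i$ increasing from left to right).
   Context: A state $\varphi$ on a von Neumann algebra $A$ is non-degenerate if, for $x\in A$, $\varphi(a^*xb)=0$ for all $a,b\in A$ implies $x=0$. $C(S_N^+)$ is the universal unital C*-algebra generated by self-adjoint projections $u_{ij}$, $1\leqslant i,j\leqslant N$, with $\sum_iu_{ik}=1=\sum_ju_{kj}$ for all $k$. For $\chi\in\{\ell,r\}^n$, write $\chi^{-1}(\ell)=\{i_1<\dots<i_k\}$, $\chi^{-1}(r)=\{i_{k+1}>\dots>i_n\}$, and let $s_\chi\in S_n$ be $s_\chi(t)=i_t$. For $I=(i_1,\dots,i_n)$, $J=(j_1,\dots,j_n)$ in $\{1,\dots,N\}^n$ set $u_{IJ}^\chi=u_{i_{s_\chi(1)}j_{s_\chi(1)}}\cdots u_{i_{s_\chi(n)}j_{s_\chi(n)}}$. The infinite family $(x_j^\ell,x_j^r)_{j\in\mathbb{N}}$ is quantum bi-exchangeable if for all $N,n\in\mathbb{N}$, all $\chi\in\{\ell,r\}^n$ and all $J\in\{1,\dots,N\}^n$, $$\varphi(x_{j_1}^{\chi(1)}\cdots x_{j_n}^{\chi(n)})\,1_{C(S_N^+)}=\sum_{I\in\{1,\dots,N\}^n}\varphi(x_{i_1}^{\chi(1)}\cdots x_{i_n}^{\chi(n)})\,u_{IJ}^\chi.$$ The tail algebra is $B=\bigcap_{n\geqslant0}W^*(\{x_j^\ell,x_j^r:\ j\geqslant n\})\subset\mathcal{A}$, where $W^*(S)$ is the von Neumann algebra generated by $S$ in $\mathcal{A}$. $C_j^\ell$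 (resp. $C_j^r$) denotes the algebra generated by $B$ and $x_j^\ell$ (resp. by $B$ and $x_j^r$). A conditional expectation onto $B$ is a norm-one linear projection onto $B$ which is $B$-bimodular. *)

(* Defs.v *)
From HB Require Import structures.
From mathcomp Require Import all_boot all_order all_algebra complex.
From mathcomp Require Import boolp classical_sets functions reals topology.
From mathcomp Require Import normedtype sequences generic_quotient.

Set Implicit Arguments.
Unset Strict Implicit.
Unset Printing Implicit Defensive.

Import Order.TTheory GRing.Theory Num.Theory.
Import numFieldNormedType.Exports.

Local Open Scope classical_set_scope.
Local Open Scope ring_scope.
Local Open Scope quotient_scope.

(* The norm of a normed module over [R[i]] takes its values in [R[i]], where
   [0 <= z] means that z is real and nonnegative. *)
HB.mixin Record CompleteNormedModule_isHilbert (R : realType) H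
    of CompleteNormedModule R[i] H := {
  dot : H -> H -> R[i];
  dot_linearl : forall (c : R[i]) (v1 v2 w : H),
    dot (c *: v1 + v2) w = c * dot v1 w + dot v2 w;
  dot_conj : forall v w : H, dot w v = (dot v w)^*;
  dot_norm : forall v : H, dot v v = `|v| ^+ 2
}.

#[short(type="hilbertType")]
HB.structure Definition Hilbert (R : realType) :=
  {H of CompleteNormedModule R[i] H & CompleteNormedModule_isHilbert R H}.

Record cstarType (R : realType) := Cstar {
  cstar_car :> algType R[i];
  cnorm : cstar_car -> R;
  star : cstar_car -> cstar_car;
  cnorm_eq0 : forall a, cnorm a = 0 -> a = 0;
  cnormD : forall a b, cnorm (a + b) <= cnorm a + cnorm b;
  cnormZ : forall (c : R[i]) a, (cnorm (c *: a))%:C%C = `|c| * (cnorm a)%:C%C;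
  cnormM : forall a b, cnorm (a * b) <= cnorm a * cnorm b;
  cnorm_complete : forall a : nat -> cstar_car,
    (forall e : R, 0 < e -> exists n, forall p q, (n <= p)%N -> (n <= q)%N ->
       cnorm (a p - a q) < e) ->
    exists l, (fun p => cnorm (a p - l)) @ \oo --> (0 : R);
  starD : forall a b, star (a + b) = star a + star b;
  starZ : forall (c : R[i]) a, star (c *: a) = c^* *: star a;
  starM : forall a b, star (a * b) = star b * star a;
  starK : forall a, star (star a) = a;
  cnorm_star : forall a, cnorm (star a * a) = cnorm a ^+ 2
}.

Section BoundedOperators.
Variables (R : realType) (H : hilbertType R).

Definition bounded_op : {pred H -> H} := fun f =>
  `[< linear f /\ exists c : R[i], forall v, `|f v| <= c * `|v| >].

Lemma bounded_op_submod : submod_closed bounded_op.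
Proof.
split=> [|c f g /asboolP[fl [k fk]] /asboolP[gl [l gl']]]; apply/asboolP; split.
- by move=> c v w; change (0 = c *: 0 + 0 :> H); rewrite scaler0 addr0.
- by exists 0 => v; rewrite mul0r -[leRHS](normr0 H).
- move=> d v w.
  change (c *: f (d *: v + w) + g (d *: v + w)
    = d *: (c *: f v + g v) + (c *: f w + g w)).
  by rewrite fl gl !scalerDr !scalerA (mulrC d c) addrACA.
- exists (`|c| * k + l) => v; rewrite mulrDl -mulrA.
  change (`|c *: f v + g v| <= `|c| * (k * `|v|) + l * `|v|).
  by rewrite (le_trans (ler_normD _ _))// normrZ lerD// ler_wpM2l.
Qed.

HB.instance Definition _ :=
  GRing.isSubmodClosed.Build R[i] (H -> H) bounded_op bounded_op_submod.

(* The algebra of bounded operators on [H]. *)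
Record bop := Bop { bop_fun :> H -> H; _ : bop_fun \in bounded_op }.

HB.instance Definition _ := [isSub for bop_fun].
HB.instance Definition _ := [Choice of bop by <:].
HB.instance Definition _ := [SubChoice_isSubLmodule of bop by <:].

Lemma bopP (S T : bop) : (forall v, S v = T v) -> S = T.
Proof. by move=> ST; apply: val_inj; apply/funext. Qed.

Lemma bop_linear (T : bop) : linear T.
Proof. by case: T => f /= /asboolP[]. Qed.

Lemma bop_id_subproof : (id : H -> H) \in bounded_op.
Proof. by apply/asboolP; split=> //; exists 1 => v; rewrite mul1r. Qed.

Lemma bop_comp_subproof (S T : bop) : (fun v => S (T v)) \in bounded_op.
Proof.
case: S T => f /= /asboolP[fl [k fk]] [g /= /asboolP[gl [l gl']]].
apply/asboolP; split=> [c v w|]; first by rewrite gl fl.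
exists (`|k| * `|l|) => v.
have nle (z : R[i]) (u : H) (y : R[i]) : 0 <= y -> y <= z * `|u| ->
    y <= `|z| * `|u|.
  move=> y0 yzu; rewrite -[`|u|]normr_id -normrM (le_trans yzu)//.
  by rewrite real_ler_norm// ger0_real// (le_trans y0 yzu).
rewrite (le_trans (nle _ _ _ _ (fk _)))// -mulrA ler_wpM2l//.
exact: nle.
Qed.

Definition bop_id := Bop bop_id_subproof.
Definition bop_comp S T := Bop (bop_comp_subproof S T).

Lemma bop_compA : associative bop_comp.
Proof. by move=> S T U; apply: bopP. Qed.

Lemma bop_comp1l : left_id bop_id bop_comp.
Proof. by move=> S; apply: bopP. Qed.

Lemma bop_comp1r : right_id bop_id bop_comp.
Proof. by move=> S; apply: bopP. Qed.

Lemma bop_compDl : left_distributive bop_comp +%R.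
Proof. by move=> S T U; apply: bopP. Qed.

Lemma bop_compDr : right_distributive bop_comp +%R.
Proof.
move=> S T U; apply: bopP => v.
change (S (T v + U v) = S (T v) + S (U v)).
by have := bop_linear S 1 (T v) (U v); rewrite !scale1r.
Qed.

HB.instance Definition _ := GRing.Zmodule_isPzRing.Build bop
  bop_compA bop_comp1l bop_comp1r bop_compDl bop_compDr.

(* The adjoint; by the Riesz representation theorem the set below is always a
   singleton, so the default value 0 is never used. *)
Definition adj (T : bop) : bop :=
  xget (0 : bop) [set S : bop | forall v w, dot (T v) w = dot v (S w)].

Definition opnorm (T : bop) : R :=
  sup [set complex.Re `|T v| | v in [set v | `|v| <= 1]].

Definition commutant (S : set bop) : set bop :=
  [set T | forall U, S U -> T * U = U * T].

Definition von_neumann_algebra (A : set bop) :=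
  (forall T, A T -> A (adj T)) /\ commutant (commutant A) = A.

Definition Wstar (S : set bop) : set bop :=
  \bigcap_(A in [set A | von_neumann_algebra A /\ S `<=` A]) A.

Definition subalgebra (A : set bop) :=
  [/\ A 1, forall (c : R[i]) S T, A S -> A T -> A (c *: S + T)
    & forall S T, A S -> A T -> A (S * T)].

Definition generated_algebra (S : set bop) : set bop :=
  \bigcap_(A in [set A | subalgebra A /\ S `<=` A]) A.

(* Functionals and maps defined on a set of operators [A] are represented by
   total functions on [bop], whose values outside [A] are irrelevant. *)
Definition state (A : set bop) (phi : bop -> R[i]) :=
  [/\ forall (c : R[i]) S T, A S -> A T -> phi (c *: S + T) = c * phi S + phi T,
      forall T, A T -> 0 <= phi (adj T * T)
    & phi 1 = 1].

Definition nondegenerate_on (M : set bop) (phi : bop -> R[i]) :=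
  forall T, M T ->
    (forall S U, M S -> M U -> phi (adj S * T * U) = 0) -> T = 0.

Definition square_summable (v : nat -> H) :=
  cvgn (series (fun k => `|v k| ^+ 2 : R[i]^o)).

Definition sigma_weak_form (v w : nat -> H) (T : bop) : R[i] :=
  limn (series (fun k => dot (T (v k)) (w k) : R[i]^o)).

(* Normality is continuity for the sigma-weak topology, which is generated by
   the functionals [sigma_weak_form v w], [v] and [w] square-summable. *)
Definition normal_on (M : set bop) (phi : bop -> R[i]) :=
  forall T, M T -> forall e : R[i], 0 < e ->
  exists m (v w : 'I_m -> nat -> H),
    (forall i, square_summable (v i) /\ square_summable (w i)) /\
    exists2 d : R[i], 0 < d & forall S, M S ->
      (forall i, `|sigma_weak_form (v i) (w i) S
                   - sigma_weak_form (v i) (w i) T| < d) ->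
      `|phi S - phi T| < e.

(* [E] has norm one: 1 is the least constant [c] such that
   [opnorm (E T) <= c * opnorm T] on [N]. *)
Record conditional_expectation (N B : set bop) (E : bop -> bop) : Prop := {
  cexp_linear : forall (c : R[i]) S T, N S -> N T ->
    E (c *: S + T) = c *: E S + E T;
  cexp_sub : forall T, N T -> B (E T);
  cexp_id : forall b, B b -> E b = b;
  cexp_bimodule : forall b T b', B b -> N T -> B b' ->
    E (b * T * b') = b * E T * b';
  cexp_contractive : forall T, N T -> opnorm (E T) <= opnorm T;
  cexp_norm1 : forall c : R,
    (forall T, N T -> opnorm (E T) <= c * opnorm T) -> 1 <= c
}.

End BoundedOperators.

Arguments bop {R} H.

(* The algebraic tensor product of two vector spaces: formal sums of pairs,
   modulo the congruence generated by the bilinearity relations. *)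
Section Tensor.
Variables (R : realType) (V W : lmodType R[i]).

Inductive tens_rel : seq (V * W) -> seq (V * W) -> Prop :=
| tens_refl s : tens_rel s s
| tens_sym s t : tens_rel s t -> tens_rel t s
| tens_trans s t r : tens_rel s t -> tens_rel t r -> tens_rel s r
| tens_cat s s' t t' :
    tens_rel s s' -> tens_rel t t' -> tens_rel (s ++ t) (s' ++ t')
| tens_comm s t : tens_rel (s ++ t) (t ++ s)
| tens_zero w : tens_rel [:: (0, w)] [::]
| tens_addl v v' w : tens_rel [:: (v + v', w)] [:: (v, w); (v', w)]
| tens_addr v w w' : tens_rel [:: (v, w + w')] [:: (v, w); (v, w')]
| tens_scale c v w : tens_rel [:: (c *: v, w)] [:: (v, c *: w)].

Definition tens_relb : rel (seq (V * W)) := fun s t => `[< tens_rel s t >].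

Lemma tens_relb_refl : reflexive tens_relb.
Proof. by move=> s; apply/asboolP; exact: tens_refl. Qed.

Lemma tens_relb_sym : symmetric tens_relb.
Proof. by move=> s t; apply/asboolP/asboolP; exact: tens_sym. Qed.

Lemma tens_relb_trans : transitive tens_relb.
Proof.
by move=> t s r /asboolP st /asboolP tr; apply/asboolP; exact: tens_trans tr.
Qed.

Definition tens_equiv := EquivRel tens_relb
  tens_relb_refl tens_relb_sym tens_relb_trans.

Definition tensor := {eq_quot tens_equiv}.

HB.instance Definition _ := Choice.on tensor.

Definition tensor_of (s : seq (V * W)) : tensor := \pi_({eq_quot tens_equiv}) s.

Lemma tensor_ofP s t : tens_rel s t <-> tensor_of s = tensor_of t.
Proof.
split=> [st|/eqquotP/asboolP//]; apply/eqquotP; exact/asboolP.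
Qed.

Definition tens_opp (s : seq (V * W)) := [seq (- p.1, p.2) | p <- s].

Lemma tens_oppl s : tens_rel (tens_opp s ++ s) [::].
Proof.
elim: s => [|[v w] s ih] /=; first exact: tens_refl.
have vNv : tens_rel [:: (- v, w); (v, w)] [::].
  apply: tens_trans (tens_zero w); rewrite -(addNr v).
  exact/tens_sym/tens_addl.
rewrite -cat1s.
apply: (@tens_trans _ ([:: (- v, w); (v, w)] ++ (tens_opp s ++ s))); last first.
  exact: tens_cat vNv ih.
rewrite -(cat1s (v, w) s) -[X in tens_rel _ X]/([:: (- v, w)] ++
  ([:: (v, w)] ++ (tens_opp s ++ s))).
apply: tens_cat (tens_refl _) _; rewrite !catA.
exact: tens_cat (tens_comm _ _) (tens_refl _).
Qed.

Lemma tens_opp_rel s t : tens_rel s t -> tens_rel (tens_opp s) (tens_opp t).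
Proof.
move=> st; rewrite -[tens_opp s]cats0 -[X in tens_rel _ X]cat0s.
apply: (@tens_trans _ (tens_opp s ++ (t ++ tens_opp t))).
  apply: tens_cat (tens_refl _) _; apply: tens_sym.
  exact: tens_trans (tens_comm _ _) (tens_oppl _).
rewrite catA; apply: tens_cat (tens_refl _).
apply: tens_trans (tens_oppl s); exact: tens_cat (tens_refl _) (tens_sym st).
Qed.

Definition tensor_add (x y : tensor) := tensor_of (repr x ++ repr y).
Definition tensor_opp (x : tensor) := tensor_of (tens_opp (repr x)).

Lemma repr_tensor_of s : tens_rel (repr (tensor_of s)) s.
Proof. by apply/tensor_ofP; rewrite /tensor_of reprK. Qed.

Lemma tensor_addC : commutative tensor_add.
Proof. by move=> x y; apply/tensor_ofP; exact: tens_comm. Qed.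

Lemma tensor_addA : associative tensor_add.
Proof.
move=> x y z; apply/tensor_ofP.
apply: (@tens_trans _ (repr x ++ (repr y ++ repr z))).
  exact: tens_cat (tens_refl _) (repr_tensor_of _).
rewrite catA; apply: tens_cat (tens_refl _).
exact/tens_sym/repr_tensor_of.
Qed.

Lemma tensor_add0 : left_id (tensor_of [::]) tensor_add.
Proof.
move=> x; rewrite -[RHS]reprK; apply/tensor_ofP.
exact: tens_cat (repr_tensor_of [::]) (tens_refl _).
Qed.

Lemma tensor_addN : left_inverse (tensor_of [::]) tensor_opp tensor_add.
Proof.
move=> x; apply/tensor_ofP; apply: tens_trans (tens_oppl (repr x)).
exact: tens_cat (repr_tensor_of _) (tens_refl _).
Qed.

HB.instance Definition _ := GRing.isZmodule.Build tensor
  tensor_addA tensor_addC tensor_add0 tensor_addN.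

Definition tens (v : V) (w : W) : tensor := tensor_of [:: (v, w)].

End Tensor.

Notation "v '⊗' w" := (tens v w) (at level 40, left associativity) : ring_scope.

Section QuantumPermutations.
Variables (R : realType) (N : nat).

Definition magic_unitary (A : cstarType R) (u : 'I_N -> 'I_N -> A) :=
  [/\ forall i j, star (u i j) = u i j,
      forall i j, u i j * u i j = u i j,
      forall k, \sum_i u i k = 1
    & forall k, \sum_j u k j = 1].

(* $C(S_N^+)$, given by its universal property, which determines it up to a
   unique isomorphism preserving the generators. *)
Record quantum_permutation_algebra := QuantumPermutationAlgebra {
  qperm_car :> cstarType R;
  qperm_gen : 'I_N -> 'I_N -> qperm_car;
  qperm_magic : magic_unitary qperm_gen;
  qperm_universal : forall (D : cstarType R) (v : 'I_N -> 'I_N -> D),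
    magic_unitary v ->
    exists f : {lrmorphism qperm_car -> D},
      [/\ forall a, f (star a) = star (f a),
          forall i j, f (qperm_gen i j) = v i j
        & forall g : {lrmorphism qperm_car -> D},
            (forall a, g (star a) = star (g a)) ->
            (forall i j, g (qperm_gen i j) = v i j) -> g =1 f]
}.

End QuantumPermutations.

Inductive face := lface | rface.

Definition is_left (c : face) := if c is lface then true else false.

(* The one-line notation of the permutation $s_\chi$. *)
Definition s_chi n (chi : 'I_n -> face) : seq 'I_n :=
  [seq i <- enum 'I_n | is_left (chi i)] ++
  rev [seq i <- enum 'I_n | ~~ is_left (chi i)].

Definition u_chi (R : realType) N (CS : quantum_permutation_algebra R N) n
    (chi : 'I_n -> face) (I J : 'I_n -> 'I_N) : CS :=
  \prod_(i <- s_chi chi) qperm_gen CS (I i) (J i).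

(* The two faces of a family of pairs are indexed by [face], and the index set
   $\{1,\dots,N\}$ is shifted to $\{0,\dots,N-1\}$. *)
Section Families.
Variables (R : realType) (H : hilbertType R) (x : face -> nat -> bop H).

Definition word n (chi : 'I_n -> face) (j : 'I_n -> nat) : bop H :=
  \prod_(i < n) x (chi i) (j i).

Definition bword n (b : 'I_n.+1 -> bop H) (chi : 'I_n -> face)
    (j : 'I_n -> nat) : bop H :=
  (\prod_(i < n) (b (widen_ord (leqnSn n) i) * x (chi i) (j i))) * b ord_max.

Definition quantum_bi_exchangeable
    (CS : forall N, quantum_permutation_algebra R N) (phi : bop H -> R[i]) :=
  forall N n (chi : 'I_n -> face) (J : {ffun 'I_n -> 'I_N}),
    phi (word chi (fun i => J i)) *: (1 : CS N)
    = \sum_(I : {ffun 'I_n -> 'I_N}) phi (word chi (fun i => I i)) *: u_chi (CS N) chi I J.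

Definition quantum_bi_invariant
    (CS : forall N, quantum_permutation_algebra R N)
    (B : set (bop H)) (E : bop H -> bop H) :=
  forall N n (chi : 'I_n -> face) (J : {ffun 'I_n -> 'I_N})
      (b : 'I_n.+1 -> bop H), (forall i, B (b i)) ->
    E (bword b chi (fun i => J i)) ⊗ (1 : CS N)
    = \sum_(I : {ffun 'I_n -> 'I_N}) E (bword b chi (fun i => I i)) ⊗ u_chi (CS N) chi I J.

Definition variables_from (n : nat) : set (bop H) :=
  [set T | exists c j, (n <= j)%N /\ T = x c j].

Definition tail_algebra : set (bop H) := \bigcap_n Wstar (variables_from n).

Definition face_algebra (B : set (bop H)) (c : face) (j : nat) :=
  generated_algebra (B `|` [set x c j]).

End Families.

(* Main.v *)
(* Writing [M] for the von Neumann algebra of all the variables, quantum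
   bi-exchangeability extends, by normality, from moments in the variables to
   moments with coefficients in the algebra of the variables of index at least
   [N]: one applies the relations of $C(S_{N+k}^+)$ to $u \oplus 1$.  For
   permutation matrices this says that finite permutations of the indices,
   fixing the tail algebra [B], preserve [phi] on the algebra generated by [B]
   and the variables; since [phi] is nondegenerate, they are well-defined and
   isometric there.  The conditional expectation is the weak limit, along an
   ultrafilter, of the translates of an element by permutations sending
   [0, k) to [k, 2k).  It need not be weakly continuous, but
   [phi (y E(T) z) = phi (y T_k z)] for all large [k], and as the numbers
   [phi (y . z)] separate the points of [M], both (1) and (2) become identities
   between moments; (2) only uses transpositions sending the last index to
   infinity. *)
Require Import Defs.
From HB Require Import structures.
From mathcomp Require Import all_boot all_order all_algebra complex.
From mathcomp Require Import boolp classical_sets functions reals topology.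
From mathcomp Require Import normedtype sequences.
From mathcomp Require Import zify ring lra.

Set Implicit Arguments.
Unset Strict Implicit.
Unset Printing Implicit Defensive.

Import Order.TTheory GRing.Theory Num.Theory.
Import numFieldNormedType.Exports.

Local Open Scope classical_set_scope.
Local Open Scope ring_scope.

(** * Hilbert spaces as real forms *)

Section ComplexModulus.
Variable R : realType.
Implicit Types z : R[i].

(** Three obstacles shape the argument. The expectation need not be normal, so its values cannot be
    found by approximating its argument. Instead invariance moves the permutation off T: with y_k
    and z_k the translates of y and z, phi (y E(T) z) = phi (y_k T z_k). The word T is then
    untouched, while y_k and z_k lie among the far variables and the tail; this is why
    exchangeability is wanted with such coefficients. Next, approximating a coefficient comes with
    no bound on the norms of the approximants. A normal functional is dominated by finitely many
    numbers |<(T ⊗ 1) v, w>| with v and w square-summable, and density in the bicommutant is proved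
    for finitely many such v at once; each approximation is therefore made against fixed operators.
    Last, the norm on M is reached from phi through order: [nb c T] amounts to positivity of c^2 -
    T^* T, and positivity of a self-adjoint S in M is tested on the numbers phi (V^* S V), by means
    of square roots that stay in M. *)

Definition nc z : R := complex.Re `|z|.

Lemma ncE z : `|z| = (nc z)%:C%C.
Proof. by rewrite /nc normc_def. Qed.

Lemma nc_ge0 z : 0 <= nc z.
Proof. by rewrite -ler0c -ncE. Qed.

Lemma nc_lt z (a : R) : (`|z| < a%:C%C) = (nc z < a).
Proof. by rewrite ncE ltcR. Qed.

Lemma ncD y z : nc (y + z) <= nc y + nc z.
Proof. by rewrite -lecR rmorphD /= -!ncE ler_normD. Qed.

Lemma ncM y z : nc (y * z) = nc y * nc z.
Proof. by apply: complexI; rewrite rmorphM /= -!ncE normrM. Qed.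

Lemma nc_real (a : R) : nc a%:C%C = `|a|.
Proof. by rewrite /nc normc_def /= expr0n addr0 sqrtr_sqr. Qed.

Lemma nc0 : nc 0 = 0.
Proof. by rewrite /nc normr0. Qed.

Lemma nc_eq0 z : nc z <= 0 -> z = 0.
Proof.
move=> z0; apply/eqP; rewrite -normr_eq0 ncE.
by have -> : nc z = 0 by apply/eqP; rewrite eq_le z0 nc_ge0.
Qed.

Lemma sqr_nc z : nc z ^+ 2 = complex.Re z ^+ 2 + complex.Im z ^+ 2.
Proof. by apply: complexI; rewrite add_Re2_Im2 rmorphXn /= -ncE. Qed.

Lemma Re_nc z : `|complex.Re z| <= nc z.
Proof. by rewrite -lecR -ncE normc_ge_Re. Qed.

Lemma nc_ReIm z : nc z <= `|complex.Re z| + `|complex.Im z|.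
Proof.
rewrite -ler_sqr ?nnegrE ?nc_ge0 ?addr_ge0// sqr_nc sqrrD !real_normK ?num_real//.
have := mulr_ge0 (normr_ge0 (complex.Re z)) (normr_ge0 (complex.Im z)).
by set a := _ * _ => a0; lra.
Qed.

Lemma complex_decomp z :
  z = (complex.Re z)%:C%C + (complex.Im z)%:C%C * 'i%C.
Proof. by rewrite {1}[z]complexE mulrC. Qed.

Lemma ReB (y z : R[i]) : complex.Re (y - z) = complex.Re y - complex.Re z.
Proof. by case: y z => a b [c d]. Qed.

Lemma ImB (y z : R[i]) : complex.Im (y - z) = complex.Im y - complex.Im z.
Proof. by case: y z => a b [c d]. Qed.

Lemma Im_nc (z : R[i]) : `|complex.Im z| <= nc z.
Proof.
rewrite -ler_sqr ?nnegrE ?nc_ge0// sqr_nc real_normK ?num_real//.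
by rewrite lerDr sqr_ge0.
Qed.

Lemma Re_real_imag (a b : R) : complex.Re (a%:C%C + b%:C%C * 'i%C) = a.
Proof. by rewrite /=; ring. Qed.

Lemma Im_real_imag (a b : R) : complex.Im (a%:C%C + b%:C%C * 'i%C) = b.
Proof. by rewrite /=; ring. Qed.

End ComplexModulus.

(** Letting t tend to 0. It serves first-variation arguments and all estimates of the form error
    times a fixed constant. *)
Lemma quadratic_small (R : realType) (a b : R) :
  0 <= a -> (forall t : R, 0 < t -> b <= t * a) -> b <= 0.
Proof.
move=> a0 h; rewrite leNgt; apply/negP => b0.
have a1 : 0 < a + 1 by rewrite ltr_wpDl.
have := h (b / (2 * (a + 1))); rewrite divr_gt0 ?mulr_gt0// => /(_ isT).
have -> : b / (2 * (a + 1)) * a = b * (a / (2 * (a + 1))) by ring.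
have q1 : a / (2 * (a + 1)) < 1 by rewrite ltr_pdivrMr ?mulr_gt0//; lra.
by rewrite leNgt => /negP[]; rewrite gtr_pMr.
Qed.

Section RealForms.
Variables (R : realType) (V : lmodType R[i]) (ip : V -> V -> R).

(** The real part of a complex inner product, kept abstract so that projections and Riesz
    representation apply both to [H] and to the square-summable sequences in [H]. The complex
    structure enters through [ip_i] alone. *)
Record hilbert_form : Prop := HilbertForm {
  ipDl : forall u v w, ip (u + v) w = ip u w + ip v w;
  ipZl : forall (a : R) v w, ip (a%:C%C *: v) w = a * ip v w;
  ipC : forall v w, ip v w = ip w v;
  ip_i : forall v w, ip ('i%C *: v) ('i%C *: w) = ip v w;
  ip_ge0 : forall v, 0 <= ip v v;
  ip_complete : forall a : nat -> V,
    (forall e : R, 0 < e -> exists n, forall p q, (n <= p)%N -> (n <= q)%N ->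
       ip (a p - a q) (a p - a q) < e) ->
    exists l, forall e : R, 0 < e ->
      exists n, forall p, (n <= p)%N -> ip (a p - l) (a p - l) < e
}.

Hypothesis h : hilbert_form.

Definition nrm v : R := Num.sqrt (ip v v).

Lemma ip0l w : ip 0 w = 0.
Proof. by have := ipZl h 0 0 w; rewrite mul0r scaler0. Qed.

Lemma ip0r w : ip w 0 = 0.
Proof. by rewrite ipC// ip0l. Qed.

Lemma ipNl v w : ip (- v) w = - ip v w.
Proof. by apply/eqP; rewrite -addr_eq0 -ipDl// addNr ip0l. Qed.

Lemma ipNr v w : ip v (- w) = - ip v w.
Proof. by rewrite ipC// ipNl (ipC h). Qed.

Lemma ipDr u v w : ip u (v + w) = ip u v + ip u w.
Proof. by rewrite ipC// ipDl// !(ipC h _ u). Qed.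

Lemma ipBl u v w : ip (u - v) w = ip u w - ip v w.
Proof. by rewrite ipDl// ipNl. Qed.

Lemma ipBr u v w : ip u (v - w) = ip u v - ip u w.
Proof. by rewrite ipDr ipNr. Qed.

Lemma ipZr (a : R) v w : ip v (a%:C%C *: w) = a * ip v w.
Proof. by rewrite ipC// ipZl// (ipC h). Qed.

Lemma ip_il v w : ip ('i%C *: v) w = - ip v ('i%C *: w).
Proof.
by rewrite -[w in LHS]opprK ipNr -[- w]scaleN1r -sqr_i expr2 -scalerA ip_i.
Qed.

Lemma ip_vi v : ip v ('i%C *: v) = 0.
Proof. by have := ip_il v v; rewrite ipC//; lra. Qed.

Lemma ip_suml I (r : seq I) (F : I -> V) w :
  ip (\sum_(i <- r) F i) w = \sum_(i <- r) ip (F i) w.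
Proof.
elim: r => [|i r ih]; first by rewrite !big_nil ip0l.
by rewrite !big_cons ipDl// ih.
Qed.

Lemma nrm_ge0 v : 0 <= nrm v. Proof. exact: sqrtr_ge0. Qed.

Lemma nrm2 v : nrm v ^+ 2 = ip v v.
Proof. by rewrite sqr_sqrtr// ip_ge0. Qed.

Lemma nrm_le v (c : R) : 0 <= c -> (nrm v <= c) = (ip v v <= c ^+ 2).
Proof. by move=> c0; rewrite -nrm2 ler_sqr ?nnegrE ?nrm_ge0. Qed.

Lemma nrm0 : nrm 0 = 0.
Proof. by rewrite /nrm ip0l sqrtr0. Qed.

Lemma nrmN v : nrm (- v) = nrm v.
Proof. by rewrite /nrm ipNl ipNr opprK. Qed.

Lemma nrm_distC v w : nrm (v - w) = nrm (w - v).
Proof. by rewrite -nrmN opprB. Qed.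

Lemma nrmZ c v : nrm (c *: v) = nc c * nrm v.
Proof.
rewrite -[nc c]ger0_norm ?nc_ge0// -sqrtr_sqr -sqrtrM ?sqr_ge0//.
congr Num.sqrt; rewrite sqr_nc {1 2}[c]complex_decomp scalerDl -!scalerA.
rewrite ipDl// !ipDr !ipZl// !ipZr ip_i// ip_il ip_vi.
by ring.
Qed.

Lemma ip_sqr_le v w : ip v w ^+ 2 <= ip v v * ip w w.
Proof.
have q t : 0 <= ip v v - 2 * t * ip v w + t ^+ 2 * ip w w.
  have := ip_ge0 h (v - t%:C%C *: w).
  rewrite ipBl !ipBr !ipZl// !ipZr (ipC h w v).
  by congr (0 <= _); ring.
have [w0|w0] := eqVneq (ip w w) 0; last first.
  have wp : 0 < ip w w by rewrite lt_def w0 ip_ge0.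
  have := q (ip v w / ip w w).
  have -> : ip v v - 2 * (ip v w / ip w w) * ip v w
      + (ip v w / ip w w) ^+ 2 * ip w w = ip v v - ip v w ^+ 2 / ip w w.
    by field.
  by rewrite subr_ge0 ler_pdivrMr.
(* With [ip w w = 0] the quadratic is affine in t; at this t it equals -1 unless [ip v w = 0]. *)
have := q (ip v w * (ip v v + 1) / 2 / (ip v w ^+ 2)).
rewrite w0 !mulr0 addr0.
have [->|vw0] := eqVneq (ip v w) 0; first by rewrite expr0n.
have -> : 2 * (ip v w * (ip v v + 1) / 2 / ip v w ^+ 2) * ip v w
  = ip v v + 1 by field.
by lra.
Qed.

Lemma ip_le v w : `|ip v w| <= nrm v * nrm w.
Proof.
rewrite -ler_sqr ?nnegrE ?mulr_ge0 ?nrm_ge0// real_normK ?num_real//.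
by rewrite exprMn !nrm2 ip_sqr_le.
Qed.

Lemma nrmD v w : nrm (v + w) <= nrm v + nrm w.
Proof.
rewrite nrm_le ?addr_ge0 ?nrm_ge0// ipDl// !ipDr (ipC h w v) sqrrD !nrm2.
have := le_trans (ler_norm _) (ip_le v w); lra.
Qed.

Lemma nrmB v w : nrm (v - w) <= nrm v + nrm w.
Proof. by rewrite (le_trans (nrmD _ _))// nrmN. Qed.

Lemma nrm_le_dual v (c : R) : 0 <= c ->
  (forall w, ip v w <= c * nrm w) -> nrm v <= c.
Proof.
move=> c0 /(_ v); rewrite -nrm2 expr2.
have [->|v0] := eqVneq (nrm v) 0; first by rewrite c0.
by rewrite ler_pM2r// lt_def v0 nrm_ge0.
Qed.

Definition nclosed (L : V -> Prop) := forall v,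
  (forall e : R, 0 < e -> exists2 l, L l & nrm (v - l) < e) -> L v.

(** A minimizing sequence is Cauchy by the parallelogram law, and its limit is orthogonal by first
    variation. Closure under real scalars is all that is asked of [L], so the kernel of a real
    functional is covered. *)
Lemma projection_exists (L : V -> Prop) (v : V) :
  L 0 -> (forall (a : R) u w, L u -> L w -> L (a%:C%C *: u + w)) -> nclosed L ->
  exists2 p, L p & forall l, L l -> ip (v - p) l = 0.
Proof.
move=> L0 Llin Lcl.
pose S := [set ip (v - l) (v - l) | l in [set l | L l]].
have Slb : has_inf S.
  split; first by exists (ip (v - 0) (v - 0)), 0.
  by exists 0 => _ [l _ <-]; exact: ip_ge0.
set d := inf S.
have dlb l : L l -> d <= ip (v - l) (v - l).
  by move=> Ll; apply: ge_inf; [case: Slb|exists l].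
have LD u w : L u -> L w -> L (u + w).
  by move=> Lu Lw; rewrite -[u]scale1r; exact: (Llin 1).
have LZ (a : R) u : L u -> L (a%:C%C *: u).
  by move=> Lu; rewrite -[_ *: _]addr0; exact: Llin.
have /choice[a aP] : forall n : nat, exists l, L l /\
    ip (v - l) (v - l) < d + n.+1%:R^-1.
  move=> n; have [|_ [l Ll <-] lt] := @inf_adherent _ S n.+1%:R^-1 _ Slb.
    by rewrite invr_gt0.
  by exists l.
(* The parallelogram law, the midpoint of u and w being at squared distance at least d from v. *)
have par u w : L u -> L w -> ip (u - w) (u - w) <=
    2 * (ip (v - u) (v - u) - d) + 2 * (ip (v - w) (v - w) - d).
  move=> Lu Lw.
  have := dlb _ (LZ 2^-1 _ (LD _ _ Lu Lw)).
  rewrite !(ipNl, ipNr, ipZl h, ipZr, ipDl h, ipDr).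
  rewrite (ipC h w u) (ipC h u v) (ipC h w v); lra.
have inv_small (e : R) : 0 < e -> exists n, forall p, (n <= p)%N ->
    p.+1%:R^-1 < e.
  move=> e0; exists (Num.trunc e^-1) => p np.
  rewrite invf_plt ?posrE//.
  apply: (lt_le_trans (truncnS_gt _)).
  by rewrite ler_nat ltnS.
have [|l lP] := ip_complete h (a := a).
  move=> e e0; have [n nP] := inv_small (e / 4) (ltac:(lra)).
  exists n => p q np nq; have [Lp p1] := aP p; have [Lq q1] := aP q.
  have := nP _ np; have := nP _ nq; move: p1 q1 (par _ _ Lp Lq).
  by move: (p.+1%:R^-1 : R) (q.+1%:R^-1 : R) => x y; lra.
have Ll : L l.
  apply: Lcl => e e0; have [n nP] := lP (e ^+ 2) (exprn_gt0 _ e0).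
  exists (a n); first by case: (aP n).
  rewrite nrm_distC -ltr_sqr ?nnegrE ?nrm_ge0 ?(ltW e0)// nrm2; exact: nP.
have ld : nrm (v - l) <= Num.sqrt d.
  apply/ler_addgt0Pr => e e0.
  have d0 : 0 <= d by apply: lb_le_inf; [case: Slb|move=> _ [? _ <-]; exact: ip_ge0].
  have e2 : 0 < e / 2 by lra.
  have [n1 n1P] := lP ((e / 2) ^+ 2) (exprn_gt0 _ e2).
  have [n2 n2P] := inv_small ((e / 2) ^+ 2) (exprn_gt0 _ e2).
  pose n := maxn n1 n2.
  have [Ln bn] := aP n.
  have h1 : nrm (a n - l) <= e / 2.
    rewrite nrm_le; last lra.
    exact/ltW/n1P/leq_maxl.
  have h2 : nrm (v - a n) <= Num.sqrt d + e / 2.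
    rewrite nrm_le; last by rewrite addr_ge0 ?sqrtr_ge0//; lra.
    rewrite sqrrD sqr_sqrtr//.
    have := n2P n (leq_maxr _ _); move: bn; move: (n.+1%:R^-1 : R) => z bn.
    have : 0 <= Num.sqrt d * (e / 2) by rewrite mulr_ge0 ?sqrtr_ge0//; lra.
    set x := Num.sqrt d * _; set y := (e / 2) ^+ 2.
    lra.
  have := nrmD (v - a n) (a n - l).
  rewrite addrA subrK; lra.
exists l => // w Lw.
have d0 : 0 <= d by apply: lb_le_inf; [case: Slb|move=> _ [? _ <-]; exact: ip_ge0].
have ld2 : ip (v - l) (v - l) <= d.
  by rewrite -nrm2 -[leRHS]sqr_sqrtr// ler_sqr ?nnegrE ?nrm_ge0 ?sqrtr_ge0.
(* First variation: moving l by t w' within [L] cannot decrease the distance to v. It is used below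
   for w and for - w. *)
have key (t : R) w' : L w' -> 0 < t -> 2 * ip (v - l) w' <= t * ip w' w'.
  move=> Lw' t0.
  have := dlb _ (LD _ _ Ll (LZ t _ Lw')).
  rewrite opprD addrA; move: (v - l) ld2 => u ld2.
  rewrite !(ipNl, ipNr, ipZl h, ipZr, ipDl h, ipDr) (ipC h w' u) => H.
  have {H} H : 2 * t * ip u w' <= t * (t * ip w' w') by lra.
  by rewrite -(ler_pM2l t0) (le_trans _ H)//; lra.
apply/eqP; rewrite eq_le; apply/andP; split.
  have := quadratic_small (ip_ge0 h w) (fun t => key t w Lw); lra.
have LNw : L (- w) by rewrite -scaleN1r; have := LZ (-1) w Lw; rewrite rmorphN1.
have := quadratic_small (ip_ge0 h (- w)) (fun t => key t _ LNw).
rewrite ipNr; lra.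
Qed.

(** The bound makes the kernel of f closed, so a vector outside it has a component u orthogonal to
    the kernel. Subtracting from v the multiple of u with the same value of f lands in the kernel,
    which makes f proportional to [ip u]. *)
Lemma riesz_real (f : V -> R) (c : R) : 0 <= c ->
  (forall u v, f (u + v) = f u + f v) ->
  (forall (a : R) v, f (a%:C%C *: v) = a * f v) ->
  (forall v, `|f v| <= c * nrm v) ->
  exists w, forall v, f v = ip w v.
Proof.
move=> c0 fD fZ fb.
have [f0|] := pselect (forall v, f v = 0).
  by exists 0 => v; rewrite ip0l f0.
move=> /existsNP[v0 /eqP fv0].
have fB u v : f (u - v) = f u - f v.
  by rewrite fD -scaleN1r; have := fZ (-1) v; rewrite rmorphN1 => ->; rewrite mulN1r.
have f00 : f 0 = 0 by have := fZ 0 0; rewrite mul0r scaler0.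
have [p fp pP] : exists2 p, f p = 0 & forall l, f l = 0 -> ip (v0 - p) l = 0.
  apply: projection_exists => //.
    by move=> a u w fu fw; rewrite fD fZ fu fw mulr0 addr0.
  move=> v vP; apply/eqP; rewrite -normr_le0; apply/ler_addgt0Pr => e e0.
  have c1 : 0 < c + 1 by lra.
  have [l fl vl] := vP (e / (c + 1)) (divr_gt0 e0 c1).
  have := fb (v - l); rewrite fB fl subr0 add0r => /le_trans; apply.
  rewrite (le_trans (ler_wpM2l c0 (ltW vl)))// mulrCA ler_piMr ?(ltW e0)//.
  by rewrite ler_pdivrMr//; lra.
set u := v0 - p in pP.
have fu : f u != 0 by rewrite fB fp subr0.
have uu : ip u u != 0.
  apply: contra fu => /eqP uu; rewrite -normr_le0 (le_trans (fb _))//.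
  by rewrite /nrm uu sqrtr0 mulr0.
exists ((f u / ip u u)%:C%C *: u) => v; rewrite ipZl//.
have := pP (v - (f v / f u)%:C%C *: u).
rewrite fB fZ -mulrA mulVf// mulr1 subrr => /(_ erefl).
rewrite ipBr ipZr => /eqP; rewrite subr_eq0 => /eqP ->.
by field; rewrite fu uu.
Qed.

End RealForms.

(** * Limits along an ultrafilter *)

(** It contains every tail of the integers, so whatever holds eventually holds along it; being an
    ultrafilter, it gives every bounded sequence a limit, without extraction of subsequences. *)
Definition nat_ultra : set_system nat :=
  sval (cid (ultraFilterLemma eventually_filter)).

Instance nat_ultra_ultra : UltraFilter nat_ultra.
Proof. by rewrite /nat_ultra; case: cid => U []. Qed.

Lemma nat_ultra_eventually : \oo `<=` nat_ultra.
Proof. by rewrite /nat_ultra; case: cid => U []. Qed.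

Section UltraLimit.
Variable R : realType.
Implicit Types a b : nat -> R.

Definition ulim a : R := lim (a @ nat_ultra).

Definition bnd a := exists C, forall n, `|a n| <= C.

(** The image of an ultrafilter is an ultrafilter, and on the compact segment from -C to C it must
    converge. *)
Lemma ulim_cvg a : bnd a -> a @ nat_ultra --> ulim a.
Proof.
move=> [C aC].
have : compact `[- C, C]%classic by exact: segment_compact.
rewrite compact_ultra => /(_ (a @ nat_ultra)) [||x [_ ax]].
- split; first exact: fmap_proper_filter.
  move=> G PG aG; apply/seteqP; split=> // A GA.
  have [//|NA] : nat_ultra (a @^-1` A) \/ nat_ultra (~` (a @^-1` A)).
    exact: in_ultra_setVsetC.
  have : G (A `&` ~` A) by apply: filterI => //; apply: aG.
  by rewrite setICr => /filter_ex[].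
- apply: (@filterS _ nat_ultra _ setT); last exact: filterT.
  by move=> n _ /=; rewrite in_itv /= -ler_norml.
- by apply/cvg_ex; exists x.
Qed.

Lemma ulim_unique a l : a @ nat_ultra --> l -> ulim a = l.
Proof. by move/cvg_lim; apply. Qed.

Lemma cvg_ulim a l : a @ \oo --> l -> ulim a = l.
Proof.
move=> al; apply: ulim_unique => A /al aA; exact: nat_ultra_eventually.
Qed.

Lemma ulim_near a l : (exists m, forall n, (m <= n)%N -> a n = l) -> ulim a = l.
Proof.
move=> [m am]; apply: cvg_ulim; apply/cvgrPdist_lt => e e0; exists m => // n /= mn.
by rewrite am// subrr normr0.
Qed.

Lemma ulim_ext a b : (exists m, forall n, (m <= n)%N -> a n = b n) ->
  bnd a -> ulim a = ulim b.
Proof.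
move=> [m ab] ba; apply/esym/ulim_unique => A /(ulim_cvg ba) aA.
have : nat_ultra [set n | (m <= n)%N] by apply: nat_ultra_eventually; exists m.
have {}aA : nat_ultra (a @^-1` A) := aA.
move=> nm; change (nat_ultra (b @^-1` A)).
by apply: filterS2 aA nm => n /= aAn mn; rewrite -ab.
Qed.

Lemma bnd_cst c : bnd (fun=> c).
Proof. by exists `|c|. Qed.

Lemma ulimD a b : bnd a -> bnd b ->
  ulim (fun n => a n + b n) = ulim a + ulim b.
Proof. by move=> ba bb; apply: ulim_unique; apply: cvgD; exact: ulim_cvg. Qed.

Lemma ulimZ c a : bnd a -> ulim (fun n => c * a n) = c * ulim a.
Proof.
by move=> ba; apply: ulim_unique; apply: cvgM; [exact: cvg_cst|exact: ulim_cvg].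
Qed.

Lemma ulim_cst c : ulim (fun=> c) = c.
Proof. by apply: ulim_near; exists 0%N. Qed.

Lemma ulim_le a b : (exists m, forall n, (m <= n)%N -> a n <= b n) ->
  bnd a -> bnd b -> ulim a <= ulim b.
Proof.
move=> [m ab] ba bb; rewrite -subr_ge0.
apply: cvgr_to_ge (cvgB (ulim_cvg bb) (ulim_cvg ba)) _.
by apply: nat_ultra_eventually; exists m => // n /= /ab; rewrite subr_ge0.
Qed.

Lemma ulim_norm_le a (C : R) : (forall n, `|a n| <= C) -> `|ulim a| <= C.
Proof.
move=> aC; have ba : bnd a by exists C.
rewrite ler_norml; apply/andP; split.
- rewrite -[leLHS]ulim_cst; apply: ulim_le => //; last exact: bnd_cst.
  by exists 0%N => n _; move: (aC n); rewrite ler_norml => /andP[].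
- rewrite -[leRHS]ulim_cst; apply: ulim_le => //; last exact: bnd_cst.
  by exists 0%N => n _; move: (aC n); rewrite ler_norml => /andP[].
Qed.

End UltraLimit.

(** * Bounded operators, adjoints and weak limits *)

Section HilbertSpace.
Variables (R : realType) (H : hilbertType R).
Implicit Types (v w : H) (S T : bop H).

(** Only the real part of the inner product is carried through the proof; [dot_hd] recovers the
    complex value by rotating the second argument. *)
Definition hd v w : R := complex.Re (dot v w).

Lemma dotDl (u v w : H) : dot (u + v) w = dot u w + dot v w.
Proof. by have := dot_linearl 1 u v w; rewrite scale1r mul1r. Qed.

Lemma dot0l (w : H) : dot 0 w = 0.
Proof. by apply: (addrI (dot 0 w)); rewrite -dotDl !addr0. Qed.

Lemma dotZl c v w : dot (c *: v) w = c * dot v w.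
Proof. by rewrite -[_ *: v]addr0 dot_linearl dot0l addr0. Qed.

Lemma conj_conjc (z : R[i]) : z^* = conjc z.
Proof. reflexivity. Qed.

Lemma Re_conj (z : R[i]) : complex.Re z^* = complex.Re z.
Proof. by rewrite conj_conjc; case: z => a b. Qed.

Lemma Im_dot v w : complex.Im (dot v w) = hd v ('i%C *: w).
Proof.
rewrite /hd (dot_conj ('i%C *: w) v) dotZl (dot_conj v w) !conj_conjc.
by case: (dot v w) => a b /=; rewrite !mul0r !mul1r sub0r !opprK.
Qed.

Lemma dot_hd v w : dot v w = (hd v w)%:C%C + (hd v ('i%C *: w))%:C%C * 'i%C.
Proof. by rewrite -Im_dot {1}[dot v w]complex_decomp. Qed.

Lemma hdvv v : hd v v = complex.Re `|v| ^+ 2.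
Proof.
rewrite /hd dot_norm.
have /complex_realP[r ->] : `|v| \is Num.real by rewrite normr_real.
by rewrite -rmorphXn.
Qed.

Lemma norm_Re v : `|v| = (complex.Re `|v|)%:C%C.
Proof. by rewrite RRe_real// normr_real. Qed.

Lemma Re_norm_ge0 v : 0 <= complex.Re `|v|.
Proof. by rewrite -ler0c -norm_Re. Qed.

Lemma hd_form : hilbert_form hd.
Proof.
split=> [u v w|a v w|v w|v w|v|a aC].
- by rewrite /hd dotDl; case: (dot u w); case: (dot v w).
- by rewrite /hd dotZl; case: (dot v w) => x y /=; rewrite mul0r subr0.
- by rewrite /hd dot_conj Re_conj.
- by rewrite -Im_dot dotZl /hd; case: (dot v w) => x y /=; rewrite mul0r mul1r add0r.
- by rewrite hdvv sqr_ge0.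
have : cauchy (a @ \oo).
  apply/cauchy_ballP => e e0.
  have /complex_realP[r er] : e \is Num.real by rewrite gtr0_real.
  move: e0; rewrite er ltcR => r0.
  have [n nP] := aC (r ^+ 2) (exprn_gt0 _ r0).
  exists ((a @` [set k | (n <= k)%N]), (a @` [set k | (n <= k)%N])).
    by split; exists n => // k /= nk; exists k.
  move=> [_ _] /= [[p np <-] [q nq <-]]; rewrite -ball_normE /=.
  rewrite norm_Re ltcR.
  have := nP _ _ np nq; rewrite hdvv ltr_sqr ?nnegrE ?Re_norm_ge0//.
  exact: ltW.
move=> /cauchy_cvg al; exists (lim (a @ \oo)) => e e0.
move/cvgrPdist_lt : al => /(_ (Num.sqrt e)%:C%C).
rewrite ltcR sqrtr_gt0 => /(_ e0) [n _ nP]; exists n => p /nP /=.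
rewrite distrC norm_Re ltcR hdvv => lt.
rewrite -[ltRHS]sqr_sqrtr ?(ltW e0)// ltr_sqr ?nnegrE ?Re_norm_ge0//.
exact: sqrtr_ge0.
Qed.

Local Notation hH := hd_form.
Definition hn := nrm hd.

Lemma hnE v : `|v| = (hn v)%:C%C.
Proof.
by rewrite norm_Re /hn /nrm hdvv sqrtr_sqr ger0_norm// Re_norm_ge0.
Qed.

Lemma hn_eq0 v : hn v <= 0 -> v = 0.
Proof.
move=> v0; apply/eqP; rewrite -normr_eq0 hnE.
by have -> : hn v = 0 by apply/eqP; rewrite eq_le v0 nrm_ge0.
Qed.

Lemma hd_eq v w : (forall u, hd v u = hd w u) -> v = w.
Proof.
move=> vw; apply/eqP; rewrite -subr_eq0; apply/eqP/hn_eq0.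
by rewrite /hn /nrm (ipBl hH) vw subrr sqrtr0.
Qed.

(** Bounds are stated by this inequality; the supremum [opnorm] comes back only for the norm clauses
    of a conditional expectation. *)
Definition nb (c : R) T := forall v, hn (T v) <= c * hn v.

Lemma bopD (S T : bop H) v : (S + T) v = S v + T v. Proof. by []. Qed.
Lemma bopN (T : bop H) v : (- T) v = - T v. Proof. by []. Qed.
Lemma bopB (S T : bop H) v : (S - T) v = S v - T v. Proof. by []. Qed.
Lemma bopZ c (T : bop H) v : (c *: T) v = c *: T v. Proof. by []. Qed.
Lemma bopM (S T : bop H) v : (S * T) v = S (T v). Proof. by []. Qed.
Lemma bop1 v : (1 : bop H) v = v. Proof. by []. Qed.
Lemma bop0 v : (0 : bop H) v = 0. Proof. by []. Qed.

Lemma bop_add T v w : T (v + w) = T v + T w.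
Proof. by have := bop_linear T 1 v w; rewrite !scale1r. Qed.

Lemma bop_zero T : T 0 = 0.
Proof. by apply: (addrI (T 0)); rewrite -bop_add !addr0. Qed.

Lemma bop_scale T c v : T (c *: v) = c *: T v.
Proof. by have := bop_linear T c v 0; rewrite bop_zero !addr0. Qed.

Lemma bop_opp T v : T (- v) = - T v.
Proof. by rewrite -scaleN1r bop_scale scaleN1r. Qed.

Lemma bop_sub T v w : T (v - w) = T v - T w.
Proof. by rewrite bop_add bop_opp. Qed.

Lemma bop_scaleAl c (S T : bop H) : c *: (S * T) = (c *: S) * T.
Proof. exact: bopP. Qed.

Lemma bop_scaleAr c (S T : bop H) : c *: (S * T) = S * (c *: T).
Proof. by apply: bopP => v; rewrite bopZ !bopM bopZ bop_scale. Qed.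

Lemma nb_exists T : exists2 c : R, 0 < c & nb c T.
Proof.
have /asboolP[_ [c fc]] := valP T; rewrite /= in fc.
(* The constant of [bounded_op] is a complex number without sign condition: the modulus makes it
   real, and adding 1 makes it positive. *)
exists (nc c + 1) => [|v]; first by rewrite ltr_wpDl ?nc_ge0.
rewrite /= -lecR rmorphM /= -!hnE.
have [->|v0] := eqVneq v 0.
  by have := fc 0; rewrite normr0 !mulr0.
have := fc v.
have vp : 0 < `|v| by rewrite normr_gt0.
move=> fcv; rewrite (le_trans fcv)// ler_wpM2r//.
have c0 : 0 <= c by rewrite -(pmulr_lge0 _ vp) (le_trans _ fcv).
by rewrite rmorphD /= -ncE ger0_norm// lerDl.
Qed.

Lemma nb_le c d T : c <= d -> nb c T -> nb d T.
Proof. by move=> cd Tc v; rewrite (le_trans (Tc v))// ler_wpM2r ?nrm_ge0. Qed.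

Lemma nbM c d S T : 0 <= c -> nb c S -> nb d T -> nb (c * d) (S * T).
Proof.
by move=> c0 Sc Td v; rewrite bopM (le_trans (Sc _))// -mulrA ler_wpM2l.
Qed.

Lemma nbD c d S T : nb c S -> nb d T -> nb (c + d) (S + T).
Proof.
move=> Sc Td v; rewrite bopD (le_trans (nrmD hH _ _))// mulrDl.
by rewrite lerD.
Qed.

Lemma nbZ a c T : nb c T -> nb (nc a * c) (a *: T).
Proof.
move=> Tc v; by rewrite bopZ /hn (nrmZ hH) -mulrA ler_wpM2l ?nc_ge0.
Qed.

Lemma nbN c T : nb c T -> nb c (- T).
Proof. by move=> Tc v; rewrite bopN /hn (nrmN hH); exact: Tc. Qed.

Lemma nb0 : nb 0 0.
Proof. by move=> v; rewrite mul0r bop0 /hn nrm0//; exact: hH. Qed.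

Lemma nb0_eq0 T : nb 0 T -> T = 0.
Proof. by move=> T0; apply: bopP => v; apply: hn_eq0; rewrite -(mul0r (hn v)). Qed.

Lemma nb_hd c T v w : 0 <= c -> nb c T -> `|hd (T v) w| <= c * hn v * hn w.
Proof.
by move=> c0 Tc; rewrite (le_trans (ip_le hH _ _))// ler_wpM2r ?nrm_ge0.
Qed.

(* Real-linear in each variable, so complex linearity of the represented
   operator is recovered from [q (i v) w = - q v (i w)]. *)
Lemma bop_of_form (q : H -> H -> R) (c : R) : 0 <= c ->
  (forall u v w, q (u + v) w = q u w + q v w) ->
  (forall u v w, q w (u + v) = q w u + q w v) ->
  (forall (a : R) v w, q (a%:C%C *: v) w = a * q v w) ->
  (forall (a : R) v w, q w (a%:C%C *: v) = a * q w v) ->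
  (forall v w, q ('i%C *: v) w = - q v ('i%C *: w)) ->
  (forall v w, `|q v w| <= c * hn v * hn w) ->
  exists2 T : bop H, nb c T & forall v w, q v w = hd (T v) w.
Proof.
move=> c0 qDl qDr qZl qZr qi qb.
have /choice[f fP] : forall v, exists u, forall w, q v w = hd u w.
  move=> v; apply: (riesz_real hH (c := c * hn v)) => //.
  by rewrite mulr_ge0 ?nrm_ge0.
have fD u v : f (u + v) = f u + f v.
  by apply: hd_eq => w; rewrite -fP qDl (ipDl hH) -!fP.
have fZ (a : R) v : f (a%:C%C *: v) = a%:C%C *: f v.
  by apply: hd_eq => w; rewrite -fP qZl (ipZl hH) -!fP.
have fi v : f ('i%C *: v) = 'i%C *: f v.
  by apply: hd_eq => w; rewrite -fP qi (ip_il hH) -!fP.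
have fl : linear f.
  move=> a u v; rewrite fD; congr (_ + _).
  rewrite [a]complex_decomp !scalerDl fD fZ -!scalerA.
  by rewrite fZ fi.
have fb v : hn (f v) <= c * hn v.
  apply: (nrm_le_dual hH); first by rewrite mulr_ge0 ?nrm_ge0.
  by move=> w; rewrite -fP (le_trans (ler_norm _)).
have fB : f \in @bounded_op R H.
  apply/asboolP; split=> //; exists c%:C%C => v.
  by rewrite !hnE -rmorphM /= lecR.
by exists (Bop fB).
Qed.

Lemma hd_dot_adj T S : (forall v w, hd (T v) w = hd v (S w)) ->
  forall v w, dot (T v) w = dot v (S w).
Proof. by move=> TS v w; rewrite !dot_hd !TS bop_scale. Qed.

(** The bounded form [hd (T w) v] is represented by an operator, so the set in the definition of
    [adj] is inhabited and the default is never taken. *)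
Lemma adjP T v w : dot (T v) w = dot v (adj T w).
Proof.
suff : exists S : bop H, forall v w, dot (T v) w = dot v (S w).
  by move=> exS; move: v w; rewrite /adj; case: xgetP => [S _ //|nS]; case: exS => S /nS.
have [c c0 Tc] := nb_exists T.
have [|u v' w'|u v' w'|a v' w'|a v' w'|v' w'|v' w'|S _ SP] :=
  @bop_of_form (fun v w => hd (T w) v) c.
- exact: ltW.
- exact: ipDr hH _ _ _.
- by rewrite bop_add (ipDl hH).
- exact: ipZr hH _ _ _.
- by rewrite bop_scale (ipZl hH).
- by rewrite bop_scale (ip_il hH) opprK.
- by rewrite mulrAC; apply: nb_hd => //; exact: ltW.
by exists S; apply: hd_dot_adj => v' w'; rewrite SP (ipC hH).
Qed.

Lemma hd_adj T v w : hd (T v) w = hd v (adj T w).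
Proof. by rewrite /hd adjP. Qed.

Lemma hd_adjl T v w : hd (adj T v) w = hd v (T w).
Proof. by rewrite (ipC hH) -hd_adj (ipC hH). Qed.

Lemma adj_unique T S : (forall v w, hd (T v) w = hd v (S w)) -> adj T = S.
Proof.
move=> TS; apply: bopP => w; apply: hd_eq => v.
by rewrite hd_adjl (ipC hH) TS (ipC hH).
Qed.

Lemma adjK T : adj (adj T) = T.
Proof. by apply: adj_unique => v w; rewrite hd_adjl. Qed.

Lemma adjM S T : adj (S * T) = adj T * adj S.
Proof. by apply: adj_unique => v w; rewrite !bopM !hd_adj. Qed.

Lemma adj_one : adj 1 = 1 :> bop H.
Proof. exact: adj_unique. Qed.

Lemma adjD S T : adj (S + T) = adj S + adj T.
Proof.
by apply: adj_unique => v w; rewrite !bopD (ipDl hH) (ipDr hH) !hd_adj.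
Qed.

Lemma hd_conj (a : R[i]) v w : hd (a *: v) w = hd v (a^* *: w).
Proof.
rewrite conj_conjc {1}[a]complex_decomp; case: a => x y /=.
have -> : (x -i* y)%C = x%:C%C - y%:C%C * 'i%C.
  by apply/eqP; rewrite eq_complex /=; apply/andP; split; apply/eqP; ring.
rewrite !scalerDl scaleNr -!scalerA (ipDl hH) (ipBr hH) !(ipZl hH, ipZr hH).
by rewrite (ip_il hH) mulrN.
Qed.

Lemma adjZ a T : adj (a *: T) = a^* *: adj T.
Proof.
by apply: adj_unique => v w; rewrite !bopZ hd_conj hd_adj bop_scale.
Qed.

Lemma adjN T : adj (- T) = - adj T.
Proof. by apply: adj_unique => v w; rewrite !bopN (ipNl hH) (ipNr hH) hd_adj. Qed.

Lemma adjB S T : adj (S - T) = adj S - adj T.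
Proof. by rewrite adjD adjN. Qed.

Lemma nb_adj c T : 0 <= c -> nb c T -> nb c (adj T).
Proof.
move=> c0 Tc v; apply: (nrm_le_dual hH); first by rewrite mulr_ge0 ?nrm_ge0.
move=> w; rewrite hd_adjl (ipC hH) (le_trans (ler_norm _))//.
by rewrite mulrAC nb_hd.
Qed.

(** The ultrafilter limits of the matrix coefficients form a bounded form with the same bound c,
    which is represented by an operator. *)
Lemma weak_limit_exists (T : nat -> bop H) (c : R) : 0 <= c ->
  (forall k, nb c (T k)) ->
  exists2 S, nb c S & forall v w, hd (S v) w = ulim (fun k => hd (T k v) w).
Proof.
move=> c0 Tc.
have b v w : bnd (fun k => hd (T k v) w).
  by exists (c * hn v * hn w) => k; exact: nb_hd.
have [u v w|u v w|a v w|a v w|v w|v w|S Sc SP] :=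
  @bop_of_form (fun v w => ulim (fun k => hd (T k v) w)) c c0.
- rewrite -ulimD//; congr ulim; apply/funext => k.
  by rewrite bop_add (ipDl hH).
- by rewrite -ulimD//; congr ulim; apply/funext => k; rewrite (ipDr hH).
- by rewrite -ulimZ//; congr ulim; apply/funext => k; rewrite bop_scale (ipZl hH).
- by rewrite -ulimZ//; congr ulim; apply/funext => k; rewrite (ipZr hH).
- rewrite -mulN1r -ulimZ//; congr ulim; apply/funext => k.
  by rewrite bop_scale (ip_il hH) mulN1r.
- by apply: ulim_norm_le => k; exact: nb_hd.
by exists S => // v w; rewrite -SP.
Qed.

Lemma opnorm_has_sup T :
  has_sup [set complex.Re `|T v| | v in [set v | `|v| <= 1]].
Proof.
split; first by exists (complex.Re `|T 0|), 0; rewrite //= normr0.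
have [c c0 Tc] := nb_exists T.
exists c => _ [v /= v1 <-]; rewrite hnE /= (le_trans (Tc v))//.
by rewrite ler_piMr ?(ltW c0)//; move: v1; rewrite hnE -(lecR _ 1).
Qed.

Lemma nb_opnorm T : nb (opnorm T) T.
Proof.
move=> v; have [v0|v0] := eqVneq (hn v) 0.
  have -> : v = 0 by apply: hn_eq0; rewrite v0.
  by rewrite bop_zero /hn nrm0 ?mulr0//; exact: hH.
have vp : 0 < hn v by rewrite lt_def v0 nrm_ge0.
have : complex.Re `|T ((hn v)^-1%:C%C *: v)| <= opnorm T.
  apply: ub_le_sup; first by case: (opnorm_has_sup T).
  exists ((hn v)^-1%:C%C *: v) => //=.
  rewrite hnE -[leRHS]/(1%:C%C) lecR /hn (nrmZ hH) nc_real -/(hn v).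
  by rewrite ger0_norm ?invr_ge0 ?nrm_ge0// mulVf.
rewrite bop_scale hnE /= /hn (nrmZ hH) nc_real -/(hn v) -/(hn (T v)).
by rewrite ger0_norm ?invr_ge0 ?nrm_ge0// mulrC ler_pdivrMr.
Qed.

Lemma opnorm_ge0 T : 0 <= opnorm T.
Proof.
apply: ub_le_sup; first by case: (opnorm_has_sup T).
by exists 0; rewrite /= ?normr0// bop_zero normr0.
Qed.

Lemma opnorm_le T c : 0 <= c -> nb c T -> opnorm T <= c.
Proof.
move=> c0 Tc; apply: ge_sup; first by case: (opnorm_has_sup T).
move=> _ [v /= v1 <-]; rewrite hnE /= (le_trans (Tc v))//.
by rewrite ler_piMr//; move: v1; rewrite hnE -(lecR _ 1).
Qed.

End HilbertSpace.

Arguments hd {R H}.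
Arguments hn {R H}.
Arguments hd_form {R H}.

(** * Square-summable sequences and the density theorem *)

Section SquareSummable.
Variables (R : realType) (H : hilbertType R).
Local Notation hH := (@hd_form R H).

Lemma sqr_hnD (v w : H) : hn (v + w) ^+ 2 <= 2 * hn v ^+ 2 + 2 * hn w ^+ 2.
Proof.
have := nrmD hH v w; rewrite -/(hn _) -/(hn v) -/(hn w) => vw.
have : hn (v + w) ^+ 2 <= (hn v + hn w) ^+ 2.
  by rewrite ler_sqr ?nnegrE ?addr_ge0 ?nrm_ge0.
have := sqr_ge0 (hn v - hn w); lra.
Qed.

Definition sqs : {pred nat -> H} := fun v =>
  `[< exists C : R, forall n, \sum_(k < n) hn (v k) ^+ 2 <= C >].

Lemma sqs_submod : submod_closed sqs.
Proof.
split=> [|c v w /asboolP[C vC] /asboolP[D wD]]; apply/asboolP.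
  by exists 0 => n; rewrite big1// => k _; rewrite /hn (nrm0 hH) expr0n.
exists (2 * (nc c ^+ 2 * C) + 2 * D) => n.
apply: (@le_trans _ _ (\sum_(k < n) (2 * (nc c ^+ 2 * hn (v k) ^+ 2) + 2 * hn (w k) ^+ 2))).
  apply: ler_sum => k _; rewrite (le_trans (sqr_hnD _ _))// lerD2r ler_pM2l//.
  by rewrite /hn (nrmZ hH) exprMn.
rewrite big_split /= -!mulr_sumr; apply: lerD; rewrite ler_pM2l//.
  exact: ler_wpM2l (sqr_ge0 _) _ _ (vC n).
exact: wD.
Qed.

HB.instance Definition _ :=
  GRing.isSubmodClosed.Build R[i] (nat -> H) sqs sqs_submod.

(** The Hilbert space of square-summable sequences in [H]. On it a sigma-weak functional becomes an
    ordinary matrix coefficient of the amplification [amp T]. *)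
Record l2 := L2 { l2_fun :> nat -> H; _ : l2_fun \in sqs }.

HB.instance Definition _ := [isSub for l2_fun].
HB.instance Definition _ := [Choice of l2 by <:].
HB.instance Definition _ := [SubChoice_isSubLmodule of l2 by <:].

Implicit Types (u v w : l2) (S T : bop H).

Lemma l2P v w : (forall k, v k = w k) -> v = w.
Proof. by move=> vw; apply: val_inj; apply/funext. Qed.

Lemma l2D v w k : (v + w) k = v k + w k. Proof. by []. Qed.
Lemma l2B v w k : (v - w) k = v k - w k. Proof. by []. Qed.
Lemma l2Z c v k : (c *: v) k = c *: v k. Proof. by []. Qed.
Lemma l20 k : (0 : l2) k = 0. Proof. by []. Qed.

Definition psum v w n : R := \sum_(k < n) hd (v k) (w k).

Lemma psum_sqr v n : psum v v n = \sum_(k < n) hn (v k) ^+ 2.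
Proof. by apply: eq_bigr => k _; rewrite /hn (nrm2 hH). Qed.

Lemma psum_bnd v w : bnd (psum v w).
Proof.
have /asboolP[C vC] := valP v; have /asboolP[D wD] := valP w.
exists (C + D) => n; rewrite (le_trans (ler_norm_sum _ _ _))//.
apply: (@le_trans _ _ (\sum_(k < n) (hn (v k) ^+ 2 + hn (w k) ^+ 2))).
  apply: ler_sum => k _; rewrite (le_trans (ip_le hH _ _))// -/(hn _) -/(hn _).
  by have := sqr_ge0 (hn (v k) - hn (w k)); have := sqr_ge0 (hn (v k) + hn (w k)); lra.
rewrite big_split /=; exact: lerD (vC n) (wD n).
Qed.

(** The inner product is an ultrafilter limit of bounded partial sums, so linearity is inherited
    without a convergence proof for the series. *)
Definition kd v w : R := ulim (psum v w).
Definition kn := nrm kd.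

Lemma psum_mono v m n : (m <= n)%N -> psum v v m <= psum v v n.
Proof.
move=> /subnKC <-; elim: (n - m)%N => [|k ih]; first by rewrite addn0.
by rewrite addnS /psum big_ord_recr /= -/(psum v v _) (le_trans ih)// lerDl (ip_ge0 hH).
Qed.

Lemma psum_le_kd v n : psum v v n <= kd v v.
Proof.
rewrite -[leLHS]ulim_cst; apply: ulim_le; [|exact: bnd_cst|exact: psum_bnd].
by exists n => m; exact: psum_mono.
Qed.

Lemma kd_le v (C : R) : (forall n, psum v v n <= C) -> kd v v <= C.
Proof.
move=> vC; rewrite -[leRHS]ulim_cst.
by apply: ulim_le; [exists 0%N|exact: psum_bnd|exact: bnd_cst].
Qed.

Lemma hn_le_kd v k : hn (v k) ^+ 2 <= kd v v.
Proof.
apply: le_trans (psum_le_kd v k.+1); rewrite psum_sqr big_ord_recr /=.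
by rewrite lerDr sumr_ge0// => i _; rewrite sqr_ge0.
Qed.

Lemma psum_near (a : nat -> l2) (l : nat -> H) :
  (forall k (e : R), 0 < e -> exists n, forall p, (n <= p)%N ->
     hn (a p k - l k) ^+ 2 < e) ->
  forall m (e : R), 0 < e -> exists n, forall p, (n <= p)%N ->
     \sum_(k < m) hn (a p k - l k) ^+ 2 < e.
Proof.
move=> al; elim=> [|m ih] e e0.
  by exists 0%N => p _; rewrite big_ord0.
have e2 : 0 < e / 2 by lra.
have [n nP] := ih _ e2; have [n' nP'] := al m _ e2.
exists (maxn n n') => p; rewrite geq_max big_ord_recr /= => /andP[np np'].
by have := nP _ np; have := nP' _ np'; lra.
Qed.

(** The coordinates converge in [H]; the estimate is then made on each partial sum, with a threshold
    independent of its length, and passes to the supremum. *)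
Lemma l2_complete (a : nat -> l2) :
  (forall e : R, 0 < e -> exists n, forall p q, (n <= p)%N -> (n <= q)%N ->
     kd (a p - a q) (a p - a q) < e) ->
  exists l, forall e : R, 0 < e ->
    exists n, forall p, (n <= p)%N -> kd (a p - l) (a p - l) < e.
Proof.
move=> aC.
have /choice[l lP] : forall k, exists x : H, forall e : R, 0 < e ->
    exists n, forall p, (n <= p)%N -> hn (a p k - x) ^+ 2 < e.
  move=> k; have [|x xP] := ip_complete hH (a := fun p => a p k).
    move=> e /aC[n nP]; exists n => p q np nq.
    rewrite -(nrm2 hH); apply: le_lt_trans (nP _ _ np nq).
    exact: (hn_le_kd (a p - a q) k).
  exists x => e /xP[n nP]; exists n => p /nP.
  by rewrite -(nrm2 hH).
have near := psum_near lP.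
have close (e : R) : 0 < e -> exists n, forall p, (n <= p)%N -> forall m,
    \sum_(k < m) hn (a p k - l k) ^+ 2 <= e.
  move=> e0; have e4 : 0 < e / 4 by lra.
  have [n nP] := aC _ e4; exists n => p np m.
  (* The intermediate index q may depend on the length m, whereas the threshold n does not. *)
  have [n' nP'] := near m _ e4; pose q := maxn n n'.
  have := nP _ _ np (leq_maxl n n'); rewrite -/q => pq.
  have := nP' _ (leq_maxr n n'); rewrite -/q => ql.
  apply: (@le_trans _ _ (\sum_(k < m) (2 * hn ((a p - a q) k) ^+ 2
      + 2 * hn (a q k - l k) ^+ 2))).
    apply: ler_sum => k _; rewrite (le_trans _ (sqr_hnD _ _))//.
    by rewrite l2B addrA subrK.
  have := psum_le_kd (a p - a q) m; rewrite big_split -!mulr_sumr psum_sqr /=.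
  lra.
have lK : l \in sqs.
  have [n nP] := close 1 ltr01.
  apply/asboolP; exists (2 * kd (a n) (a n) + 2) => m.
  apply: (@le_trans _ _ (\sum_(k < m) (2 * hn (a n k) ^+ 2
      + 2 * hn (a n k - l k) ^+ 2))).
    apply: ler_sum => k _; rewrite /hn (nrm_distC hH) (le_trans _ (sqr_hnD _ _))//.
    by rewrite addrC subrK.
  have := psum_le_kd (a n) m; have := nP _ (leqnn _) m.
  rewrite big_split -!mulr_sumr psum_sqr /=; lra.
exists (L2 lK) => e e0; have e2 : 0 < e / 2 by lra.
have [n nP] := close _ e2; exists n => p np.
have : kd (a p - L2 lK) (a p - L2 lK) <= e / 2.
  by apply: kd_le => m; rewrite psum_sqr; exact: nP.
lra.
Qed.

Lemma kd_form : hilbert_form kd.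
Proof.
split=> [u v w|a v w|v w|v w|v|]; last exact: l2_complete.
- rewrite -ulimD; try exact: psum_bnd.
  congr ulim; apply/funext => n; rewrite -big_split; apply: eq_bigr => k _.
  by rewrite (ipDl hH).
- rewrite -ulimZ; last exact: psum_bnd.
  congr ulim; apply/funext => n; rewrite mulr_sumr; apply: eq_bigr => k _.
  by rewrite (ipZl hH).
- congr ulim; apply/funext => n; apply: eq_bigr => k _; exact: (ipC hH).
- congr ulim; apply/funext => n; apply: eq_bigr => k _; exact: (ip_i hH).
- by rewrite (le_trans _ (psum_le_kd v 0))// /psum big_ord0.
Qed.

Local Notation kH := kd_form.

Lemma kn_eq0 v : kd v v <= 0 -> v = 0.
Proof.
move=> v0; apply: l2P => k; apply: hn_eq0.
have : hn (v k) ^+ 2 <= 0 by rewrite (le_trans (hn_le_kd v k)).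
by rewrite (@exprn_even_le0 _ 2)// => /eqP ->.
Qed.

Lemma hn_le_kn v k : hn (v k) <= kn v.
Proof.
by rewrite -ler_sqr ?nnegrE ?nrm_ge0// /kn (nrm2 kH) hn_le_kd.
Qed.

Lemma amp_subproof T v : (fun k => T (v k)) \in sqs.
Proof.
have [c c0 Tc] := nb_exists T.
apply/asboolP; exists (c ^+ 2 * kd v v) => n.
apply: (@le_trans _ _ (\sum_(k < n) (c ^+ 2 * hn (v k) ^+ 2))).
  apply: ler_sum => k _; rewrite -exprMn ler_sqr ?nnegrE ?mulr_ge0 ?nrm_ge0 ?(ltW c0)//.
by rewrite -mulr_sumr -psum_sqr ler_pM2l ?exprn_gt0// psum_le_kd.
Qed.

(** The amplification T ⊗ 1, acting coordinatewise. *)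
Definition amp T v : l2 := L2 (amp_subproof T v).

Lemma ampE T v k : amp T v k = T (v k). Proof. by []. Qed.

Lemma ampDr T v w : amp T (v + w) = amp T v + amp T w.
Proof. by apply: l2P => k; rewrite !ampE !l2D !ampE bop_add. Qed.

Lemma ampBr T v w : amp T (v - w) = amp T v - amp T w.
Proof. by apply: l2P => k; rewrite !ampE !l2B !ampE bop_sub. Qed.

Lemma ampDl S T v : amp (S + T) v = amp S v + amp T v.
Proof. exact: l2P. Qed.

Lemma ampBl S T v : amp (S - T) v = amp S v - amp T v.
Proof. exact: l2P. Qed.

Lemma ampZl a T v : amp (a *: T) v = a *: amp T v.
Proof. exact: l2P. Qed.

Lemma ampM S T v : amp (S * T) v = amp S (amp T v).
Proof. exact: l2P. Qed.

Lemma amp1 v : amp 1 v = v.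
Proof. exact: l2P. Qed.

Lemma kd_amp T v w : kd (amp T v) w = kd v (amp (adj T) w).
Proof.
congr ulim; apply/funext => n; apply: eq_bigr => k _.
by rewrite !ampE hd_adj.
Qed.

Lemma kn_amp c T v : 0 <= c -> nb c T -> kn (amp T v) <= c * kn v.
Proof.
move=> c0 Tc.
rewrite -ler_sqr ?nnegrE ?mulr_ge0 ?nrm_ge0// exprMn /kn !(nrm2 kH).
apply: kd_le => n; rewrite psum_sqr.
apply: (@le_trans _ _ (\sum_(k < n) (c ^+ 2 * hn (v k) ^+ 2))).
  apply: ler_sum => k _; rewrite -exprMn ler_sqr ?nnegrE ?mulr_ge0 ?nrm_ge0//.
  exact: Tc.
by rewrite -mulr_sumr -psum_sqr ler_wpM2l ?exprn_ge0// psum_le_kd.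
Qed.

Lemma single_subproof n (x : H) : (fun k => if k == n then x else 0) \in sqs.
Proof.
apply/asboolP; exists (hn x ^+ 2) => m.
rewrite (eq_bigr (fun k : 'I_m => if (k : nat) == n then hn x ^+ 2 else 0)); last first.
  by move=> k _; case: ifP => // _; rewrite /hn (nrm0 hH) expr0n.
rewrite -big_mkcond /=; case: (ltnP n m) => nm.
  by rewrite (big_pred1 (Ordinal nm)).
rewrite big_pred0 ?sqr_ge0// => k; apply/negbTE.
by rewrite neq_ltn (leq_trans (ltn_ord k)).
Qed.

Definition single n x : l2 := L2 (single_subproof n x).

Lemma kn_single n x : kn (single n x) <= hn x.
Proof.
rewrite -ler_sqr ?nnegrE ?nrm_ge0// /kn (nrm2 kH); apply: kd_le => m.
rewrite psum_sqr.
rewrite (eq_bigr (fun k : 'I_m => if (k : nat) == n then hn x ^+ 2 else 0)); last first.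
  by move=> k _ /=; case: ifP => // _; rewrite /hn (nrm0 hH) expr0n.
rewrite -big_mkcond /=; case: (ltnP n m) => nm.
  by rewrite (big_pred1 (Ordinal nm)).
rewrite big_pred0 ?sqr_ge0// => k; apply/negbTE.
by rewrite neq_ltn (leq_trans (ltn_ord k)).
Qed.

Definition truncate n v : l2 := \sum_(k < n) single k (v k).

Lemma l2_sum I (r : seq I) (F : I -> l2) k : (\sum_(i <- r) F i) k = \sum_(i <- r) F i k.
Proof.
elim: r => [|i r ih]; first by rewrite !big_nil l20.
by rewrite !big_cons l2D ih.
Qed.

Lemma truncateE n v k : truncate n v k = if (k < n)%N then v k else 0.
Proof.
rewrite /truncate l2_sum /= -big_mkcond /=.
case: (ltnP k n) => kn; first by rewrite (big_pred1 (Ordinal kn)).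
rewrite big_pred0// => i; apply/negbTE.
by rewrite eq_sym neq_ltn (leq_trans (ltn_ord i)).
Qed.

Lemma truncate_near v (e : R) : 0 < e -> exists n, kn (v - truncate n v) < e.
Proof.
move=> e0; have e20 : 0 < e ^+ 2 by rewrite exprn_gt0.
have [n nP] : exists n, kd v v - e ^+ 2 < psum v v n.
  apply/not_existsP => h.
  have : kd v v <= kd v v - e ^+ 2 by apply: kd_le => n; rewrite leNgt; apply/negP.
  lra.
exists n; rewrite -ltr_sqr ?nnegrE ?nrm_ge0 ?(ltW e0)// /kn (nrm2 kH).
suff : kd (v - truncate n v) (v - truncate n v) <= kd v v - psum v v n by lra.
apply: kd_le => m; rewrite lerBrDr.
apply: le_trans (psum_le_kd v (n + m)); rewrite (le_trans (y := psum (v - truncate n v) (v - truncate n v) (n + m) + psum v v n))//.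
  by rewrite lerD2r psum_mono// leq_addl.
have -> : psum v v (n + m) = psum v v n + \sum_(k < m) hd (v (n + k)%N) (v (n + k)%N).
  exact: big_split_ord.
rewrite addrC lerD2l.
have -> : psum (v - truncate n v) (v - truncate n v) (n + m)
  = \sum_(k < n) hd ((v - truncate n v) k) ((v - truncate n v) k)
  + \sum_(k < m) hd ((v - truncate n v) (n + k)%N) ((v - truncate n v) (n + k)%N).
  exact: big_split_ord.
rewrite big1 ?add0r; last first.
  by move=> k _; rewrite l2B truncateE ltn_ord subrr (ip0l hH).
apply: ler_sum => k _.
by rewrite l2B truncateE ltnNge leq_addr /= subr0.
Qed.

End SquareSummable.

Arguments kd {R H}.
Arguments kn {R H}.
Arguments kd_form {R H}.
Arguments amp {R H}.

Section Bicommutant.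
Variables (R : realType) (H : hilbertType R).
Local Notation hH := (@hd_form R H).
Local Notation kH := (@kd_form R H).
Implicit Types (S T : bop H) (u v w : l2 H).

Lemma subalgebra_generated (X : set (bop H)) : subalgebra (generated_algebra X).
Proof.
split=> [A [[]]//|c S T XS XT A XA|S T XS XT A XA].
- by have [[_ h _] _] := XA; apply: h; [exact: XS|exact: XT].
- by have [[_ _ h] _] := XA; apply: h; [exact: XS|exact: XT].
Qed.

Lemma sub_generated (X : set (bop H)) : X `<=` generated_algebra X.
Proof. by move=> T XT A [_]; apply. Qed.

Lemma generated_min (X A : set (bop H)) :
  subalgebra A -> X `<=` A -> generated_algebra X `<=` A.
Proof. by move=> Aa XA T; apply. Qed.

Lemma generated_mono (X Y : set (bop H)) :
  X `<=` Y -> generated_algebra X `<=` generated_algebra Y.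
Proof.
move=> XY; apply: generated_min; first exact: subalgebra_generated.
by move=> T /XY; exact: sub_generated.
Qed.

Section SubalgebraTheory.
Variables (A : set (bop H)) (hA : subalgebra A).

Lemma subalg1 : A 1. Proof. by case: hA. Qed.

Lemma subalgM S T : A S -> A T -> A (S * T).
Proof. by case: hA => _ _; apply. Qed.

Lemma subalg0 : A 0.
Proof.
by have [A1 + _] := hA; move/(_ (-1) _ _ A1 A1); rewrite scaleN1r addNr.
Qed.

Lemma subalgZ c T : A T -> A (c *: T).
Proof. by move=> AT; have [_ + _] := hA; move/(_ c _ _ AT subalg0); rewrite addr0. Qed.

Lemma subalgD S T : A S -> A T -> A (S + T).
Proof. by move=> AS AT; have [_ + _] := hA; move/(_ 1 _ _ AS AT); rewrite scale1r. Qed.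

Lemma subalgB S T : A S -> A T -> A (S - T).
Proof. by move=> AS AT; apply: subalgD => //; rewrite -scaleN1r; exact: subalgZ. Qed.

Lemma subalg_prod n (F : 'I_n -> bop H) :
  (forall i, A (F i)) -> A (\prod_(i < n) F i).
Proof. by move=> AF; elim/big_ind: _ => //; [exact: subalg1|exact: subalgM]. Qed.

End SubalgebraTheory.

Definition selfadj (X : set (bop H)) := forall T, X T -> X (adj T).

Lemma subalgebra_adj (A : set (bop H)) :
  subalgebra A -> subalgebra [set T | A (adj T)].
Proof.
move=> hA; split=> [|c S T /= AS AT|S T /= AS AT] /=.
- by rewrite adj_one; exact: subalg1.
- by rewrite adjD adjZ; apply: subalgD => //; exact: subalgZ.
- by rewrite adjM; exact: subalgM.
Qed.

Lemma generated_adj (X : set (bop H)) : selfadj X -> selfadj (generated_algebra X).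
Proof.
move=> hX; apply: generated_min.
  exact/subalgebra_adj/subalgebra_generated.
by move=> T XT; apply: sub_generated; exact: hX.
Qed.

Lemma commutant_subalgebra (X : set (bop H)) : subalgebra (commutant X).
Proof.
split=> [U _|c S T XS XT U XU|S T XS XT U XU]; first by rewrite mul1r mulr1.
- by rewrite mulrDl mulrDr -bop_scaleAl XS// XT// -bop_scaleAr.
- by rewrite -mulrA XT// mulrA XS// mulrA.
Qed.

Lemma commutant_anti (X Y : set (bop H)) :
  X `<=` Y -> commutant Y `<=` commutant X.
Proof. by move=> XY T YT U /XY; exact: YT. Qed.

Lemma sub_bicommutant (X : set (bop H)) : X `<=` commutant (commutant X).
Proof. by move=> T XT U UX; rewrite UX. Qed.

Lemma commutant_adj (X : set (bop H)) : selfadj X -> selfadj (commutant X).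
Proof.
move=> hX T XT U XU.
by rewrite -[U]adjK -!adjM XT//; exact: hX.
Qed.

Lemma bicommutant_vna (X : set (bop H)) : selfadj X ->
  von_neumann_algebra (commutant (commutant X)).
Proof.
move=> hX; split; first by do 2 apply: commutant_adj.
apply/seteqP; split; last exact: sub_bicommutant.
by apply: commutant_anti; exact: sub_bicommutant.
Qed.

(** The bicommutant of [X] is itself a von Neumann algebra containing [X], and every other one
    contains it because it equals its own bicommutant. *)
Lemma Wstar_bicommutant (X : set (bop H)) : selfadj X ->
  Wstar X = commutant (commutant X).
Proof.
move=> hX; apply/seteqP; split=> T.
  by apply; split; [exact: bicommutant_vna|exact: sub_bicommutant].
move=> XT A [[_ AE] XA]; rewrite -AE; move: T XT.
by apply: commutant_anti; exact: commutant_anti.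
Qed.

Lemma commutant_weak_limit (X : set (bop H)) (T : nat -> bop H) S :
  (forall v w : H, bnd (fun k => hd (T k v) w)) ->
  (forall v w : H, hd (S v) w = ulim (fun k => hd (T k v) w)) ->
  (exists m, forall k, (m <= k)%N -> commutant X (T k)) -> commutant X S.
Proof.
move=> Tb ST [m Tm] U XU; apply: bopP => v; apply: hd_eq => w.
rewrite !bopM ST hd_adj ST; apply: ulim_ext => //; exists m => k /Tm TX.
by rewrite -bopM TX// bopM hd_adj.
Qed.

Section Density.
Variable A : set (bop H).
Hypothesis hA : subalgebra A.
Hypothesis sA : selfadj A.
Variable v0 : l2 H.

Definition orbit_closure u :=
  forall e : R, 0 < e -> exists2 p, A p & kn (u - amp p v0) < e.
Local Notation L := orbit_closure.

Let L0 : L 0.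
Proof.
move=> e e0; exists 0; first exact: subalg0.
have -> : 0 - amp 0 v0 = 0.
  by apply: l2P => k; rewrite l2B ampE bop0 subr0.
by rewrite /kn (nrm0 kH).
Qed.

Let LD u w : L u -> L w -> L (u + w).
Proof.
move=> Lu Lw e e0; have e2 : 0 < e / 2 by lra.
have [p Ap pu] := Lu _ e2; have [q Aq qw] := Lw _ e2.
exists (p + q); first exact: subalgD.
rewrite ampDl opprD addrACA [e]splitr.
exact: le_lt_trans (nrmD kH _ _) (ltrD pu qw).
Qed.

Let Lamp T u : A T -> L u -> L (amp T u).
Proof.
move=> AT Lu e e0; have [c c0 Tc] := nb_exists T.
have [p Ap pu] := Lu (e / c) (divr_gt0 e0 c0).
exists (T * p); first exact: subalgM.
rewrite ampM -ampBr (le_lt_trans (kn_amp _ (ltW c0) Tc))//.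
by rewrite mulrC -ltr_pdivlMr.
Qed.

Let LZ c u : L u -> L (c *: u).
Proof.
move=> Lu; have := @Lamp (c *: (1 : bop H) : bop H) u _ Lu; rewrite ampZl amp1; apply.
by apply: subalgZ => //; exact: subalg1.
Qed.

Let Lv : L v0.
Proof.
move=> e e0; exists 1; first exact: subalg1.
by rewrite amp1 subrr /kn (nrm0 kH).
Qed.

Let Lcl : nclosed kd L.
Proof.
move=> u uL e e0; have e2 : 0 < e / 2 by lra.
have [l Ll ul] := uL _ e2; have [p Ap lp] := Ll _ e2; exists p => //.
rewrite -[u](subrK l) -addrA [e]splitr.
exact: le_lt_trans (nrmD kH _ _) (ltrD ul lp).
Qed.

Let proj_ex : exists P : l2 H -> l2 H, forall u,
  L (P u) /\ forall l, L l -> kd (u - P u) l = 0.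
Proof.
suff /choice[P PP] : forall u, exists p, L p /\ forall l, L l -> kd (u - p) l = 0.
  by exists P.
move=> u; have [|p Lp pP] := projection_exists kH u L0 _ Lcl.
  by move=> a x y Lx Ly; exact: LD (LZ _ Lx) Ly.
by exists p.
Qed.

Let proj_unique (P : l2 H -> l2 H) :
  (forall u, L (P u) /\ forall l, L l -> kd (u - P u) l = 0) ->
  forall u p, L p -> (forall l, L l -> kd (u - p) l = 0) -> P u = p.
Proof.
move=> PP u p Lp up; apply/eqP; rewrite -subr_eq0; apply/eqP/kn_eq0.
have [LP uP] := PP u.
have Ld : L (P u - p) by apply: (LD LP); rewrite -scaleN1r; exact: LZ Lp.
have -> : kd (P u - p) (P u - p) = kd (u - p) (P u - p) - kd (u - P u) (P u - p).
  by rewrite -(ipBl kH) opprB [u - p + _]addrC addrA subrK.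
by rewrite (up _ Ld) (uP _ Ld) subrr.
Qed.

(* The projection onto the closure of [A v0] has matrix entries in the commutant
   of [A], hence commutes with [amp T]. *)
Lemma bicommutant_dense1 T (e : R) : commutant (commutant A) T -> 0 < e ->
  exists2 p, A p & kn (amp T v0 - amp p v0) < e.
Proof.
move=> TA e0; suff : L (amp T v0) by move/(_ _ e0).
have [P PP] := proj_ex; have PU := proj_unique PP.
have PL u : L (P u) by case: (PP u).
have Po u l : L l -> kd (u - P u) l = 0 by case: (PP u) => _; apply.
have PD u w : P (u + w) = P u + P w.
  apply: (PU _ _ (LD (PL u) (PL w))) => l Ll.
  by rewrite opprD addrACA (ipDl kH) (Po _ _ Ll) (Po _ _ Ll) addr0.
have kdZ0 c u l : (forall l, L l -> kd u l = 0) -> L l -> kd (c *: u) l = 0.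
  move=> ul Ll; rewrite [c]complex_decomp scalerDl -scalerA (ipDl kH) !(ipZl kH).
  by rewrite (ip_il kH) (ul _ Ll) (ul _ (LZ _ Ll)) mulr0 oppr0 mulr0 addr0.
have PZ c u : P (c *: u) = c *: P u.
  apply: (PU _ _ (LZ c (PL u))) => l Ll.
  by rewrite -scalerBr; apply: kdZ0 Ll => l' Ll'; exact: Po.
have Pamp q u : A q -> P (amp q u) = amp q (P u).
  move=> Aq; apply: (PU _ _ (Lamp Aq (PL u))) => l Ll.
  by rewrite -ampBr kd_amp; exact: Po (Lamp (sA Aq) Ll).
have Pb u : kn (P u) <= kn u.
  have [->|P0] := eqVneq (kn (P u)) 0; first exact: nrm_ge0.
  have Pp : 0 < kn (P u) by rewrite lt_def P0 nrm_ge0.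
  rewrite -(ler_pM2r Pp) -expr2 /kn (nrm2 kH).
  have -> : kd (P u) (P u) = kd u (P u).
    by apply/eqP; rewrite eq_sym -subr_eq0 -(ipBl kH) (Po _ _ (PL u)).
  by rewrite (le_trans (ler_norm _))// (ip_le kH).
have singleD l (x y : H) : single l (x + y) = single l x + single l y.
  by apply: l2P => k; rewrite l2D /=; case: ifP => _ //; rewrite addr0.
have singleZ l c (x : H) : single l (c *: x) = c *: single l x.
  by apply: l2P => k; rewrite l2Z /=; case: ifP => _ //; rewrite scaler0.
have entry k l : exists Q : bop H, forall x, Q x = P (single l x) k.
  have fB : (fun x => P (single l x) k) \in @bounded_op R H.
    apply/asboolP; split=> [c x y|].
      by rewrite singleD singleZ PD PZ l2D l2Z.
    exists 1 => x; rewrite mul1r !hnE lecR (le_trans (hn_le_kn _ _))//.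
    by rewrite (le_trans (Pb _))// kn_single.
  by exists (Bop fB).
have ampS q l x : amp q (single l x) = single l (q x).
  by apply: l2P => k; rewrite ampE /=; case: ifP => _ //; rewrite bop_zero.
have PT l x : amp T (P (single l x)) = P (amp T (single l x)).
  apply: l2P => k; have [Q QP] := entry k l.
  rewrite ampE ampS -!QP -!bopM TA// => q Aq.
  by apply: bopP => y; rewrite !bopM !QP -ampE -Pamp// ampS.
(* Matrix entries give commutation on finitely supported sequences; the remainder of [v0] is
   controlled below by the bounds on [T] and [P]. *)
have PTt n : amp T (P (truncate n v0)) = P (amp T (truncate n v0)).
  rewrite /truncate; elim/big_ind: _ => //.
  - have P0 : P 0 = 0 by have := PZ 0 0; rewrite !scale0r.
    have a0 : amp T 0 = 0 by apply: l2P => k; rewrite ampE l20 bop_zero.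
    by rewrite P0 a0 P0.
  - by move=> x y hx hy; rewrite !(PD, ampDr) hx hy.
have PN u : P (- u) = - P u by rewrite -scaleN1r PZ scaleN1r.
have PB u w : P (u - w) = P u - P w by rewrite PD PN.
(* As [v0] lies in its own orbit closure, [P v0 = v0], and commutation puts [amp T v0] in the range
   of [P]. *)
have -> : amp T v0 = P (amp T v0); last exact: PL.
have Pv : P v0 = v0 by apply: (PU _ _ Lv) => l Ll; rewrite subrr (ip0l kH).
apply/eqP; rewrite -subr_eq0; apply/eqP/kn_eq0.
rewrite -(nrm2 kH).
suff -> : nrm kd (amp T v0 - P (amp T v0)) = 0 by rewrite expr0n.
apply/eqP; rewrite eq_le nrm_ge0 andbT; apply/ler_addgt0Pr => d d0.
rewrite add0r; have [c c0 Tc] := nb_exists T.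
have [n nP] := truncate_near v0 (divr_gt0 d0 (mulr_gt0 (ltr0n R 2) c0)).
set r := v0 - truncate n v0 in nP.
have -> : amp T v0 - P (amp T v0) = amp T (P r) - P (amp T r).
  by rewrite PB !ampBr PB PTt Pv opprB addrA subrK.
rewrite (le_trans (nrmB kH _ _))//.
have h1 : kn (amp T (P r)) <= c * kn r.
  by rewrite (le_trans (kn_amp _ (ltW c0) Tc))// ler_pM2l.
have h2 : kn (P (amp T r)) <= c * kn r.
  by rewrite (le_trans (Pb _))// (kn_amp _ (ltW c0) Tc).
rewrite (le_trans (lerD h1 h2))// -mulrDl -mulr2n -mulr_natl mulrC.
by rewrite -ler_pdivlMr ?mulr_gt0//; exact: ltW.
Qed.

End Density.

Lemma interleave_subproof v w :
  (fun k => if odd k then w k./2 else v k./2) \in @sqs R H.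
Proof.
apply/asboolP; exists (kd v v + kd w w) => n.
have E m : \sum_(k < m.*2) hn (if odd k then w k./2 else v k./2) ^+ 2 =
    psum v v m + psum w w m.
  elim: m => [|m ih]; first by rewrite /psum !big_ord0 addr0.
  rewrite doubleS !big_ord_recr /= ih odd_double /= uphalf_double half_double.
  rewrite !psum_sqr !big_ord_recr /=.
  by rewrite -!addrA; congr (_ + _); rewrite addrCA.
apply: (@le_trans _ _ (psum v v n + psum w w n)); last first.
  by rewrite lerD ?psum_le_kd.
rewrite -E -addnn big_split_ord /= lerDl sumr_ge0// => i _.
exact: sqr_ge0.
Qed.

Definition interleave v w : l2 H := L2 (interleave_subproof v w).

Lemma amp_interleave T v w : amp T (interleave v w) = interleave (amp T v) (amp T w).
Proof. by apply: l2P => k; rewrite ampE /=; case: ifP. Qed.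

Lemma kn_interleave v w : kn v <= kn (interleave v w) /\ kn w <= kn (interleave v w).
Proof.
have E m : psum (interleave v w) (interleave v w) m.*2 = psum v v m + psum w w m.
  elim: m => [|m ih]; first by rewrite /psum !big_ord0 addr0.
  rewrite doubleS {1}/psum !big_ord_recr.
  rewrite -/(psum (interleave v w) (interleave v w) m.*2) ih /= odd_double /=.
  by rewrite uphalf_double half_double -addrA addrACA /psum !big_ord_recr.
have ge0 u m : 0 <= psum u u m.
  by rewrite psum_sqr sumr_ge0// => i _; exact: sqr_ge0.
split; rewrite -ler_sqr ?nnegrE ?nrm_ge0// /kn !(nrm2 kH); apply: kd_le => n;
  apply: le_trans (psum_le_kd _ n.*2); rewrite E.
- by rewrite lerDl.
- by rewrite lerDr.
Qed.

(** Interleaving stores finitely many sequences in a single one, so that density at one vector gives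
    density at finitely many. *)
Lemma l2_dominating (s : seq (l2 H)) : exists u, forall v, v \in s ->
  forall T, kn (amp T v) <= kn (amp T u).
Proof.
elim: s => [|v s [u us]]; first by exists 0.
exists (interleave v u) => w; rewrite inE => /orP[/eqP ->|ws] T.
  by rewrite amp_interleave; case: (kn_interleave (amp T v) (amp T u)).
rewrite (le_trans (us _ ws T))// amp_interleave.
by case: (kn_interleave (amp T v) (amp T u)).
Qed.

Lemma bicommutant_dense (A : set (bop H)) T (s : seq (l2 H)) (e : R) :
  subalgebra A -> selfadj A -> commutant (commutant A) T -> 0 < e ->
  exists2 p, A p & forall v, v \in s -> kn (amp (T - p) v) < e.
Proof.
move=> hA sA TA e0; have [u us] := l2_dominating s.
have [p Ap pu] := bicommutant_dense1 hA sA u TA e0.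
by exists p => // v vs; rewrite (le_lt_trans (us _ vs _))// ampBl.
Qed.

Lemma commutant_generated (X : set (bop H)) :
  commutant (generated_algebra X) = commutant X.
Proof.
apply/seteqP; split; first by apply: commutant_anti; exact: sub_generated.
move=> T XT U GU; suff : commutant (commutant X) U by move=> h; rewrite h.
apply: (generated_min (commutant_subalgebra _) (@sub_bicommutant X) GU).
Qed.

(** Density in the sigma-strong topology. Nothing here controls the norm of [p], so later estimates
    only use its action on the listed vectors. *)
Lemma Wstar_dense (X : set (bop H)) T (s : seq (l2 H)) (e : R) :
  selfadj X -> Wstar X T -> 0 < e ->
  exists2 p, generated_algebra X p & forall v, v \in s -> kn (amp (T - p) v) < e.
Proof.
move=> hX; rewrite Wstar_bicommutant// -(commutant_generated X).
apply: bicommutant_dense; first exact: subalgebra_generated.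
exact: generated_adj.
Qed.

End Bicommutant.

(** * Square roots and states *)

Section SquareRoot.
Variables (R : realType) (H : hilbertType R).
Local Notation hH := (@hd_form R H).
Implicit Types (S T D : bop H) (v w : H).

Lemma nb_half c T : 0 <= c -> nb c T -> nb (c / 2) ((2^-1)%:C%C *: T).
Proof.
move=> c0 /(nbZ (2^-1)%:C%C); rewrite nc_real ger0_norm ?invr_ge0//.
by rewrite mulrC.
Qed.

Lemma nb_small T : (forall e : R, 0 < e -> nb e T) -> T = 0.
Proof.
move=> Te; apply: nb0_eq0 => v; rewrite mul0r.
have h (t : R) : 0 < t -> hn (T v) <= t * hn v by move/Te; apply.
by have := quadratic_small (nrm_ge0 _ _) h.
Qed.

Lemma bop_half2 T : (2^-1)%:C%C *: T + (2^-1)%:C%C *: T = T.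
Proof.
rewrite -scalerDl -rmorphD /=.
have -> : (2^-1 + 2^-1 : R) = 1 by lra.
by rewrite scale1r.
Qed.

(* With [|D| <= 1], the iteration [Y' = (D + Y^2) / 2] solves
   [(1 - Y)^2 = 1 - D]; its scalar version [t' = (1 + t^2) / 2] controls the
   norms of the increments. *)
Lemma op_sqrt D : adj D = D -> nb 1 D ->
  exists Y : bop H, [/\ adj Y = Y, nb 1 Y, (1 - Y) * (1 - Y) = 1 - D
    & forall U, U * D = D * U -> U * Y = Y * U].
Proof.
move=> Da D1.
pose half := (2^-1 : R)%:C%C.
pose Y := fix Y n : bop H := if n is m.+1 then half *: (D + Y m * Y m) else 0.
pose t := fix t n : R := if n is m.+1 then (1 + t m ^+ 2) / 2 else 0.
have t01 n : 0 <= t n <= 1.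
  elim: n => [|n /andP[t0 t1]] /=; first by rewrite lexx ler01.
  have : t n ^+ 2 <= 1 by rewrite expr_le1.
  have := sqr_ge0 (t n); lra.
have t0 n : 0 <= t n by case/andP: (t01 n).
have t1 n : t n <= 1 by case/andP: (t01 n).
have Yt n : nb (t n) (Y n).
  elim: n => [|n ih] /=; first exact: nb0.
  apply: nb_half; first by rewrite addr_ge0// sqr_ge0.
  by rewrite expr2; apply: nbD => //; exact: nbM.
have sqB S T : S * S - T * T = S * (S - T) + (S - T) * T.
  by rewrite mulrBr mulrBl addrA subrK.
have inc0 n : 0 <= t n.+1 - t n.
  rewrite -[t n.+1]/((1 + t n ^+ 2) / 2); have := sqr_ge0 (1 - t n); lra.
have tle n k : 0 <= t (n + k)%N - t n.
  elim: k => [|k ih]; first by rewrite addn0 subrr.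
  by rewrite addnS; have := inc0 (n + k)%N; lra.
have Yinc n : nb (t n.+1 - t n) (Y n.+1 - Y n).
  elim: n => [|n ih].
    by rewrite !subr0 -[Y 1%N]/(half *: _) -[t 1%N]/(_ / 2); have := Yt 1%N.
  have -> : Y n.+2 - Y n.+1 = half *: (Y n.+1 * (Y n.+1 - Y n) + (Y n.+1 - Y n) * Y n).
    rewrite -sqB -[Y n.+2]/(half *: (D + Y n.+1 * Y n.+1)).
    rewrite -[X in _ - X]/(half *: (D + Y n * Y n)) -scalerBr.
    by rewrite opprD addrACA subrr add0r.
  have -> : t n.+2 - t n.+1 = (t n.+1 * (t n.+1 - t n) + (t n.+1 - t n) * t n) / 2.
    rewrite -[t n.+2]/((1 + t n.+1 ^+ 2) / 2).
    have -> : t n.+1 = (1 + t n ^+ 2) / 2 by [].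
    by field.
  apply: nb_half; first by rewrite addr_ge0 // mulr_ge0 // inc0.
  by apply: nbD; apply: nbM.
have Ydiff n k : nb (t (n + k)%N - t n) (Y (n + k)%N - Y n).
  elim: k => [|k ih]; first by rewrite addn0 !subrr; exact: nb0.
  rewrite addnS.
  have -> : Y (n + k).+1 - Y n = (Y (n + k).+1 - Y (n + k)%N) + (Y (n + k)%N - Y n).
    by rewrite addrA subrK.
  have -> : t (n + k).+1 - t n = (t (n + k).+1 - t (n + k)%N) + (t (n + k)%N - t n).
    by rewrite addrA subrK.
  exact: nbD.
have [Z Z1 ZP] := weak_limit_exists ler01 (fun n => nb_le (t1 n) (Yt n)).
have Yb v w : bnd (fun k => hd (Y k v) w).
  by exists (1 * hn v * hn w) => k; apply: nb_hd => //; exact: nb_le (t1 k) (Yt k).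
pose tau := sup (range t).
have tsup : has_sup (range t).
  by split; [exists (t 0%N), 0%N|exists 1 => _ [n _ <-]].
have ttau n : t n <= tau by apply: ub_le_sup; [case: tsup|exists n].
(* Multiplication is not weakly continuous, so the weak limit is shown to be a norm limit before the
   fixed-point equation is derived; [tau - t n] bounds all the increments still to come. *)
have ZY n : nb (tau - t n) (Z - Y n).
  move=> v; apply: (nrm_le_dual hH); first by rewrite mulr_ge0 ?nrm_ge0// subr_ge0.
  move=> w; rewrite bopB (ipBl hH) ZP lerBlDr -[leRHS]ulim_cst.
  apply: ulim_le; [exists n => m nm|exact: Yb|exact: bnd_cst].
  rewrite -lerBlDr -(ipBl hH) -(subnKC nm) -bopB (le_trans (ler_norm _))//.
  rewrite (le_trans (nb_hd _ _ (tle _ _) (Ydiff n (m - n)%N)))//.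
  by rewrite ler_wpM2r ?nrm_ge0// ler_wpM2r ?nrm_ge0// lerD2r ttau.
have Ysym n : adj (Y n) = Y n.
  elim: n => [|n ih] /=; first by apply: adj_unique => v w; rewrite (ip0l hH) (ip0r hH).
  by rewrite adjZ adjD adjM Da ih conj_conjc conjc_real.
have Ycom U n : U * D = D * U -> U * Y n = Y n * U.
  move=> UD; elim: n => [|n ih] /=; first by rewrite mulr0 mul0r.
  by rewrite -bop_scaleAr -bop_scaleAl mulrDr mulrDl UD mulrA ih -!mulrA ih.
exists Z; split=> //.
- apply: adj_unique => v w; rewrite ZP (ipC hH _ (Z w)) ZP; congr ulim.
  by apply/funext => k; rewrite -[in LHS]Ysym hd_adjl (ipC hH).
- have key : Z = half *: (D + Z * Z).
    apply/eqP; rewrite -subr_eq0; apply/eqP/nb_small => e e0.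
    have e20 : 0 < e / 2 by lra.
    have [_ [n _ <-] ne] := sup_adherent e20 tsup.
    rewrite -/tau in ne.
    have -> : Z - half *: (D + Z * Z) = (Z - Y n.+1)
        + half *: (Y n * (Y n - Z) + (Y n - Z) * Z).
      rewrite -sqB -[Y n.+1]/(half *: (D + Y n * Y n)).
      have -> : Y n * Y n - Z * Z = (D + Y n * Y n) - (D + Z * Z).
        by rewrite opprD addrACA subrr add0r.
      by rewrite scalerBr addrA subrK.
    have YZ : nb (tau - t n) (Y n - Z) by have := nbN (ZY n); rewrite opprB.
    have tt0 : 0 <= tau - t n by rewrite subr_ge0.
    have h1 : nb (1 * (tau - t n)) (Y n * (Y n - Z)).
      by apply: nbM => //; exact: nb_le (t1 n) (Yt n).
    have h2 : nb ((tau - t n) * 1) ((Y n - Z) * Z) by exact: nbM.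
    have h3 := nbD h1 h2; rewrite mul1r mulr1 in h3.
    have h4 := nb_half (addr_ge0 tt0 tt0) h3.
    apply: nb_le (nbD (ZY n.+1) h4).
    move: (inc0 n) ne tt0; move: (t n.+1) (t n) => a b; lra.
  have -> : (1 - Z) * (1 - Z) = 1 - (Z + Z) + Z * Z.
    by rewrite mulrBr mulr1 mulrBl mul1r opprB opprD !addrA addrAC.
  by rewrite {1 2}key bop_half2 opprD addrA subrK.
- move=> U UD; suff : commutant [set U] Z by move=> /(_ U erefl).
  apply: (commutant_weak_limit Yb ZP); exists 0%N => k _ _ ->.
  by rewrite Ycom.
Qed.

End SquareRoot.

Section StateTheory.
Variables (R : realType) (H : hilbertType R).
Local Notation hH := (@hd_form R H).
Variables (M : set (bop H)) (phi : bop H -> R[i]).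
Implicit Types (S T U V W D Z : bop H) (c : R).

Lemma vna_subalgebra : von_neumann_algebra M -> subalgebra M.
Proof. by case=> _ <-; exact: commutant_subalgebra. Qed.

Hypothesis hM : von_neumann_algebra M.
Hypothesis philin : forall (c : R[i]) S T, M S -> M T ->
  phi (c *: S + T) = c * phi S + phi T.
Hypothesis phipos : forall T, M T -> 0 <= phi (adj T * T).

Let sM : subalgebra M := vna_subalgebra hM.
Let aM : selfadj M := hM.1.

Lemma stD S T : M S -> M T -> phi (S + T) = phi S + phi T.
Proof. by move=> MS MT; rewrite -[S]scale1r philin// mul1r scale1r. Qed.

Lemma st0 : phi 0 = 0.
Proof.
have M0 := subalg0 sM.
by apply: (addrI (phi 0)); rewrite -stD// !addr0.
Qed.

Lemma stZ (c : R[i]) T : M T -> phi (c *: T) = c * phi T.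
Proof. by move=> MT; rewrite -[_ *: _]addr0 philin ?st0 ?addr0//; exact: subalg0. Qed.

Lemma stN T : M T -> phi (- T) = - phi T.
Proof. by move=> MT; rewrite -scaleN1r stZ// mulN1r. Qed.

Lemma stB S T : M S -> M T -> phi (S - T) = phi S - phi T.
Proof.
by move=> MS MT; rewrite stD ?stN// -scaleN1r; exact: subalgZ.
Qed.

(** Here 1 - D is the square of the self-adjoint 1 - Y, and Y lies in [M] because it commutes with
    whatever commutes with D. *)
Lemma state_pos D W : M D -> adj D = D -> nb 1 D -> M W ->
  0 <= phi (adj W * (1 - D) * W).
Proof.
move=> MD Da D1 MW; have [Y [Ya _ YY YU]] := op_sqrt Da D1.
have MY : M Y.
  by rewrite -hM.2 => U UM; rewrite YU// UM.
have -> : adj W * (1 - D) * W = adj ((1 - Y) * W) * ((1 - Y) * W).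
  by rewrite -YY adjM adjB adj_one Ya !mulrA.
apply: phipos; apply: (subalgM sM) => //.
by apply: (subalgB sM) => //; exact: (subalg1 sM).
Qed.

Lemma nb_adjM c T : 0 <= c -> nb c T -> nb (c ^+ 2) (adj T * T).
Proof. by move=> c0 Tc; rewrite expr2; apply: nbM => //; exact: nb_adj. Qed.

Lemma adj_adjM T : adj (adj T * T) = adj T * T.
Proof. by rewrite adjM adjK. Qed.

(** This is [state_pos] for D = c^-2 [adj T * T], which has norm at most 1. *)
Lemma state_norm c T W : 0 < c -> M T -> M W -> nb c T ->
  phi (adj (T * W) * (T * W)) <= (c ^+ 2)%:C%C * phi (adj W * W).
Proof.
move=> c0 MT MW Tc; pose a : R[i] := (c ^- 2)%:C%C.
have MTT : M (adj T * T) by apply: (subalgM sM) => //; exact: aM.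
have := state_pos (D := a *: (adj T * T)) (subalgZ sM _ MTT) _ _ MW.
rewrite adjZ adj_adjM conj_conjc conjc_real => /(_ erefl).
have h : nb 1 (a *: (adj T * T)).
  have := nbZ a (nb_adjM (ltW c0) Tc); rewrite nc_real ger0_norm ?invr_ge0 ?exprn_ge0 ?(ltW c0)//.
  by rewrite mulVf// expf_neq0// gt_eqF.
move=> /(_ h).
have MWW : M (adj W * W) by apply: (subalgM sM) => //; exact: aM.
have -> : adj W * (1 - a *: (adj T * T)) * W = adj W * W - a *: (adj (T * W) * (T * W)).
  by rewrite mulrBr mulr1 mulrBl -bop_scaleAr -bop_scaleAl adjM !mulrA.
have MTW : M (adj (T * W) * (T * W)).
  by apply: (subalgM sM); [apply: aM|]; exact: (subalgM sM).
rewrite stB//; last exact: (subalgZ sM).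
rewrite stZ// subr_ge0 /a fmorphV /= ler_pdivrMl// ltcR exprn_gt0//.
Qed.

Hypothesis phind : nondegenerate_on M phi.

(** Nondegeneracy involves two test elements S and U. Expanding the diagonal value at U + c S for c
    = 1 and c = i gives two relations between the mixed terms, which force both to vanish. *)
Lemma state_polarization Z : M Z ->
  (forall V, M V -> phi (adj V * Z * V) = 0) -> Z = 0.
Proof.
move=> MZ Z0; apply: phind => // S U MS MU.
have MSZ A B : M A -> M B -> M (adj A * Z * B).
  by move=> MA MB; apply: (subalgM sM) => //; apply: (subalgM sM) => //; exact: aM.
pose f A B := phi (adj A * Z * B).
have key (c : R[i]) : c * f U S + c^* * f S U = 0.
  have := Z0 _ (subalgD sM MU (subalgZ sM c MS)).
  have -> : adj (U + c *: S) * Z * (U + c *: S) = (adj U * Z * U + c *: (adj U * Z * S))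
     + (c^* *: (adj S * Z * U) + c^* *: (c *: (adj S * Z * S))).
    by rewrite adjD adjZ !(mulrDl, mulrDr) -!bop_scaleAl -!bop_scaleAr addrACA.
  have M1 := MSZ _ _ MU MU; have M2 := MSZ _ _ MU MS.
  have M3 := MSZ _ _ MS MU; have M4 := MSZ _ _ MS MS.
  have Mc a A : M A -> M (a *: A) by move=> MA; exact: (subalgZ sM a MA).
  have M5 := Mc c _ M2; have M6 := Mc c^* _ M3; have M7 := Mc c^* _ (Mc c _ M4).
  rewrite (stD (subalgD sM M1 M5) (subalgD sM M6 M7)) (stD M1 M5) (stD M6 M7).
  rewrite (stZ c M2) (stZ _ M3) (stZ _ (Mc c _ M4)) (stZ c M4).
  by rewrite (Z0 U MU) (Z0 S MS) !mulr0 addr0 add0r.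
have k1 := key 1; have ki := key 'i%C.
move: k1 ki; rewrite conj_conjc rmorph1 !mul1r => /eqP; rewrite addr_eq0 => /eqP ->.
have -> : ('i%C : R[i])^* = - 'i%C.
  by rewrite conj_conjc; apply/eqP; rewrite eq_complex /= oppr0 !eqxx.
rewrite mulrN mulNr -opprD => /eqP; rewrite oppr_eq0 -mulrDr mulf_eq0.
rewrite -mulr2n mulrn_eq0 /= => /orP[|/eqP//].
by rewrite eq_complex /= oner_eq0 andbF.
Qed.

(* With [P = |S|] the operator [Z = P - S] satisfies [Z S = - Z P], hence
   [Z P Z = 0] by positivity and nondegeneracy, so [Z] is nilpotent. *)
Lemma positive_of_state1 S : M S -> adj S = S -> nb 1 S ->
  (forall V, M V -> 0 <= phi (adj V * S * V)) -> forall v : H, 0 <= hd (S v) v.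
Proof.
move=> MS Sa S1 Spos.
(* Expanding the square gives |v - S S v|^2 <= |v|^2 - |S v|^2, because S has norm at most 1. *)
have D1 : nb 1 (1 - S * S).
  move=> v; rewrite mul1r -ler_sqr ?nnegrE ?nrm_ge0// /hn !(nrm2 hH) bopB bopM bop1.
  rewrite (ipBl hH) !(ipBr hH).
  have e : hd (S (S v)) v = hd (S v) (S v) by rewrite hd_adj Sa.
  rewrite (ipC hH v (S (S v))) e.
  have SS : hd (S (S v)) (S (S v)) <= hd (S v) (S v).
    rewrite -!(nrm2 hH) ler_sqr ?nnegrE ?nrm_ge0//.
    by have := S1 (S v); rewrite mul1r.
  have := ip_ge0 hH (S v); move: SS.
  by move: (hd (S (S v)) _) (hd (S v) _) (hd v v) => x y z; lra.
have Da : adj (1 - S * S) = 1 - S * S by rewrite adjB adj_one adjM Sa.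
have [Y [Ya Y1 YY YU]] := op_sqrt Da D1.
have MY : M Y.
  rewrite -hM.2 => U UM; rewrite YU// mulrBr mulrBl mulr1 mul1r.
  by rewrite mulrA UM// -mulrA UM// mulrA.
have [P PE] : exists P : bop H, P = 1 - Y by exists (1 - Y).
have MP : M P by rewrite PE; apply: (subalgB sM) => //; exact: (subalg1 sM).
have Pa : adj P = P by rewrite PE adjB adj_one Ya.
have PP : P * P = S * S by rewrite PE YY opprB addrC subrK.
have SP : S * P = P * S.
  by rewrite PE mulrBr mulrBl mulr1 mul1r YU// mulrBr mulrBl mulr1 mul1r mulrA.
have [Z ZE] : exists Z : bop H, Z = P - S by exists (P - S).
have MZ : M Z by rewrite ZE; exact: (subalgB sM).
have Za : adj Z = Z by rewrite ZE adjB Pa Sa.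
have ZPS : Z * S = - (Z * P).
  by rewrite ZE !mulrBl PP SP opprB.
have ZPZ : Z * P * Z = 0.
  apply: state_polarization => [|V MV]; first by do 2?apply: (subalgM sM).
  have MZV : M (Z * V) by exact: (subalgM sM).
  have e1 : adj V * (Z * P * Z) * V = adj (Z * V) * P * (Z * V).
    by rewrite adjM Za !mulrA.
  have e2 : adj (Z * V) * S * (Z * V) = - (adj V * (Z * P * Z) * V).
    by rewrite adjM Za -[adj V * Z * S]mulrA ZPS mulrN !mulNr !mulrA.
  (* The same number has both signs: the hypothesis on S at Z V makes it nonpositive, and the
     positivity of P = 1 - Y makes it nonnegative. *)
  apply/eqP; rewrite eq_le; apply/andP; split.
    have := Spos _ MZV; rewrite e2 stN ?oppr_ge0//.
    by do 4?apply: (subalgM sM) => //; exact: aM.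
  by rewrite e1 PE; exact: state_pos.
have Z2 : Z * Z = Z * P + Z * P by rewrite {2}ZE mulrBr ZPS opprK.
have Z3 : Z * Z * Z = 0 by rewrite Z2 mulrDl ZPZ addr0.
(* A self-adjoint nilpotent operator vanishes; this is applied to Z Z and then to Z. *)
have ker (T : bop H) (v : H) : adj T = T -> T (T v) = 0 -> T v = 0.
  move=> Ta TTv; apply: hn_eq0; rewrite /hn /nrm -{2}Ta -hd_adj TTv.
  by rewrite (ip0l hH) sqrtr0.
have Zv v : Z v = 0.
  apply: (ker Z v Za); apply: (ker (Z * Z) v); first by rewrite adjM Za.
  by rewrite -!bopM !mulrA Z3 mul0r.
have SPv v : S v = P v by apply/esym/eqP; rewrite -subr_eq0 -bopB -ZE Zv.
move=> v; rewrite SPv PE bopB (ipBl hH) bop1 subr_ge0.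
rewrite (le_trans (ler_norm _))// (le_trans (nb_hd _ _ ler01 Y1))// mul1r.
by rewrite -expr2 /hn (nrm2 hH).
Qed.

(** The converse of [state_norm]. The hypothesis says that 1 - c^-2 [adj T * T] has nonnegative
    values under phi, so it is a positive operator; dividing by its bound k meets the norm condition
    of [positive_of_state1]. *)
Lemma norm_of_state T c : M T -> 0 < c ->
  (forall V, M V -> phi (adj (T * V) * (T * V)) <= (c ^+ 2)%:C%C * phi (adj V * V)) ->
  nb c T.
Proof.
move=> MT c0 Tc; pose a := c ^- 2; have a0 : 0 < a by rewrite invr_gt0 exprn_gt0.
have MTT : M (adj T * T) by apply: (subalgM sM) => //; exact: aM.
pose S : bop H := 1 - a%:C%C *: (adj T * T).
have MS : M S by apply: (subalgB sM); [exact: (subalg1 sM)|exact: (subalgZ sM)].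
have Sa : adj S = S by rewrite adjB adj_one adjZ adj_adjM conj_conjc conjc_real.
have [k k0 Sk] := nb_exists S.
have k'0 : 0 <= k^-1 by rewrite invr_ge0 ltW.
pose S' := (k^-1)%:C%C *: S.
have S'pos := @positive_of_state1 S' (subalgZ sM _ MS).
have S'a : adj S' = S' by rewrite adjZ Sa conj_conjc conjc_real.
have S'1 : nb 1 S'.
  have := nbZ (k^-1)%:C%C Sk; rewrite nc_real ger0_norm// mulVf//.
  by rewrite gt_eqF.
have SV V : M V -> 0 <= phi (adj V * S' * V).
  move=> MV.
  have MVV : M (adj V * V) by apply: (subalgM sM) => //; exact: aM.
  have MTV : M (adj (T * V) * (T * V)).
    by apply: (subalgM sM); [apply: aM|]; exact: (subalgM sM).
  have -> : adj V * S' * V = (k^-1)%:C%C *: (adj V * V - a%:C%C *: (adj (T * V) * (T * V))).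
    rewrite /S' -bop_scaleAr -bop_scaleAl mulrBr mulr1 mulrBl -bop_scaleAr -bop_scaleAl.
    by rewrite adjM !mulrA.
  rewrite stZ; last by apply: (subalgB sM) => //; exact: (subalgZ sM).
  rewrite mulr_ge0 ?ler0c// stB//; last exact: (subalgZ sM).
  rewrite stZ// subr_ge0 /a fmorphV /= ler_pdivrMl ?ltcR ?exprn_gt0//.
  exact: Tc.
move=> v; have := S'pos S'a S'1 SV v.
rewrite bopZ (ipZl hH) pmulr_rge0 ?invr_gt0// bopB bopZ bopM (ipBl hH) bop1 (ipZl hH).
rewrite hd_adjl subr_ge0 /a ler_pdivrMl ?exprn_gt0// => h.
by rewrite -ler_sqr ?nnegrE ?mulr_ge0 ?nrm_ge0 ?(ltW c0)// exprMn /hn !(nrm2 hH).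
Qed.

End StateTheory.

(** * Normal functionals *)

Section NormalFunctionals.
Variables (R : realType) (H : hilbertType R).
Local Notation hH := (@hd_form R H).
Local Notation kH := (@kd_form R H).

Lemma series_hn (v : nat -> H) n :
  series (fun k => `|v k| ^+ 2 : R[i]^o) n = (\sum_(k < n) hn (v k) ^+ 2)%:C%C.
Proof.
rewrite /series /= big_mkord rmorph_sum; apply: eq_bigr => k _.
by rewrite hnE -rmorphXn.
Qed.

Lemma square_summable_sqs (v : nat -> H) : square_summable v -> v \in @sqs R H.
Proof.
move=> /cvgrPdist_lt /(_ 1 ltr01) [m _ mP].
apply/asboolP; exists (complex.Re (limn (series (fun k => `|v k| ^+ 2 : R[i]^o))) + 1) => n.
have := mP (maxn n m) (leq_maxr n m); rewrite series_hn.
set l := limn _; rewrite -[ltRHS]/(1%:C%C) nc_lt => lt.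
have := le_lt_trans (Re_nc _) lt.
rewrite ReB /= distrC ltr_norml => /andP[_ ub].
have : \sum_(k < n) hn (v k) ^+ 2 <= \sum_(k < maxn n m) hn (v k) ^+ 2.
  have /subnKC <- := leq_maxl n m; rewrite big_split_ord /= lerDl sumr_ge0// => k _.
  exact: sqr_ge0.
lra.
Qed.

Lemma series_dot (T : bop H) (v w : l2 H) n :
  series (fun k => dot (T (v k)) (w k) : R[i]^o) n =
  (psum (amp T v) w n)%:C%C + (psum (amp T v) ('i%C *: w) n)%:C%C * 'i%C.
Proof.
rewrite /series /= big_mkord /psum !rmorph_sum mulr_suml -big_split /=.
by apply: eq_bigr => k _; rewrite dot_hd.
Qed.

(* If the series diverges, [limn] is the default point [0] and the bound is
   trivial, so that its convergence need not be established. *)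
Lemma sigma_weak_form_le (T : bop H) (v w : l2 H) :
  nc (sigma_weak_form v w T) <=
  `|kd (amp T v) w| + `|kd (amp T v) ('i%C *: w)|.
Proof.
rewrite /sigma_weak_form; set a := series _.
have [ca|ca] := pselect (cvgn a); last first.
  rewrite (dvgP ca) (_ : point = 0 :> R[i]^o)// nc0.
  by rewrite addr_ge0.
set l := limn a in ca *.
have close (e : R) : 0 < e -> exists m, forall n, (m <= n)%N -> nc (a n - l) < e.
  move=> e0; move/cvgrPdist_lt : ca => /(_ e%:C%C).
  rewrite ltcR => /(_ e0)[m _ mP]; exists m => n /mP /=.
  by rewrite distrC nc_lt.
have -> : kd (amp T v) w = complex.Re l.
  apply: cvg_ulim; apply/cvgrPdist_lt => e /close[m mP]; exists m => // n /mP /=.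
  apply: le_lt_trans; rewrite distrC (le_trans _ (Re_nc _))// ReB.
  by rewrite /a series_dot Re_real_imag.
have -> : kd (amp T v) ('i%C *: w) = complex.Im l.
  apply: cvg_ulim; apply/cvgrPdist_lt => e /close[m mP]; exists m => // n /mP /=.
  apply: le_lt_trans; rewrite distrC (le_trans _ (Im_nc _))// ImB.
  by rewrite /a series_dot Im_real_imag.
exact: nc_ReIm.
Qed.

(** Continuity at 0 is upgraded to a bound by homogeneity: scaling S until the seminorms fall below
    r keeps phi below 1. The real and imaginary parts give two terms for each pair of sequences, and
    the constant is absorbed into the second vector. *)
Lemma normal_bound (M : set (bop H)) (phi : bop H -> R[i]) :
  subalgebra M -> (forall (c : R[i]) S T, M S -> M T ->
     phi (c *: S + T) = c * phi S + phi T) ->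
  normal_on M phi ->
  exists s : seq (l2 H * l2 H), forall S, M S ->
    nc (phi S) <= \sum_(p <- s) `|kd (amp S p.1) p.2|.
Proof.
move=> hM philin /(_ 0 (subalg0 hM) 1 ltr01) [m [v [w [vw [d d0 dP]]]]].
have phi0 : phi 0 = 0.
  have := philin 1 _ _ (subalg0 hM) (subalg0 hM).
  by rewrite scaler0 addr0 mul1r => e; apply: (addrI (phi 0)); rewrite addr0 -e.
have phiZ (c : R[i]) S : M S -> phi (c *: S) = c * phi S.
  by move=> MS; rewrite -[_ *: _]addr0 philin ?phi0 ?addr0//; exact: subalg0.
pose V i : l2 H := L2 (square_summable_sqs (vw i).1).
pose W i : l2 H := L2 (square_summable_sqs (vw i).2).
have sw0 i : sigma_weak_form (v i) (w i) 0 = 0.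
  apply: nc_eq0; have := sigma_weak_form_le 0 (V i) (W i).
  have -> : amp 0 (V i) = 0 by exact: l2P.
  by rewrite !(ip0l kH) normr0 addr0.
have /complex_realP[r dr] : d \is Num.real by rewrite gtr0_real.
move: d0; rewrite dr ltcR => r0.
pose q S := \sum_i (`|kd (amp S (V i)) (W i)| + `|kd (amp S (V i)) ('i%C *: W i)|).
have small S : M S -> q S < r -> nc (phi S) < 1.
  move=> MS qS; rewrite -nc_lt; have := dP S MS; rewrite phi0 subr0; apply => i.
  rewrite sw0 subr0 dr nc_lt; apply: le_lt_trans qS.
  apply: le_trans (sigma_weak_form_le S (V i) (W i)) _.
  rewrite /q (bigD1 i)//= lerDl sumr_ge0// => k _.
  by rewrite addr_ge0.
have qZ (t : R) S : 0 <= t -> q (t%:C%C *: S) = t * q S.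
  move=> t0; rewrite /q mulr_sumr; apply: eq_bigr => i _.
  by rewrite ampZl !(ipZl kH) !normrM ger0_norm// mulrDr.
have q0 S : 0 <= q S by rewrite sumr_ge0// => i _; rewrite addr_ge0.
have bound S : M S -> nc (phi S) <= 2 / r * q S.
  move=> MS.
  have h (t : R) : 0 < t -> t * q S < r -> t * nc (phi S) < 1.
    move=> t0 tq; have := small (t%:C%C *: S) (subalgZ hM _ MS).
    by rewrite qZ ?(ltW t0)// phiZ// ncM nc_real gtr0_norm//; apply.
  have [qS0|qS0] := eqVneq (q S) 0.
    rewrite qS0 mulr0 leNgt; apply/negP => p0.
    have := h (nc (phi S))^-1; rewrite invr_gt0 p0 qS0 mulr0 r0 mulVf ?gt_eqF//.
    by rewrite ltxx => /(_ isT isT).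
  have qp : 0 < q S by rewrite lt_def qS0 q0.
  have := h (r / (2 * q S)); rewrite divr_gt0 ?mulr_gt0// => /(_ isT).
  have -> : r / (2 * q S) * q S = r / 2 by field.
  have r2 : r / 2 < r by lra.
  move=> /(_ r2) /ltW; rewrite mulrC -ler_pdivlMr ?divr_gt0 ?mulr_gt0//.
  move=> /le_trans; apply; rewrite div1r invf_div.
  by rewrite mulrAC.
pose c : R[i] := (2 / r)%:C%C.
exists ([seq (V i, c *: W i) | i <- index_enum 'I_m] ++ [seq (V i, c *: ('i%C *: W i)) | i <- index_enum 'I_m]).
move=> S MS; rewrite (le_trans (bound _ MS))// big_cat !big_map /=.
rewrite -big_split /= /q mulr_sumr ler_sum// => i _.
have r20 : 0 <= 2 / r by rewrite divr_ge0// ltW.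
by rewrite !(ipZr kH) [`|2 / r * _|]normrM [`|2 / r * _|]normrM (ger0_norm r20) mulrDr.
Qed.

End NormalFunctionals.

Section UltraNull.
Variable R : realType.
Implicit Types a b : nat -> R.

Definition unull a := forall e : R, 0 < e -> nat_ultra [set k | `|a k| < e].

Lemma unull_ulim a l : bnd a -> ulim a = l -> unull (fun k => l - a k).
Proof.
move=> ba <- e e0; have /cvgrPdist_lt /(_ e e0) := ulim_cvg ba.
exact.
Qed.

Lemma unullD a b : unull a -> unull b -> unull (fun k => a k + b k).
Proof.
move=> ua ub e e0; have e2 : 0 < e / 2 by rewrite divr_gt0.
apply: filterS2 (ua _ e2) (ub _ e2) => k /= ak bk.
by rewrite (le_lt_trans (ler_normD _ _))// [e]splitr ltrD.
Qed.

Lemma unull_norm a : unull a -> unull (fun k => `|a k|).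
Proof.
by move=> ua e e0; apply: filterS (ua e e0) => k /=; rewrite normr_id.
Qed.

Lemma unull0 : unull (fun=> 0).
Proof.
move=> e e0; apply: filterS (filterT : nat_ultra setT) => k _ /=.
by rewrite normr0.
Qed.

Lemma unull_sum I (r : seq I) (F : I -> nat -> R) :
  (forall i, unull (F i)) -> unull (fun k => \sum_(i <- r) F i k).
Proof.
move=> uF; elim: r => [|i r ih].
  by move=> e e0; apply: filterS (unull0 e0) => k /=; rewrite big_nil.
by move=> e e0; apply: filterS (unullD (uF i) ih e0) => k /=; rewrite big_cons.
Qed.

Lemma unull_le a : (forall d : R, 0 < d ->
  exists2 b, unull b & forall k, `|a k| <= `|b k| + d) -> unull a.
Proof.
move=> h e e0; have e2 : 0 < e / 2 by rewrite divr_gt0.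
have [b ub ab] := h _ e2.
apply: filterS (ub _ e2) => k /= bk.
by rewrite (le_lt_trans (ab k))// [ltRHS]splitr ltrD2r.
Qed.

(** Sets of the ultrafilter meet every tail, so smallness can be combined with a property that holds
    eventually. *)
Lemma unull_frequent a (m : nat) (e : R) : unull a -> 0 < e ->
  exists2 k, (m <= k)%N & `|a k| < e.
Proof.
move=> ua e0.
have : nat_ultra [set k | (m <= k)%N] by apply: nat_ultra_eventually; exists m.
move=> um; have [k [ak mk]] : exists k, `|a k| < e /\ (m <= k)%N.
  by apply: (@filter_ex _ nat_ultra); exact: (filterI (ua _ e0) um).
by exists k.
Qed.

End UltraNull.

Section NormalApproximation.
Variables (R : realType) (H : hilbertType R).
Local Notation hH := (@hd_form R H).
Local Notation kH := (@kd_form R H).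
Implicit Types (S T U V D L : bop H).

Lemma kd_single n (x : H) (w : l2 H) : kd (single n x) w = hd x (w n).
Proof.
apply: ulim_near; exists n.+1 => m nm.
rewrite /psum (bigD1 (Ordinal nm))//= eqxx big1 ?addr0// => i.
rewrite -val_eqE /= => /negbTE ->; exact: (ip0l hH).
Qed.

(** On bounded sequences weak convergence implies sigma-weak convergence: truncating v leaves
    finitely many matrix coefficients and an error uniform in k. *)
Lemma weak_null_amp (D : nat -> bop H) (c : R) : 0 <= c ->
  (forall k, nb c (D k)) ->
  (forall v w : H, unull (fun k => hd (D k v) w)) ->
  forall v w : l2 H, unull (fun k => kd (amp (D k) v) w).
Proof.
move=> c0 Dc Dn v w; apply: unull_le => d d0.
pose K := c * kn w + 1; have K0 : 0 < K.
  by rewrite ltr_wpDl// mulr_ge0// nrm_ge0.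
have [n nP] := truncate_near v (divr_gt0 d0 K0).
exists (fun k => \sum_(l < n) hd (D k (v l)) (w l)).
  by apply: unull_sum => l; exact: Dn.
move=> k.
have -> : amp (D k) v = amp (D k) (truncate n v) + amp (D k) (v - truncate n v).
  by rewrite -ampDr addrC subrK.
rewrite (ipDl kH) (le_trans (ler_normD _ _))// lerD//.
  rewrite le_eqVlt; apply/orP; left; apply/eqP; congr `|_|.
  have -> : amp (D k) (truncate n v) = \sum_(l < n) single l (D k (v l)).
    apply: l2P => j; rewrite ampE truncateE l2_sum /= -big_mkcond /=.
    case: (ltnP j n) => jn; first by rewrite (big_pred1 (Ordinal jn)).
    rewrite bop_zero big_pred0// => i; apply/negbTE.
    by rewrite eq_sym neq_ltn (leq_trans (ltn_ord i)).
  rewrite (ip_suml kH); apply: eq_bigr => l _; exact: kd_single.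
rewrite (le_trans (ip_le kH _ _))//.
rewrite (le_trans (ler_wpM2r (nrm_ge0 _ _) (kn_amp _ c0 (Dc k))))//.
have : kn (v - truncate n v) * K <= d by rewrite -ler_pdivlMr// ltW.
apply: le_trans; rewrite mulrAC mulrC ler_wpM2l ?nrm_ge0//.
by rewrite lerDl.
Qed.

Variables (M : set (bop H)) (phi : bop H -> R[i]) (s : seq (l2 H * l2 H)).
Hypothesis hM : von_neumann_algebra M.
Let sM : subalgebra M := vna_subalgebra hM.
Let aM : selfadj M := hM.1.
Hypothesis philin : forall (c : R[i]) S T, M S -> M T ->
  phi (c *: S + T) = c * phi S + phi T.
Hypothesis phib : forall S, M S ->
  nc (phi S) <= \sum_(p <- s) `|kd (amp S p.1) p.2|.

Lemma kd_amp3 L T U (v w : l2 H) :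
  `|kd (amp (L * T * U) v) w| <= kn (amp T (amp U v)) * kn (amp (adj L) w).
Proof. by rewrite !ampM kd_amp (ip_le kH). Qed.

(** Only the vectors [amp r.2 q.1] have to be approximated; [adj r.1] is moved to the other side of
    the inner product. The set [Y] is kept general because it will be the variables from some index
    on. *)
Lemma normal_approx (Y : set (bop H)) T (rs : seq (bop H * bop H)) (e : R) :
  selfadj Y -> Wstar Y `<=` M -> Wstar Y T -> 0 < e ->
  (forall r, r \in rs -> M r.1 /\ M r.2) ->
  exists2 p, generated_algebra Y p &
    forall r, r \in rs -> nc (phi (r.1 * (T - p) * r.2)) < e.
Proof.
move=> aY YM YT e0 rsM.
(* A common strict bound for the factors of [kd_amp3] that do not involve T - p. *)
have [K K0 KP] : exists2 K : R, 0 < K & forall r, r \in rs ->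
    \sum_(p <- s) kn (amp (adj r.1) p.2) < K.
  elim: (rs) => [|r rs' [K K0 KP]]; first by exists 1.
  set x := \sum_(p <- s) kn (amp (adj r.1) p.2).
  exists (Num.max K (x + 1)) => [|r']; first by rewrite lt_max K0.
  rewrite inE => /orP[/eqP ->|/KP lt]; last by rewrite lt_max lt.
  by rewrite lt_max -/x ltrDl ltr01 orbT.
have [p Yp pP] := Wstar_dense [seq amp r.2 q.1 | r <- rs, q <- s] aY YT
  (divr_gt0 e0 K0).
exists p => // r rr; have [Mr1 Mr2] := rsM r rr.
have Mp : M p.
  apply: YM => A [[_ AE] YA]; apply: (generated_min _ YA Yp).
  by rewrite -AE; exact: commutant_subalgebra.
have MT : M T by exact: YM.
rewrite (le_lt_trans (phib _))//.
  by apply: (subalgM sM) => //; apply: (subalgM sM) => //; exact: (subalgB sM).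
rewrite (@le_lt_trans _ _ (\sum_(q <- s) e / K * kn (amp (adj r.1) q.2)))//.
  rewrite big_seq [leRHS]big_seq; apply: ler_sum => q qs.
  rewrite (le_trans (kd_amp3 _ _ _ _ _))// ler_wpM2r ?nrm_ge0// ltW//.
  by apply: pP; apply/allpairsP; exists (r, q).
by rewrite -mulr_sumr mulrAC -mulrA gtr_pMr// ltr_pdivrMr// mul1r; exact: KP.
Qed.

(** Along the bounded sequence S - T k the dominating seminorms are null, so some index beyond m
    makes phi (L (S - T k) U) arbitrarily small. *)
Lemma normal_weak_limit (T : nat -> bop H) S L U (c : R) (z : R[i]) :
  0 <= c -> (forall k, nb c (T k)) ->
  (forall v w : H, hd (S v) w = ulim (fun k => hd (T k v) w)) ->
  (forall k, M (T k)) -> M S -> M L -> M U ->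
  (exists m, forall k, (m <= k)%N -> phi (L * T k * U) = z) ->
  phi (L * S * U) = z.
Proof.
move=> c0 Tc ST MT MS ML MU [m Tm].
have Tb v w : bnd (fun k => hd (T k v) w).
  by exists (c * hn v * hn w) => k; exact: nb_hd.
have Sc : nb c S.
  move=> v; apply: (nrm_le_dual hH); first by rewrite mulr_ge0 ?nrm_ge0.
  move=> w; rewrite ST (le_trans (ler_norm _))//; apply: ulim_norm_le => k.
  exact: nb_hd.
have null v w : unull (fun k => kd (amp (S - T k) v) w).
  apply: (@weak_null_amp _ (c + c)); first by rewrite addr_ge0.
    by move=> k; apply: nbD => //; exact: nbN.
  move=> x y e e0; have := unull_ulim (Tb x y) erefl e0.
  by apply: filterS => k; rewrite /mkset bopB (ipBl hH) ST.
apply/eqP; rewrite -subr_eq0; apply/eqP/nc_eq0/ler_addgt0Pr => e e0.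
rewrite add0r.
have nsum := unull_sum s (fun p => unull_norm (null (amp U p.1) (amp (adj L) p.2))).
have [k mk small] := unull_frequent m nsum e0.
have MLTU V : M V -> M (L * V * U).
  by move=> MV; apply: (subalgM sM) => //; exact: (subalgM sM).
rewrite -(Tm k mk) -(stB hM philin (MLTU _ MS) (MLTU _ (MT k))).
rewrite -mulrBl -mulrBr (le_trans (phib _))//.
  by apply: MLTU; exact: (subalgB sM).
apply: le_trans (ltW small); rewrite ger0_norm ?sumr_ge0//.
by apply: ler_sum => p _; rewrite !ampM kd_amp.
Qed.

Variable X : set (bop H).
Hypothesis aX : selfadj X.
Hypothesis XM : Wstar X = M.
Hypothesis phind : nondegenerate_on M phi.

Let gM : generated_algebra X `<=` M.
Proof. by rewrite -XM Wstar_bicommutant// -(commutant_generated X); exact: sub_bicommutant. Qed.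

(** The two test elements are replaced one after the other, so that each approximation is made
    against a fixed operator. *)
Lemma normal_separation S : M S ->
  (forall y z, generated_algebra X y -> generated_algebra X z ->
     phi (adj y * S * z) = 0) -> S = 0.
Proof.
move=> MS S0.
have XMs : Wstar X `<=` M by rewrite XM.
have step1 y z : generated_algebra X y -> M z -> phi (adj y * S * z) = 0.
  move=> Xy Mz; apply/nc_eq0/ler_addgt0Pr => e e0; rewrite add0r.
  have MyS : M (adj y * S) by apply: (subalgM sM) => //; apply: aM; exact: gM.
  have [|||p Xp pP] := @normal_approx X z [:: (adj y * S, 1 : bop H)] e aX XMs.
  - by rewrite XM.
  - exact: e0.
  - by move=> r; rewrite inE => /eqP -> /=; split => //; exact: (subalg1 sM).
  have := pP _ (mem_head _ _); rewrite /= mulr1 mulrBr.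
  rewrite (stB hM philin); [|exact: (subalgM sM)|by apply: (subalgM sM) => //; exact: gM].
  by rewrite (S0 _ _ Xy Xp) subr0 => /ltW.
apply: phind => // y z My Mz; apply/nc_eq0/ler_addgt0Pr => e e0; rewrite add0r.
have MSz : M (S * z) by exact: (subalgM sM).
have [|||p Xp pP] := @normal_approx X (adj y) [:: (1 : bop H, S * z)] e aX XMs.
- by rewrite XM; exact: aM.
- exact: e0.
- by move=> r; rewrite inE => /eqP -> /=; split => //; exact: (subalg1 sM).
have := pP _ (mem_head _ _); rewrite /= mul1r mulrBl.
rewrite (stB hM philin); [|by apply: (subalgM sM) => //; exact: aM|by apply: (subalgM sM) => //; exact: gM].
have := step1 (adj p) z (generated_adj aX Xp) Mz.
by rewrite adjK -mulrA => ->; rewrite subr0 mulrA => /ltW.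
Qed.

(** V occurs on both sides of S, so it is approximated on the vectors [q.1] and [q.2] together, and
    the difference is split into two terms each linear in V - p. *)
Lemma normal_positive S : M S ->
  (forall y, generated_algebra X y -> 0 <= phi (adj y * S * y)) ->
  forall V, M V -> 0 <= phi (adj V * S * V).
Proof.
move=> MS Spos V MV.
suff close (e : R) : 0 < e -> exists2 z : R[i], 0 <= z & nc (phi (adj V * S * V) - z) < e.
  rewrite lecE /=; apply/andP; split.
    rewrite -normr_le0; apply/ler_addgt0Pr => e /close[z z0 zc].
    rewrite add0r (le_trans _ (ltW zc))// (le_trans _ (Im_nc _))// ImB.
    by rewrite (ger0_Im z0) subr0.
  apply/ler_addgt0Pr => e /close[z]; rewrite lecE => /andP[_ z0] zc.
  have := le_lt_trans (Re_nc _) zc; rewrite ReB ltr_norml => /andP[lb _].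
  by move: z0 => /=; lra.
move=> e0; have [c c0 Sc] := nb_exists S.
pose K := \sum_(q <- s) (kn (amp (S * V) q.1) + c * (kn (amp V q.2) + 1)) + 1.
have sum0 : 0 <= \sum_(q <- s) (kn (amp (S * V) q.1) + c * (kn (amp V q.2) + 1)).
  by rewrite sumr_ge0// => q _; rewrite addr_ge0 ?nrm_ge0// mulr_ge0 ?(ltW c0)// addr_ge0// nrm_ge0.
have K0 : 0 < K by rewrite ltr_wpDl.
(* The cap 1 bounds [amp p q.2] by the corresponding term for V plus 1; the final + 1 in K makes the
   total e (K - 1) / K, strictly below e. *)
pose d := Num.min 1 (e / K).
have d0 : 0 < d by rewrite lt_min ltr01 divr_gt0.
have XV : Wstar X V by rewrite XM.
have [p Xp pP] := Wstar_dense ([seq q.1 | q <- s] ++ [seq q.2 | q <- s]) aX XV d0.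
have Mp : M p by exact: gM.
have p1 q : q \in s -> kn (amp (V - p) q.1) < d.
  by move=> qs; apply: pP; rewrite mem_cat map_f.
have p2 q : q \in s -> kn (amp (V - p) q.2) < d.
  by move=> qs; apply: pP; rewrite mem_cat orbC map_f.
have MVp : M (V - p) by exact: (subalgB sM).
have M3 A B : M A -> M B -> M (adj A * S * B).
  by move=> MA MB; apply: (subalgM sM) => //; apply: (subalgM sM) => //; exact: aM.
exists (phi (adj p * S * p)); first exact: Spos.
rewrite -(stB hM philin (M3 _ _ MV MV) (M3 _ _ Mp Mp)).
have -> : adj V * S * V - adj p * S * p = adj (V - p) * S * V + adj p * S * (V - p).
  by rewrite adjB !mulrBl mulrBr addrA subrK.
rewrite (stD philin (M3 _ _ MVp MV) (M3 _ _ Mp MVp)) (le_lt_trans (ncD _ _))//.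
rewrite (le_lt_trans (lerD (phib (M3 _ _ MVp MV)) (phib (M3 _ _ Mp MVp))))//.
rewrite -big_split /=.
have bound : \sum_(q <- s) (`|kd (amp (adj (V - p) * S * V) q.1) q.2|
     + `|kd (amp (adj p * S * (V - p)) q.1) q.2|)
   <= \sum_(q <- s) d * (kn (amp (S * V) q.1) + c * (kn (amp V q.2) + 1)).
  rewrite big_seq [leRHS]big_seq; apply: ler_sum => q qs.
  rewrite [leRHS]mulrDr lerD//.
    rewrite -mulrA ampM kd_amp adjK (le_trans (ip_le kH _ _))// mulrC.
    by rewrite ler_wpM2r ?nrm_ge0// ltW// p2.
  rewrite -mulrA ampM kd_amp adjK (le_trans (ip_le kH _ _))// ampM.
  have h1 : kn (amp S (amp (V - p) q.1)) <= c * d.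
    rewrite (le_trans (kn_amp _ (ltW c0) Sc))// ler_pM2l// ltW//; exact: p1.
  have h2 : kn (amp p q.2) <= kn (amp V q.2) + 1.
    have -> : amp p q.2 = amp V q.2 - amp (V - p) q.2 by rewrite ampBl opprB addrC subrK.
    rewrite (le_trans (nrmB kH _ _))// lerD2l (le_trans (ltW (p2 _ qs)))//.
    by rewrite ge_min lexx.
  by rewrite mulrA [d * c]mulrC; apply: ler_pM => //; exact: nrm_ge0.
rewrite (le_lt_trans bound)// -mulr_sumr.
apply: (@le_lt_trans _ _ (e / K * (K - 1))).
  by rewrite /K addrK ler_wpM2r// ge_min lexx orbT.
by rewrite mulrBr divfK ?gt_eqF// mulr1 ltrBlDr ltrDl divr_gt0.
Qed.

Hypothesis phipos : forall T, M T -> 0 <= phi (adj T * T).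

Lemma normal_norm T (c : R) : M T -> 0 < c ->
  (forall y, generated_algebra X y ->
     phi (adj (T * y) * (T * y)) <= (c ^+ 2)%:C%C * phi (adj y * y)) ->
  nb c T.
Proof.
move=> MT c0 Tc; apply: (norm_of_state hM philin phipos phind MT c0) => V MV.
pose S : bop H := (c ^+ 2)%:C%C *: (1 : bop H) - adj T * T.
have M1 := subalg1 sM.
have MTT : M (adj T * T) by apply: (subalgM sM) => //; exact: aM.
have MS : M S by apply: (subalgB sM) => //; exact: (subalgZ sM).
have key y : M y -> phi (adj y * S * y) =
    (c ^+ 2)%:C%C * phi (adj y * y) - phi (adj (T * y) * (T * y)).
  move=> My; have Myy : M (adj y * y) by apply: (subalgM sM) => //; exact: aM.
  have MTy : M (adj (T * y) * (T * y)).
    by apply: (subalgM sM); [apply: aM|]; exact: (subalgM sM).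
  rewrite -(stZ hM philin _ Myy) -(stB hM philin _ MTy); last exact: (subalgZ sM).
  congr phi; rewrite mulrBr mulrBl -bop_scaleAr mulr1 -bop_scaleAl adjM.
  by rewrite !mulrA.
have := normal_positive MS _ MV; rewrite key// subr_ge0; apply => y Xy.
by rewrite key ?subr_ge0; [exact: Tc|exact: gM].
Qed.

End NormalApproximation.

(** * Quantum exchangeability with coefficients *)

Section CstarTheory.
Variables (R : realType) (D : cstarType R).
Implicit Types (a b : D).

Lemma cnorm0 : cnorm (0 : D) = 0.
Proof.
by apply: complexI; rewrite -(scale0r (0 : D)) cnormZ normr0 mul0r.
Qed.

Lemma cnormN a : cnorm (- a) = cnorm a.
Proof.
by apply: complexI; rewrite -scaleN1r cnormZ normrN1 mul1r.
Qed.

Lemma cnorm_ge0 a : 0 <= cnorm a.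
Proof. by have := cnormD a (- a); rewrite subrr cnorm0 cnormN; lra. Qed.

Lemma cnorm_scale (c : R[i]) a : cnorm (c *: a) = nc c * cnorm a.
Proof. by apply: complexI; rewrite cnormZ ncE rmorphM. Qed.

Lemma cnorm_sum I (r : seq I) (F : I -> D) :
  cnorm (\sum_(i <- r) F i) <= \sum_(i <- r) cnorm (F i).
Proof.
elim: r => [|i r ih]; first by rewrite !big_nil cnorm0.
by rewrite !big_cons (le_trans (cnormD _ _))// lerD2l.
Qed.

Lemma star0 : star (0 : D) = 0.
Proof. by have := starZ 0 (0 : D); rewrite rmorph0 !scale0r. Qed.

Lemma star1 : star (1 : D) = 1.
Proof. by rewrite -[LHS]mul1r -{1}[1]starK -starM mul1r starK. Qed.

End CstarTheory.

Section QuantumWords.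
Variables (R : realType) (H : hilbertType R) (x : face -> nat -> bop H).

(** Left summand: variables, on which the quantum permutation acts; right summand: coefficients,
    which it leaves alone. *)
Definition letter N : Type := (face * 'I_N) + bop H.

Definition lval N (l : letter N) : bop H :=
  match l with inl p => x p.1 p.2 | inr b => b end.

Definition wval N (w : seq (letter N)) : bop H := \prod_(l <- w) lval l.

(* The sum over [I] of [psi (x_I) u_IJ^chi], expanded from the left: a left
   letter contributes the first factor of [u_IJ^chi] and a right letter the
   last one. *)
Fixpoint qsum (D : algType R[i]) N (v : 'I_N -> 'I_N -> D) (w : seq (letter N))
    (psi : bop H -> R[i]) : D :=
  match w with
  | [::] => psi 1 *: 1
  | inl p :: w' =>
      \sum_(i < N) (if Defs.is_left p.1 then v i p.2 * qsum v w' (fun T => psi (x p.1 i * T))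
                    else qsum v w' (fun T => psi (x p.1 i * T)) * v i p.2)
  | inr b :: w' => qsum v w' (fun T => psi (b * T))
  end.

Lemma qsum_ext (D : algType R[i]) N (v : 'I_N -> 'I_N -> D) w psi psi' :
  psi =1 psi' -> qsum v w psi = qsum v w psi'.
Proof. by move=> e; congr qsum; exact/funext. Qed.

Lemma qsum_morph (D D' : algType R[i]) (f : {lrmorphism D -> D'}) N
    (v : 'I_N -> 'I_N -> D) w psi :
  f (qsum v w psi) = qsum (fun i j => f (v i j)) w psi.
Proof.
elim: w psi => [|[[c j]|b] w ih] psi /=.
- by rewrite linearZ /= rmorph1.
- rewrite linear_sum; apply: eq_bigr => i _ /=.
  by case: Defs.is_left; rewrite rmorphM /= ih.
- exact: ih.
Qed.

Lemma big_ffun_ordS (V : zmodType) n N (F : 'I_N -> {ffun 'I_n -> 'I_N} -> V) :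
  \sum_(I : {ffun 'I_n.+1 -> 'I_N}) F (I ord0) [ffun k => I (lift ord0 k)]
  = \sum_(i < N) \sum_(I : {ffun 'I_n -> 'I_N}) F i I.
Proof.
pose h (p : 'I_N * {ffun 'I_n -> 'I_N}) : {ffun 'I_n.+1 -> 'I_N} :=
  [ffun k => if unlift ord0 k is Some k' then p.2 k' else p.1].
pose g (I : {ffun 'I_n.+1 -> 'I_N}) := (I ord0, [ffun k => I (lift ord0 k)]).
have hg : cancel g h.
  move=> I; apply/ffunP => k; rewrite ffunE /=.
  by case: unliftP => [k' ->|->] //; rewrite ffunE.
have gh : cancel h g.
  move=> [i I]; rewrite /g; congr (_, _); first by rewrite ffunE unlift_none.
  by apply/ffunP => k; rewrite !ffunE liftK.
rewrite pair_big /= (reindex g) //=.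
by exists h => ? _; [exact: hg|exact: gh].
Qed.

Definition word_letters N n (chi : 'I_n -> face) (J : 'I_n -> 'I_N) : seq (letter N) :=
  [seq inl (chi i, J i) | i <- enum 'I_n].

(** The left positions come first in increasing order and the right ones last in decreasing order,
    so position 0 sits at one of the two ends. *)
Lemma s_chi_ordS n (chi : 'I_n.+1 -> face) :
  let t := [seq lift ord0 k | k <- s_chi (fun k => chi (lift ord0 k))] in
  s_chi chi = if Defs.is_left (chi ord0) then ord0 :: t else rcons t ord0.
Proof.
rewrite /s_chi enum_ordSl; move: (enum 'I_n) => r /=.
rewrite map_cat map_rev !filter_map.
by case: Defs.is_left => //=; rewrite rev_cons -rcons_cat.
Qed.

Lemma u_chi_ordS N (CS : quantum_permutation_algebra R N) n
    (chi : 'I_n.+1 -> face) (I J : 'I_n.+1 -> 'I_N) :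
  u_chi CS chi I J =
  let u := u_chi CS (fun k => chi (lift ord0 k)) (fun k => I (lift ord0 k))
             (fun k => J (lift ord0 k)) in
  if Defs.is_left (chi ord0) then qperm_gen CS (I ord0) (J ord0) * u
  else u * qperm_gen CS (I ord0) (J ord0).
Proof.
rewrite /u_chi s_chi_ordS; case: ifP => _ /=.
- by rewrite big_cons big_map.
- by rewrite big_rcons big_map.
Qed.

Lemma sum_u_chi N (CS : quantum_permutation_algebra R N) n (chi : 'I_n -> face)
    (J : 'I_n -> 'I_N) (psi : bop H -> R[i]) :
  \sum_(I : {ffun 'I_n -> 'I_N}) psi (word x chi (fun i => I i)) *: u_chi CS chi I J
  = qsum (@qperm_gen _ _ CS) (word_letters chi J) psi.
Proof.
elim: n chi J psi => [|n ih] chi J psi.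
  have f0 : 'I_0 -> 'I_N by case.
  rewrite (big_pred1 (finfun f0)).
    rewrite /word_letters /word big_ord0 /u_chi /s_chi.
    have -> : enum 'I_0 = [::] by apply: size0nil; rewrite size_enum_ord.
    by rewrite big_nil.
  by move=> I /=; apply/esym/eqP/ffunP => -[].
rewrite /word_letters enum_ordSl /= -map_comp.
pose F (i : 'I_N) (I' : {ffun 'I_n -> 'I_N}) : CS :=
     psi (x (chi ord0) i * word x (fun k => chi (lift ord0 k)) (fun k => I' k)) *:
     (let u := u_chi CS (fun k => chi (lift ord0 k)) I' (fun k => J (lift ord0 k)) in
      if Defs.is_left (chi ord0) then qperm_gen CS i (J ord0) * u
      else u * qperm_gen CS i (J ord0)).
transitivity (\sum_(I : {ffun 'I_n.+1 -> 'I_N}) F (I ord0) [ffun k => I (lift ord0 k)]).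
  apply: eq_bigr => I _; rewrite /F u_chi_ordS /word big_ord_recl /=.
  move: [ffun k => I (lift ord0 k)] (ffunE (fun k => I (lift ord0 k))) => I' I'E.
  have -> : (fun k => I (lift ord0 k)) = I' :> ('I_n -> 'I_N) by apply/funext.
  by congr (psi (_ * _) *: _); apply: eq_bigr => k _; rewrite I'E.
rewrite big_ffun_ordS; apply: eq_bigr => i _; rewrite /F.
rewrite -(ih (fun k => chi (lift ord0 k)) (fun k => J (lift ord0 k))
  (fun T => psi (x (chi ord0) i * T))).
case: Defs.is_left => /=.
- by rewrite mulr_sumr; apply: eq_bigr => I _; rewrite scalerAr.
- by rewrite mulr_suml; apply: eq_bigr => I _; rewrite scalerAl.
Qed.

Variables (CS : forall N, quantum_permutation_algebra R N) (phi : bop H -> R[i]).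
Hypothesis hbi : quantum_bi_exchangeable x CS phi.

Lemma wval_word_letters N n (chi : 'I_n -> face) (J : 'I_n -> 'I_N) :
  wval (word_letters chi J) = word x chi (fun i => J i).
Proof. rewrite /wval /word_letters big_map enumT.
by rewrite /word [index_enum _]unlock.
Qed.

(** The universal property carries the exchangeability relations from the generators to any magic
    unitary, which allows block matrices and permutation matrices later. *)
Lemma qsum_variables N (D : cstarType R) (v : 'I_N -> 'I_N -> D)
    (w : seq (face * 'I_N)) : magic_unitary v ->
  qsum v [seq inl p | p <- w] phi = phi (wval [seq inl p | p <- w]) *: 1.
Proof.
move=> hv; have [f [_ fv _]] := qperm_universal (CS N) hv.
pose t := in_tuple w.
pose chi i := (tnth t i).1; pose J := [ffun i => (tnth t i).2].
have -> : [seq inl p | p <- w] = word_letters chi J :> seq (letter N).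
  rewrite /word_letters; have wE : w = map (tnth t) (enum 'I_(size w)) by rewrite map_tnth_enum.
  rewrite {1}wE -map_comp; apply: eq_map => i.
  by rewrite /= /chi /J ffunE; case: (tnth t i).
have -> : v = fun i j => f (qperm_gen (CS N) i j).
  by apply/funext => i; apply/funext => j; rewrite fv.
rewrite -qsum_morph -sum_u_chi -hbi linearZ /= rmorph1 wval_word_letters.
by [].
Qed.

(** The block-diagonal matrix v ⊕ 1. It fixes the last k indices, so variables there behave as
    coefficients. *)
Definition magic_sum (D : algType R[i]) N k (v : 'I_N -> 'I_N -> D)
    (i j : 'I_(N + k)) : D :=
  match fintype.split i, fintype.split j with
  | inl a, inl b => v a b
  | inr a, inr b => (a == b)%:R
  | _, _ => 0
  end.

Lemma magic_sumll (D : algType R[i]) N k (v : 'I_N -> 'I_N -> D) i j :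
  magic_sum v (lshift k i) (lshift k j) = v i j.
Proof. by rewrite /magic_sum !(unsplitK (inl _)). Qed.

Lemma magic_sumlr (D : algType R[i]) N k (v : 'I_N -> 'I_N -> D) i (j : 'I_k) :
  magic_sum v (lshift k i) (rshift N j) = 0.
Proof. by rewrite /magic_sum (unsplitK (inl _)) (unsplitK (inr _)). Qed.

Lemma magic_sumrl (D : algType R[i]) N k (v : 'I_N -> 'I_N -> D) (i : 'I_k) j :
  magic_sum v (rshift N i) (lshift k j) = 0.
Proof. by rewrite /magic_sum (unsplitK (inl _)) (unsplitK (inr _)). Qed.

Lemma magic_sumrr (D : algType R[i]) N k (v : 'I_N -> 'I_N -> D) (i j : 'I_k) :
  magic_sum v (rshift N i) (rshift N j) = (i == j)%:R.
Proof. by rewrite /magic_sum !(unsplitK (inr _)). Qed.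

Definition magic_sumE := (magic_sumll, magic_sumlr, magic_sumrl, magic_sumrr).

Lemma magic_sum_magic (D : cstarType R) N k (v : 'I_N -> 'I_N -> D) :
  magic_unitary v -> magic_unitary (@magic_sum D N k v).
Proof.
move=> [vs vp vr vc].
have delta (i : 'I_k) : \sum_j (j == i)%:R = 1 :> D.
  rewrite (bigD1 i)//= eqxx big1 ?addr0// => j /negbTE ->.
  by [].
split=> [i j|i j|i|i].
- case: (split_ordP i) => i' ->; case: (split_ordP j) => j' ->;
    rewrite magic_sumE ?star0//; by case: eqP; rewrite ?star0 ?star1.
- case: (split_ordP i) => i' ->; case: (split_ordP j) => j' ->;
    rewrite magic_sumE ?mul0r//; by case: eqP; rewrite ?mul0r ?mul1r.
- case: (split_ordP i) => i' ->; rewrite big_split_ord /=.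
  + rewrite [X in _ + X]big1 ?addr0; first by under eq_bigr do rewrite magic_sumE.
    by move=> j _; rewrite magic_sumE.
  + rewrite [X in X + _]big1 ?add0r; first by under eq_bigr do rewrite magic_sumE.
    by move=> j _; rewrite magic_sumE.
- case: (split_ordP i) => i' ->; rewrite big_split_ord /=.
  + rewrite [X in _ + X]big1 ?addr0; first by under eq_bigr do rewrite magic_sumE.
    by move=> j _; rewrite magic_sumE.
  + rewrite [X in X + _]big1 ?add0r; first by under eq_bigr do rewrite magic_sumE eq_sym.
    by move=> j _; rewrite magic_sumE.
Qed.

(* [inr (c, l)] stands for the fixed letter [x c (N + l)]. *)
Definition elem_letter N (l : (face * 'I_N) + (face * nat)) : letter N :=
  match l with inl p => inl p | inr p => inr (x p.1 (N + p.2)%N) end.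

(** The successor makes the second block nonempty, as [inord] requires; [elem_bound] says when
    [inord] keeps the index. *)
Definition shift_letter N k (l : (face * 'I_N) + (face * nat)) : face * 'I_(N + k.+1) :=
  match l with
  | inl p => (p.1, lshift k.+1 p.2)
  | inr p => (p.1, rshift N (inord p.2))
  end.

Definition elem_bound N k (l : (face * 'I_N) + (face * nat)) :=
  if l is inr p then (p.2 < k.+1)%N else true.

Lemma elem_bound_exists N (w : seq ((face * 'I_N) + (face * nat))) :
  exists k, all (@elem_bound N k) w.
Proof.
elim: w => [|[p|p] w [k ih]]; [by exists 0%N|by exists k|].
exists (maxn k p.2); rewrite /= ltnS leq_maxr /=.
by apply: sub_all ih => -[//|q] /=; rewrite !ltnS => /leq_trans; apply; exact: leq_maxl.
Qed.

Lemma lval_shift N k l : @elem_bound N k l ->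
  lval (inl (shift_letter k l)) = lval (elem_letter l).
Proof. by case: l => [[c j]|[c l]] //= lk; rewrite inordK. Qed.

(** At a letter of the second block the column of v ⊕ 1 has a single nonzero entry, equal to 1, so
    the sum over row indices collapses. *)
Lemma qsum_shift (D : algType R[i]) N k (v : 'I_N -> 'I_N -> D)
    (w : seq ((face * 'I_N) + (face * nat))) psi :
  all (@elem_bound N k) w ->
  qsum (@magic_sum D N k.+1 v) [seq inl (shift_letter k l) | l <- w] psi
  = qsum v (map (@elem_letter N) w) psi.
Proof.
elim: w psi => [//|l w ih] psi /= /andP[lk /ih{}ih].
case: l lk => [[c j]|[c l]] /= lk; rewrite big_split_ord /=.
  rewrite [X in _ + X]big1 ?addr0; last first.
    by move=> i _; rewrite magic_sumE mul0r mulr0; case: ifP.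
  by apply: eq_bigr => i _; rewrite magic_sumE ih.
rewrite big1 ?add0r; last first.
  by move=> i _; rewrite magic_sumE mul0r mulr0; case: ifP.
rewrite (bigD1 (inord l))//= big1 ?addr0; last first.
  by move=> i /negbTE il; rewrite magic_sumE il mul0r mulr0; case: ifP.
by rewrite magic_sumE eqxx mul1r mulr1 ih inordK//; case: ifP.
Qed.

Lemma qsum_elementary (D : cstarType R) N (v : 'I_N -> 'I_N -> D)
    (w : seq ((face * 'I_N) + (face * nat))) : magic_unitary v ->
  qsum v (map (@elem_letter N) w) phi = phi (wval (map (@elem_letter N) w)) *: 1.
Proof.
move=> hv; have [k wk] := elem_bound_exists w.
have := qsum_variables [seq shift_letter k l | l <- w] (magic_sum_magic k.+1 hv).
rewrite -map_comp qsum_shift// => ->; congr (phi _ *: _).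
rewrite /wval !big_map; elim: w wk => [|l w ih] /=; first by rewrite !big_nil.
by move=> /andP[lk /ih e]; rewrite !big_cons e -(lval_shift lk).
Qed.

Variable M : set (bop H).
Hypothesis hM : von_neumann_algebra M.
Let sM : subalgebra M := vna_subalgebra hM.
Hypothesis xM : forall c j, M (x c j).

Lemma qsum_rep (D : algType R[i]) N (v : 'I_N -> 'I_N -> D) (w : seq (letter N)) :
  (forall b, List.In (inr b) w -> M b) ->
  exists rs : seq (bop H * D),
    (forall r, r \in [seq q.1 | q <- rs] -> M r) /\
    forall psi, qsum v w psi = \sum_(r <- rs) psi r.1 *: r.2.
Proof.
elim: w => [|[[c j]|b] w ih] wM.
- exists [:: (1, 1)]; split=> [r|psi]; last by rewrite big_seq1.
  by rewrite inE => /eqP ->; exact: (subalg1 sM).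
- have [rs [rsM rsE]] := ih (fun b bw => wM b (or_intror bw)).
  exists [seq (x c p.1 * p.2.1, if Defs.is_left c then v p.1 j * p.2.2 else p.2.2 * v p.1 j)
         | p : 'I_N * (bop H * D) <- [seq (i, r) | i <- index_enum 'I_N, r <- rs]].
  split=> [r|psi].
    rewrite -map_comp => /mapP[[i q] /allpairsP[[i' q'] [_ qrs [-> ->]]] ->] /=.
    by apply: (subalgM sM) => //; apply: rsM; exact: map_f.
  rewrite big_map big_allpairs /=; apply: eq_bigr => i _.
  rewrite rsE; case: ifP => _.
    by rewrite mulr_sumr; apply: eq_bigr => r _; rewrite scalerAr.
  by rewrite mulr_suml; apply: eq_bigr => r _; rewrite scalerAl.
- have [rs [rsM rsE]] := ih (fun b bw => wM b (or_intror bw)).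
  exists [seq (b * p.1, p.2) | p <- rs]; split=> [r|psi].
    rewrite -map_comp => /mapP[q qrs ->] /=.
    by apply: (subalgM sM); [apply: wM; left|apply: rsM; exact: map_f].
  by rewrite big_map /= rsE.
Qed.

(** As a function of one coefficient, [qsum] is a finite combination of evaluations with that
    coefficient between fixed elements of [M]; this finiteness is what [normal_approx] consumes. *)
Lemma qsum_rep_mid (D : algType R[i]) N (v : 'I_N -> 'I_N -> D) (w1 w2 : seq (letter N)) :
  (forall b, List.In (inr b) w1 -> M b) -> (forall b, List.In (inr b) w2 -> M b) ->
  exists rs : seq ((bop H * bop H) * D),
    (forall r, r \in [seq q.1 | q <- rs] -> M r.1 /\ M r.2) /\
    forall psi b, qsum v (w1 ++ inr b :: w2) psi
      = \sum_(r <- rs) psi (r.1.1 * b * r.1.2) *: r.2.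
Proof.
move=> w1M w2M; elim: w1 w1M => [|[[c j]|a] w ih] wM.
- have [rs [rsM rsE]] := qsum_rep v w2M.
  exists [seq ((1, r.1), r.2) | r <- rs]; split=> [r|psi b].
    rewrite -map_comp => /mapP[q qrs ->] /=; split; first exact: (subalg1 sM).
    by apply: rsM; exact: map_f.
  by rewrite big_map /= rsE; apply: eq_bigr => r _; rewrite mul1r.
- have [rs [rsM rsE]] := ih (fun b bw => wM b (or_intror bw)).
  exists [seq ((x c p.1 * p.2.1.1, p.2.1.2),
               if Defs.is_left c then v p.1 j * p.2.2 else p.2.2 * v p.1 j)
         | p : 'I_N * ((bop H * bop H) * D) <- [seq (i, r) | i <- index_enum 'I_N, r <- rs]].
  split=> [r|psi b].
    rewrite -map_comp => /mapP[[i q] /allpairsP[[i' q'] [_ qrs [-> ->]]] ->] /=.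
    have [M1 M2] := rsM _ (map_f fst qrs); split=> //.
    exact: (subalgM sM).
  rewrite /= big_map big_allpairs /=; apply: eq_bigr => i _.
  rewrite rsE; case: ifP => _.
    by rewrite mulr_sumr; apply: eq_bigr => r _; rewrite scalerAr !mulrA.
  by rewrite mulr_suml; apply: eq_bigr => r _; rewrite scalerAl !mulrA.
- have [rs [rsM rsE]] := ih (fun b bw => wM b (or_intror bw)).
  exists [seq ((a * p.1.1, p.1.2), p.2) | p <- rs]; split=> [r|psi b].
    rewrite -map_comp => /mapP[q qrs ->] /=.
    have [M1 M2] := rsM _ (map_f fst qrs); split=> //.
    by apply: (subalgM sM) => //; apply: wM; left.
  by rewrite big_map /= rsE; apply: eq_bigr => r _; rewrite !mulrA.
Qed.

Hypothesis philin : forall (c : R[i]) S T, M S -> M T ->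
  phi (c *: S + T) = c * phi S + phi T.
Variable s : seq (l2 H * l2 H).
Hypothesis phib : forall S, M S ->
  nc (phi S) <= \sum_(p <- s) `|kd (amp S p.1) p.2|.
Hypothesis hx : forall c j, adj (x c j) = x c j.

Lemma variables_selfadj n : selfadj (variables_from x n).
Proof. by move=> _ [c [j [nj ->]]]; exists c, j; rewrite hx. Qed.

Lemma Wstar_tail_sub n : Wstar (variables_from x n) `<=` M.
Proof. by move=> T; apply; split=> // _ [c [j [_ ->]]]. Qed.

Lemma wval_mem N (w : seq (letter N)) :
  (forall b, List.In (inr b) w -> M b) -> M (wval w).
Proof.
elim: w => [|l w ih] wM; first by rewrite /wval big_nil; exact: (subalg1 sM).
rewrite /wval big_cons; apply: (subalgM sM); last first.
  by apply: ih => b bw; apply: wM; right.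
by case: l wM => [p|b] wM //=; apply: wM; left.
Qed.

Lemma wval_cat N (w1 w2 : seq (letter N)) : wval (w1 ++ w2) = wval w1 * wval w2.
Proof. by rewrite /wval big_cat. Qed.

Lemma wval_cons N l (w : seq (letter N)) : wval (l :: w) = lval l * wval w.
Proof. by rewrite /wval big_cons. Qed.

(* Coefficients are replaced one at a time, from right to left: the identity is
   linear in each of them, and by normality it survives the approximation of a
   coefficient by polynomials in the variables of index at least [N]. *)
Lemma qsum_word (D : cstarType R) N (v : 'I_N -> 'I_N -> D) (w : seq (letter N)) :
  magic_unitary v ->
  (forall b, List.In (inr b) w -> Wstar (variables_from x N) b) ->
  qsum v w phi = phi (wval w) *: 1.
Proof.
move=> hv wN; have := qsum_elementary [::] hv.
suff: forall e : seq ((face * 'I_N) + (face * nat)),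
  qsum v (w ++ map (@elem_letter N) e) phi = phi (wval (w ++ map (@elem_letter N) e)) *: 1.
  by move=> /(_ [::]); rewrite cats0.
have wM b : List.In (inr b) w -> M b by move=> /wN; exact: Wstar_tail_sub.
elim/last_ind: w wN wM => [|w l ih] wN wM e; first exact: qsum_elementary.
have InR b : List.In (inr b) w -> List.In (inr b) (rcons w l).
  by elim: (w) => [//|a w' ih'] /= [->|/ih' h]; [left|right].
have {}ih := ih (fun b bw => wN b (InR b bw)) (fun b bw => wM b (InR b bw)).
case: l wN wM InR => [p|b] wN wM InR.
  by have := ih (inl p :: e); rewrite -cats1 -catA.
have bN : Wstar (variables_from x N) b.
  by apply: wN; elim: (w) => [|a w' ih'] /=; [left|right].
have {wN}wM1 b' : List.In (inr b') w -> M b' by move=> /InR/wM.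
have eM e' b' : List.In (inr b') (map (@elem_letter N) e') -> M b'.
  by elim: e' => [//|[p|p] e' ih'] /= [//|]; [exact: ih'|move=> [<-]|exact: ih'].
have wMv := wval_mem wM1.
(* The defect of the identity when the last coefficient is T and the suffix is e'. *)
pose g e' T := qsum v (w ++ inr T :: map (@elem_letter N) e') phi
  - phi (wval w * T * wval (map (@elem_letter N) e')) *: 1.
have gE e' : exists rs : seq ((bop H * bop H) * D),
    (forall r, r \in [seq q.1 | q <- rs] -> M r.1 /\ M r.2) /\
    forall T, g e' T = \sum_(r <- rs) phi (r.1.1 * T * r.1.2) *: r.2.
  have [rs [rsM rsE]] := qsum_rep_mid v wM1 (eM e').
  exists (((wval w, wval (map (@elem_letter N) e')), -1) :: rs); split.
    move=> r; rewrite inE => /orP[/eqP ->|]; last exact: rsM.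
    by split=> //=; apply: wval_mem; exact: eM.
  move=> T; rewrite /g rsE big_cons /= addrC; congr (_ + _).
  by rewrite scalerN.
have MLR r T : M r.1 /\ M r.2 -> M T -> M (r.1 * T * r.2).
  by move=> [M1 M2] MT; apply: (subalgM sM) => //; exact: (subalgM sM).
have glin e' c S T : M S -> M T -> g e' (c *: S + T) = c *: g e' S + g e' T.
  move=> MS MT; have [rs [rsM rsE]] := gE e'.
  rewrite !rsE scaler_sumr -big_split /=.
  elim: rs rsM {rsE} => [|r rs ihr] rsM; first by rewrite !big_nil.
  rewrite !big_cons ihr; last by move=> q qr; apply: rsM; rewrite inE qr orbT.
  congr (_ + _); have rM := rsM _ (mem_head _ _).
  have -> : r.1.1 * (c *: S + T) * r.1.2 = c *: (r.1.1 * S * r.1.2) + r.1.1 * T * r.1.2.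
    by rewrite mulrDr mulrDl -bop_scaleAr -bop_scaleAl.
  by rewrite philin ?scalerDl ?scalerA//; exact: MLR.
have gpoly q : generated_algebra (variables_from x N) q ->
    M q /\ forall e', g e' q = 0.
  (* Right multipliers preserving a vanishing defect form an algebra. All suffixes are quantified
     because a variable of index j >= N is absorbed as one more elementary letter, with index j - N,
     at the head of the suffix. *)
  pose Z := [set T | M T /\ forall S, M S -> (forall e', g e' S = 0) -> forall e', g e' (S * T) = 0].
  have M1 := subalg1 sM.
  suff : generated_algebra (variables_from x N) `<=` Z.
    move=> h /h[MT ZT]; split=> // e'; rewrite -[q]mul1r; apply: ZT => // e''.
    rewrite /g mulr1 -wval_cat -ih; apply/eqP; rewrite subr_eq0; apply/eqP.
    have [rs [_ rsE]] := qsum_rep_mid v wM1 (eM e'').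
    elim: (w) (phi) => [|[p|a] w' ihw] ph /=.
    - by apply: qsum_ext => T'; rewrite mul1r.
    - by apply: eq_bigr => i _; rewrite !ihw.
    - exact: ihw.
  apply: generated_min; last first.
    move=> _ [c [j [Nj ->]]]; split=> // S MS gS e'.
    have := gS (inr (c, (j - N)%N) :: e').
    rewrite /g /= subnKC// wval_cons /= !mulrA => <-; congr (_ - _).
    elim: (w) (phi) => [|[p|a] w' ihw] ph /=.
    - by apply: qsum_ext => T'; rewrite mulrA.
    - by apply: eq_bigr => i _; rewrite !ihw.
    - exact: ihw.
  split.
  - by split=> // S MS gS e'; rewrite mulr1.
  - move=> c S T [MS ZS] [MT ZT]; split.
      by apply: (subalgD sM) => //; exact: (subalgZ sM).
    move=> U MU gU e'; rewrite mulrDr -bop_scaleAr glin; [|exact: (subalgM sM)..].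
    by rewrite ZS// ZT// scaler0 addr0.
  - move=> S T [MS ZS] [MT ZT]; split; first exact: (subalgM sM).
    move=> U MU gU; rewrite mulrA; apply: ZT; first exact: (subalgM sM).
    exact: ZS.
have [rs [rsM rsE]] := gE e.
pose K := \sum_(r <- rs) cnorm r.2.
have K0 : 0 <= K by rewrite sumr_ge0// => r _; exact: cnorm_ge0.
suff : cnorm (g e b) <= 0.
  move=> gb; have := cnorm_eq0 (a := g e b); rewrite -cats1 -catA /= => /(_ _)/eqP.
  rewrite subr_eq0 wval_cat wval_cons mulrA => h; apply/eqP/h.
  by apply/eqP; rewrite eq_le gb cnorm_ge0.
(* The list [rs] and hence K are fixed before the precision d, so the defect is at most d K for
   every d. *)
apply: (quadratic_small K0) => d d0.
have [p pN pP] := normal_approx hM phib (variables_selfadj (n := N)) (@Wstar_tail_sub N) bN d0 rsM.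
have [Mp gp] := gpoly p pN; have Mb := Wstar_tail_sub bN.
have -> : g e b = g e (b - p).
  have := glin e (-1) p b Mp Mb; rewrite scaleN1r gp scaler0 add0r addrC => ->.
  by [].
rewrite rsE (le_trans (cnorm_sum _ _))// mulr_sumr.
rewrite big_seq [leRHS]big_seq; apply: ler_sum => r rr.
rewrite cnorm_scale ler_wpM2r ?cnorm_ge0// ltW//; apply: pP.
exact: map_f.
Qed.

End QuantumWords.

(** * Algebraic tensor products *)

Section TensorSeparation.
Variables (R : realType) (V W : lmodType R[i]).
Implicit Types (v : V) (w : W).

Lemma tensDl v v' w : (v + v') ⊗ w = v ⊗ w + v' ⊗ w.
Proof.
apply/tensor_ofP; apply: tens_trans (tens_addl _ _ _) _.
exact: tens_cat (tens_sym (repr_tensor_of [:: (v, w)]))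
  (tens_sym (repr_tensor_of [:: (v', w)])).
Qed.

Lemma tensDr v w w' : v ⊗ (w + w') = v ⊗ w + v ⊗ w'.
Proof.
apply/tensor_ofP; apply: tens_trans (tens_addr _ _ _) _.
exact: tens_cat (tens_sym (repr_tensor_of [:: (v, w)]))
  (tens_sym (repr_tensor_of [:: (v, w')])).
Qed.

Lemma tensZ (c : R[i]) v w : (c *: v) ⊗ w = v ⊗ (c *: w).
Proof. exact/tensor_ofP/tens_scale. Qed.

Lemma tens0l w : (0 : V) ⊗ w = 0.
Proof. exact/tensor_ofP/tens_zero. Qed.

Lemma tensNl v w : (- v) ⊗ w = - (v ⊗ w).
Proof. by apply/eqP; rewrite -addr_eq0 -tensDl addNr tens0l. Qed.

Lemma tens0r v : v ⊗ (0 : W) = 0.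
Proof. by rewrite -(scale0r (0 : W)) -tensZ scale0r tens0l. Qed.

Lemma tens_sumr v n (w : 'I_n -> W) : v ⊗ (\sum_i w i) = \sum_i v ⊗ w i.
Proof.
elim/big_rec2: _ => [|i y z _ <-]; [exact: tens0r|exact: tensDr].
Qed.

Variables (Vm : V -> Prop) (F : (V -> R[i]) -> Prop).
Hypothesis VmD : forall (c : R[i]) u v, Vm u -> Vm v -> Vm (c *: u + v).
Hypothesis Flin : forall f, F f -> forall (c : R[i]) u v, Vm u -> Vm v ->
  f (c *: u + v) = c * f u + f v.
Hypothesis Fsep : forall v, Vm v -> (forall f, F f -> f v = 0) -> v = 0.

(* A linear relation between the right factors shortens the tensor; when they
   are independent, each left factor is killed by all of [F]. *)
Lemma tens_eq0_ord n (v : 'I_n -> V) (w : 'I_n -> W) : (forall i, Vm (v i)) ->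
  (forall f, F f -> \sum_i f (v i) *: w i = 0) -> \sum_i v i ⊗ w i = 0.
Proof.
elim: n v w => [|n ih] v w Vv Fv; first by rewrite big_ord0.
have [[c [c0 [i0 ci0]]]|indep] := pselect (exists c : 'I_n.+1 -> R[i],
    \sum_i c i *: w i = 0 /\ exists i, c i <> 0); last first.
  apply: big1 => i _; suff -> : v i = 0 by exact: tens0l.
  apply: Fsep => // f Ff; apply: contrapT => fv; apply: indep.
  by exists (fun i => f (v i)); split; [exact: Fv|exists i].
have {}ci0 : c i0 != 0 by exact/eqP.
pose d k := - (c (lift i0 k) / c i0).
have wE : w i0 = \sum_k d k *: w (lift i0 k).
  apply: (scalerI ci0); rewrite scaler_sumr.
  move: c0; rewrite (bigD1_ord i0)//= => /eqP; rewrite addr_eq0 => /eqP ->.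
  rewrite -sumrN; apply: eq_bigr => k _; rewrite scalerA /d.
  by rewrite mulrN mulrCA mulfV// mulr1 scaleNr.
rewrite (bigD1_ord i0)//= wE tens_sumr -big_split /=.
rewrite (eq_bigr (fun k => (d k *: v i0 + v (lift i0 k)) ⊗ w (lift i0 k))); last first.
  by move=> k _; rewrite tensDl tensZ.
apply: ih => [k|f Ff]; first exact: VmD.
have := Fv f Ff; rewrite (bigD1_ord i0)//= wE scaler_sumr -big_split /= => e.
apply: etrans e; apply: eq_bigr => k _.
by rewrite (Flin Ff)// scalerDl scalerA mulrC.
Qed.

Lemma tens_eq0 (t : seq (V * W)) : (forall p, p \in t -> Vm p.1) ->
  (forall f, F f -> \sum_(p <- t) f p.1 *: p.2 = 0) ->
  \sum_(p <- t) p.1 ⊗ p.2 = 0.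
Proof.
move=> tV tF; rewrite big_tnth; apply: tens_eq0_ord => [i|f Ff].
  by apply: tV; exact: mem_tnth.
by have := tF f Ff; rewrite big_tnth.
Qed.

End TensorSeparation.

(** * Permutations of the variables *)

Lemma In_rcons T (w : seq T) l a : List.In a (rcons w l) -> l = a \/ List.In a w.
Proof.
elim: w => [|b w ih] /=; first by case=> [->|[]]; left.
by case=> [->|/ih[]]; [right; left|left|right; right].
Qed.

Section BlockSwap.

(* A permutation only when [a + m <= b]. *)
Definition swap (a b m i : nat) : nat :=
  if (a <= i < a + m)%N then (i - a + b)%N
  else if (b <= i < b + m)%N then (i - b + a)%N else i.

Lemma swapK a b m : (a + m <= b)%N -> involutive (swap a b m).
Proof.
by move=> abm i; rewrite /swap; do ?case: ifP; lia.
Qed.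

Lemma swap_far a b m i : (a + m <= b)%N -> (b + m <= i)%N -> swap a b m i = i.
Proof. by move=> ab bi; rewrite /swap; do ?case: ifP; lia. Qed.

Lemma swap_fix a b m i : ~~ (a <= i < a + m)%N -> ~~ (b <= i < b + m)%N ->
  swap a b m i = i.
Proof. by rewrite /swap => /negbTE -> /negbTE ->. Qed.

Lemma swap_l a b m i : (i < m)%N -> swap a b m (a + i) = (b + i)%N.
Proof. by move=> im; rewrite /swap; do ?case: ifP; lia. Qed.

End BlockSwap.

Section Permutations.
Variables (R : realType) (H : hilbertType R) (x : face -> nat -> bop H).
Variables (CS : forall N, quantum_permutation_algebra R N) (phi : bop H -> R[i]).
Hypothesis hbi : quantum_bi_exchangeable x CS phi.
Hypothesis hx : forall c j, adj (x c j) = x c j.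

Local Notation X := (variables_from x 0).
Local Notation M := (Wstar X).
Local Notation B := (tail_algebra x).

Let aX : selfadj X := variables_selfadj hx (n := 0).

Lemma Wstar_vna : von_neumann_algebra M.
Proof. by rewrite Wstar_bicommutant//; exact: bicommutant_vna. Qed.

Let hM := Wstar_vna.
Let sM : subalgebra M := vna_subalgebra hM.
Let aM : selfadj M := hM.1.

Lemma var_mem n c j : (n <= j)%N -> Wstar (variables_from x n) (x c j).
Proof. by move=> nj A [_]; apply; exists c, j. Qed.

Let xM c j : M (x c j) := var_mem c (leq0n j).

Hypothesis philin : forall (c : R[i]) S T, M S -> M T ->
  phi (c *: S + T) = c * phi S + phi T.
Variable s : seq (l2 H * l2 H).
Hypothesis phib : forall S, M S ->
  nc (phi S) <= \sum_(p <- s) `|kd (amp S p.1) p.2|.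

Lemma tail_mem n b : B b -> Wstar (variables_from x n) b.
Proof. exact. Qed.

Lemma tail_subalgebra : subalgebra B.
Proof.
have W n : subalgebra (Wstar (variables_from x n)).
  rewrite Wstar_bicommutant; first exact: commutant_subalgebra.
  exact: variables_selfadj.
split=> [n _|c S T BS BT n _|S T BS BT n _].
- exact: subalg1 (W n).
- by have [_ h _] := W n; apply: h; [exact: BS|exact: BT].
- by have [_ _ h] := W n; apply: h; [exact: BS|exact: BT].
Qed.

Lemma tail_adj : selfadj B.
Proof.
move=> b Bb n _; have aV := variables_selfadj hx (n := n).
have := tail_mem (n := n) Bb; rewrite Wstar_bicommutant// => bW.
by apply: (bicommutant_vna aV).1.
Qed.

(** Different polynomial expressions may have the same value in [M], so the action of f is at first
    only a relation between the values of an expression and of its relabelling; [permutes_unique]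
    makes it single-valued. *)
Inductive permutes (f : nat -> nat) : bop H -> bop H -> Prop :=
| permutes_one : permutes f 1 1
| permutes_lin c S S' T T' : permutes f S S' -> permutes f T T' ->
    permutes f (c *: S + T) (c *: S' + T')
| permutes_tail b T T' : B b -> permutes f T T' -> permutes f (b * T) (b * T')
| permutes_var c j T T' : permutes f T T' ->
    permutes f (x c j * T) (x c (f j) * T').

Lemma permutesB f S S' T T' : permutes f S S' -> permutes f T T' ->
  permutes f (S - T) (S' - T').
Proof.
by move=> pS pT; have := permutes_lin (-1) pT pS; rewrite !scaleN1r ![- _ + _]addrC.
Qed.

Lemma permutesM f S S' T T' : permutes f S S' -> permutes f T T' ->
  permutes f (S * T) (S' * T').
Proof.
move=> pS pT; elim: pS => [|c U U' V V' _ ihU _ ihV|b U U' Bb _ ih|c j U U' _ ih].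
- by rewrite !mul1r.
- rewrite !mulrDl -!bop_scaleAl. exact: permutes_lin.
- by rewrite -!mulrA; exact: permutes_tail.
- by rewrite -!mulrA; exact: permutes_var.
Qed.

Lemma permutes_b f b : B b -> permutes f b b.
Proof. by move=> Bb; have := permutes_tail Bb (permutes_one f); rewrite mulr1. Qed.

Lemma permutes_x f c j : permutes f (x c j) (x c (f j)).
Proof. by have := permutes_var c j (permutes_one f); rewrite !mulr1. Qed.

Lemma permutes_adj f S S' : permutes f S S' -> permutes f (adj S) (adj S').
Proof.
elim=> [|c U U' V V' _ ihU _ ihV|b U U' Bb _ ih|c j U U' _ ih].
- by rewrite adj_one; exact: permutes_one.
- by rewrite !adjD !adjZ; exact: permutes_lin.
- by rewrite !adjM; apply: permutesM => //; apply: permutes_b; exact: tail_adj.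
- by rewrite !adjM !hx; apply: permutesM => //; exact: permutes_x.
Qed.

Lemma permutes_sym f S S' : involutive f -> permutes f S S' -> permutes f S' S.
Proof.
move=> fK; elim=> [|c U U' V V' _ ihU _ ihV|b U U' Bb _ ih|c j U U' _ ih].
- exact: permutes_one.
- exact: permutes_lin.
- exact: permutes_tail.
- by have := permutes_var c (f j) ih; rewrite fK.
Qed.

Lemma permutes_mem f S S' : permutes f S S' -> M S /\ M S'.
Proof.
elim=> [|c U U' V V' _ [MU MU'] _ [MV MV']|b U U' Bb _ [MU MU']|c j U U' _ [MU MU']].
- by split; exact: (subalg1 sM).
- by split; apply: (subalgD sM) => //; exact: (subalgZ sM).
- by split; apply: (subalgM sM) => //; exact: tail_mem.
- by split; apply: (subalgM sM) => //; exact: xM.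
Qed.

Lemma permutes_id S S' : permutes id S S' -> S = S'.
Proof. by elim=> [//|c U U' V V' _ -> _ ->|b U U' _ _ ->|c j U U' _ ->]. Qed.

Section PermutationMatrix.
Variables (N : nat) (g : 'I_N -> 'I_N).
Hypothesis gK : involutive g.

(** A permutation matrix with scalar entries; [CS 0] serves as a unital C*-algebra with 1 different
    from 0. *)
Let v (i j : 'I_N) : CS 0 := (i == g j)%:R.

Lemma permutation_magic : magic_unitary v.
Proof.
split=> [i j|i j|k|k].
- by rewrite /v; case: eqP; rewrite ?star0 ?star1.
- by rewrite /v; case: eqP; rewrite ?mul0r ?mul1r.
- rewrite (bigD1 (g k))//= /v eqxx big1 ?addr0// => i /negbTE -> //.
- rewrite (bigD1 (g k))//= /v gK eqxx big1 ?addr0// => i ik.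
  by case: eqP => // ki; move: ik; rewrite ki gK eqxx.
Qed.

Definition permute_letter (l : letter H N) : letter H N :=
  match l with inl p => inl (p.1, g p.2) | inr b => inr b end.

Lemma qsum_permutation (w : seq (letter H N)) psi :
  qsum x v w psi = psi (wval x (map permute_letter w)) *: 1.
Proof.
elim: w psi => [|[[c j]|b] w ih] psi /=; first by rewrite /wval big_nil.
- rewrite (bigD1 (g j))//= big1 ?addr0; last first.
    by move=> i /negbTE ij; rewrite /v ij mul0r mulr0; case: ifP.
  by rewrite /v eqxx mul1r mulr1 ih wval_cons; case: ifP.
- by rewrite ih wval_cons.
Qed.

(** Two evaluations of the same [qsum] are compared: by exchangeability with coefficients, and
    directly, where each sum over row indices has one nonzero term. *)
Lemma exchangeable_word (w : seq (letter H N)) :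
  (forall b, List.In (inr b) w -> B b) ->
  phi (wval x w) = phi (wval x (map permute_letter w)).
Proof.
move=> wB; have := qsum_permutation w phi.
have wN b : List.In (inr b) w -> Wstar (variables_from x N) b.
  by move=> /wB; exact: tail_mem.
rewrite (qsum_word hbi hM xM philin phib hx permutation_magic wN) => /eqP.
rewrite -subr_eq0 -scalerBl scaler_eq0 oner_eq0 orbF subr_eq0.
by move/eqP.
Qed.

End PermutationMatrix.

Definition finite_involution (f : nat -> nat) :=
  involutive f /\ exists N, forall i, (N <= i)%N -> f i = i.

Definition nletter : Type := (face * nat) + bop H.

Definition nval (l : nletter) : bop H :=
  match l with inl p => x p.1 p.2 | inr b => b end.

Definition nperm (f : nat -> nat) (l : nletter) : nletter :=
  match l with inl p => inl (p.1, f p.2) | inr b => inr b end.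

Lemma exchangeable_nword f (w : seq nletter) : finite_involution f ->
  (forall b, List.In (inr b) w -> B b) ->
  phi (\prod_(l <- w) nval l) = phi (\prod_(l <- map (nperm f) w) nval l).
Proof.
move=> [fK [N fN]] wB.
have [k [Nk wk]] : exists k, (N <= k)%N /\
    all (fun l : nletter => if l is inl p then (p.2 < k.+1)%N else true) w.
  elim: (w) => [|[p|b] w' [k [Nk ih]]]; [by exists N|exists (maxn k p.2)|by exists k].
  split; first by rewrite leq_max Nk.
  rewrite /= ltnS leq_maxr /=; apply: sub_all ih => -[q|//] /=.
  by rewrite !ltnS => /leq_trans; apply; exact: leq_maxl.
(* An image beyond the support would be fixed by f, and f being an involution it would equal i. *)
have fk i : (i < k.+1)%N -> (f i < k.+1)%N.
  move=> ik; rewrite ltnNge; apply/negP => kf.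
  have fNi : (N <= f i)%N by lia.
  by have := fN _ fNi; rewrite fK => ifi; move: kf; rewrite -ifi; lia.
pose g (i : 'I_k.+1) : 'I_k.+1 := inord (f i).
have gE i : g i = f i :> nat by rewrite inordK ?fk.
have gK : involutive g by move=> i; apply: val_inj; rewrite /= !gE fK.
pose w' : seq (letter H k.+1) :=
  [seq (match l with inl p => inl (p.1, inord p.2) | inr b => inr b end : letter H k.+1) | l <- w].
have w'B b : List.In (inr b) w' -> B b.
  move=> bw; apply: wB; move: bw; rewrite /w'.
  by elim: (w) => [//|[p|a] w2 ih] /= [|/ih]; [|right|move=> [->]; left|right].
have <- : wval x w' = \prod_(l <- w) nval l.
  rewrite /wval /w' big_map; elim: (w) wk => [|[p|b] w2 ih] /=;
    rewrite ?big_nil// !big_cons /=; last by move=> /ih ->.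
  by move=> /andP[pk /ih ->]; rewrite inordK.
have <- : wval x (map (permute_letter g) w') = \prod_(l <- map (nperm f) w) nval l.
  rewrite /wval /w' !big_map; elim: (w) wk => [|[p|b] w2 ih] /=;
    rewrite ?big_nil// !big_cons /=; last by move=> /ih ->.
  by move=> /andP[pk /ih ->]; rewrite gE inordK.
exact: exchangeable_word.
Qed.

Lemma permutes_phi f S S' : finite_involution f -> permutes f S S' -> phi S = phi S'.
Proof.
move=> hf pS.
(* The constructors of [permutes] add letters on the left, so the induction carries a prefix word
   that takes them over. *)
suff h (w : seq nletter) : (forall b, List.In (inr b) w -> B b) ->
    phi ((\prod_(l <- w) nval l) * S) = phi ((\prod_(l <- map (nperm f) w) nval l) * S').
  by have := h [::] (fun b => False_ind _); rewrite !big_nil !mul1r.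
have wM (w' : seq nletter) : (forall b, List.In (inr b) w' -> B b) ->
    M (\prod_(l <- w') nval l).
  elim: w' => [|[p|b] w' ih] wB; rewrite ?big_nil ?big_cons /=.
  - exact: (subalg1 sM).
  - by apply: (subalgM sM); [exact: xM|apply: ih => b bw; apply: wB; right].
  - apply: (subalgM sM); first by apply: tail_mem; apply: wB; left.
    by apply: ih => a aw; apply: wB; right.
have wfB (w' : seq nletter) : (forall b, List.In (inr b) w' -> B b) ->
    (forall b, List.In (inr b) (map (nperm f) w') -> B b).
  move=> wB b; elim: w' wB => [//|[p|a] w' ih] wB /= [] //.
  - by apply: ih => b' bw; apply: wB; right.
  - by move=> [<-]; apply: wB; left.
  - by apply: ih => b' bw; apply: wB; right.
elim: pS w => [|c U U' V V' pU ihU pV ihV|b U U' Bb pU ih|c j U U' pU ih] w wB.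
- by rewrite !mulr1; exact: exchangeable_nword.
- rewrite !mulrDr -!bop_scaleAr.
  have [MU MU'] := permutes_mem pU; have [MV MV'] := permutes_mem pV.
  have Mw := wM _ wB; have Mw' := wM _ (wfB _ wB).
  by rewrite !philin ?ihU ?ihV//; exact: (subalgM sM).
- have := ih (rcons w (inr b)); rewrite map_rcons !big_rcons /= -!mulrA; apply => a aw.
  by case: (In_rcons aw) => [e|]; [case: e => <-|exact: wB].
- have := ih (rcons w (inl (c, j))); rewrite map_rcons !big_rcons /= -!mulrA; apply => a aw.
  by case: (In_rcons aw) => [//|]; exact: wB.
Qed.

Hypothesis phind : nondegenerate_on M phi.
Hypothesis phipos : forall T, M T -> 0 <= phi (adj T * T).

Lemma permutes_var_alg f y : generated_algebra X y -> exists y', permutes f y y'.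
Proof.
pose Z := [set y | exists y', permutes f y y'].
suff : generated_algebra X `<=` Z by apply.
apply: generated_min; last by move=> _ [c [j [_ ->]]]; exists (x c (f j)); exact: permutes_x.
split=> [|c S T [S' pS] [T' pT]|S T [S' pS] [T' pT]].
- by exists 1; exact: permutes_one.
- by exists (c *: S' + T'); exact: permutes_lin.
- by exists (S' * T'); exact: permutesM.
Qed.

(* [phi] need not be faithful, but being nondegenerate it determines the norm of
   [M], so that the invariance of [phi] makes a permutation isometric. *)
Lemma permutes_nb f T T' (c : R) : finite_involution f -> permutes f T T' ->
  0 <= c -> nb c T -> nb c T'.
Proof.
move=> hf pT c0 Tc; have [MT MT'] := permutes_mem pT.
(* The norm criterion asks for a positive constant, whereas c may be 0, the case that gives
   uniqueness. *)
suff h (e : R) : 0 < e -> nb (c + e) T'.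
  move=> v; apply/ler_addgt0Pr => e e0.
  have d0 : 0 < e / (hn v + 1) by rewrite divr_gt0// ltr_wpDl ?nrm_ge0.
  rewrite (le_trans (h _ d0 v))// mulrDl lerD2l mulrAC ler_pdivrMr.
    by rewrite ler_pM2l// lerDl.
  by rewrite ltr_wpDl ?nrm_ge0.
move=> e0; have ce : 0 < c + e by lra.
have XM : Wstar X = M by [].
apply: (normal_norm hM philin phib aX XM phind phipos MT' ce) => y Xy.
have [y' py] := permutes_var_alg f Xy; have [My My'] := permutes_mem py.
have pTy := permutesM pT (permutes_sym hf.1 py).
rewrite -(permutes_phi hf (permutesM (permutes_adj pTy) pTy)).
have py' := permutes_sym hf.1 py.
rewrite -(permutes_phi hf (permutesM (permutes_adj py') py')).
apply: (state_norm hM philin phipos ce MT My').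
by apply: nb_le Tc; lra.
Qed.

(** By linearity 0 is related to U - V, and the bound 0 is preserved. *)
Lemma permutes_unique f T U V : finite_involution f ->
  permutes f T U -> permutes f T V -> U = V.
Proof.
move=> hf pU pV; apply/eqP; rewrite -subr_eq0; apply/eqP/nb0_eq0.
by apply: (permutes_nb hf (permutesB pU pV)) => //; rewrite subrr; exact: nb0.
Qed.

(** * Polynomials over the tail algebra and their supports *)

Definition alg_on (P : set nat) : set (bop H) :=
  generated_algebra (B `|` [set T | exists c j, P j /\ T = x c j]).

Lemma alg_on_subalgebra P : subalgebra (alg_on P).
Proof. exact: subalgebra_generated. Qed.

Lemma alg_on_tail P b : B b -> alg_on P b.
Proof. by move=> Bb; apply: sub_generated; left. Qed.

Lemma alg_on_var (P : set nat) c j : P j -> alg_on P (x c j).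
Proof. by move=> Pj; apply: sub_generated; right; exists c, j. Qed.

Lemma alg_on_ind (P : set nat) (Q : bop H -> Prop) : Q 1 ->
  (forall c S T, Q S -> Q T -> Q (c *: S + T)) ->
  (forall S T, Q S -> Q T -> Q (S * T)) ->
  (forall b, B b -> Q b) -> (forall c j, P j -> Q (x c j)) ->
  forall T, alg_on P T -> Q T.
Proof.
move=> Q1 QD QM QB Qx; apply: (@generated_min _ _ _ (fun T => Q T)); first by split.
by move=> T [/QB//|[c [j [Pj ->]]]]; exact: Qx.
Qed.

Lemma alg_on_mono (P Q : set nat) : P `<=` Q -> alg_on P `<=` alg_on Q.
Proof.
move=> PQ; apply: generated_mono => T [BT|[c [j [Pj ->]]]]; [by left|right].
by exists c, j; split=> //; exact: PQ.
Qed.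

Lemma alg_on_adj P : selfadj (alg_on P).
Proof.
apply: generated_adj => T [BT|[c [j [Pj ->]]]]; [left; exact: tail_adj|right].
by exists c, j; rewrite hx.
Qed.

Lemma alg_on_finite_in (P : set nat) T : alg_on P T ->
  exists m, alg_on (P `&` [set j | (j < m)%N]) T.
Proof.
pose Pm m := P `&` [set j | (j < m)%N].
have mono m n : (m <= n)%N -> alg_on (Pm m) `<=` alg_on (Pm n).
  by move=> mn; apply: alg_on_mono => j [Pj jm]; split=> //; exact: leq_trans jm mn.
apply: (@alg_on_ind P (fun T => exists m, alg_on (Pm m) T))
  => [|c S U [m Sm] [n Un]|S U [m Sm] [n Un]|b Bb|c j Pj].
- by exists 0%N; exact: subalg1 (alg_on_subalgebra _).
- exists (maxn m n); have [_ h _] := alg_on_subalgebra (Pm (maxn m n)).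
  by apply: h; [apply: mono Sm; exact: leq_maxl|apply: mono Un; exact: leq_maxr].
- exists (maxn m n); have [_ _ h] := alg_on_subalgebra (Pm (maxn m n)).
  by apply: h; [apply: mono Sm; exact: leq_maxl|apply: mono Un; exact: leq_maxr].
- by exists 0%N; exact: alg_on_tail.
- by exists j.+1; apply: alg_on_var; split=> /=.
Qed.

Lemma alg_on_finite T : alg_on setT T -> exists m, alg_on [set j | (j < m)%N] T.
Proof. by move=> /alg_on_finite_in[m]; rewrite setTI => mT; exists m. Qed.

Lemma alg_on_Wstar n : alg_on [set j | (n <= j)%N] `<=` Wstar (variables_from x n).
Proof.
apply: generated_min; last first.
  by move=> T [BT|[c [j [nj ->]]]]; [exact: tail_mem|exact: var_mem].
rewrite Wstar_bicommutant; first exact: commutant_subalgebra.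
exact: variables_selfadj.
Qed.

Lemma alg_on_sub (P : set nat) : alg_on P `<=` M.
Proof. by move=> T PT; apply: alg_on_Wstar; apply: alg_on_mono PT. Qed.

Lemma permutes_fix (P : set nat) f T : (forall j, P j -> f j = j) ->
  alg_on P T -> permutes f T T.
Proof.
move=> fP; apply: (@alg_on_ind P (fun T => permutes f T T)) => [|c S U|S U|b|c j Pj].
- exact: permutes_one.
- exact: permutes_lin.
- exact: permutesM.
- exact: permutes_b.
- by have := permutes_x f c j; rewrite fP.
Qed.

(** U and V are read off one and the same expression of T, which is what relates them by h and
    locates the support of U. *)
Lemma permutes_compose (P : set nat) f g h T : (forall j, P j -> h (f j) = g j) ->
  alg_on P T -> exists U V, [/\ permutes f T U, permutes g T V, permutes h U V
    & alg_on (f @` P) U].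
Proof.
move=> hfg; apply: (@alg_on_ind P (fun T => exists U V, [/\ permutes f T U, permutes g T V,
  permutes h U V & alg_on (f @` P) U])).
- exists 1, 1; split; try exact: permutes_one.
  exact: subalg1 (alg_on_subalgebra _).
- move=> c S T' [U [V [fU gV UV PU]]] [U' [V' [fU' gV' UV' PU']]].
  exists (c *: U + U'), (c *: V + V'); split; try exact: permutes_lin.
  by have [_ k _] := alg_on_subalgebra (f @` P); exact: k.
- move=> S T' [U [V [fU gV UV PU]]] [U' [V' [fU' gV' UV' PU']]].
  exists (U * U'), (V * V'); split; try exact: permutesM.
  by have [_ _ k] := alg_on_subalgebra (f @` P); exact: k.
- move=> b Bb; exists b, b; split; try exact: permutes_b.
  exact: alg_on_tail.
- move=> c j Pj; exists (x c (f j)), (x c (g j)); split; try exact: permutes_x.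
    by have := permutes_x h c (f j); rewrite hfg.
  by apply: alg_on_var; exists j.
Qed.

(** * The conditional expectation *)

Implicit Types (S T U y z : bop H) (v w : H).

Lemma swap_finite a b m : (a + m <= b)%N -> finite_involution (swap a b m).
Proof.
by move=> abm; split; [exact: swapK|exists (b + m)%N => i; exact: swap_far].
Qed.

Local Notation algN := (alg_on setT).

Let sN : subalgebra algN := alg_on_subalgebra setT.

Lemma alg_on_setT (P : set nat) : alg_on P `<=` algN.
Proof. by move=> T; exact: alg_on_mono. Qed.

(* The junk value [0] is taken only outside the algebra generated by the tail and
   the variables. *)
Definition moved k T : bop H := xget (0 : bop H) [set T' | permutes (swap 0 k k) T T'].

Lemma movedP k T : algN T -> permutes (swap 0 k k) T (moved k T).
Proof.
move=> NT; rewrite /moved; case: xgetP => [T' _ //|none].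
have [||U [_ [pU _ _ _]]] := @permutes_compose setT (swap 0 k k) (swap 0 k k) id T.
- by [].
- exact: NT.
- by case: (none U).
Qed.

Lemma moved_unique k T T' : permutes (swap 0 k k) T T' -> moved k T = T'.
Proof.
move=> pT; rewrite /moved; case: xgetP => [U _ pU|/(_ T')//].
exact: permutes_unique (swap_finite (leqnn _)) pU pT.
Qed.

Lemma moved_nb k T (c : R) : algN T -> 0 <= c -> nb c T -> nb c (moved k T).
Proof. by move=> NT; apply: permutes_nb (swap_finite (leqnn _)) (movedP k NT). Qed.

Lemma moved_mem k T : algN T -> M (moved k T).
Proof. by move=> NT; case: (permutes_mem (movedP k NT)). Qed.

Lemma moved_bnd T v w : algN T -> bnd (fun k => hd (moved k T v) w).
Proof.
move=> NT; have [c c0 Tc] := nb_exists T; exists (c * hn v * hn w) => k.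
by apply: nb_hd; [exact: ltW|apply: moved_nb => //; exact: ltW].
Qed.

Definition cexp T : bop H :=
  xget (0 : bop H) [set S : bop H | forall v w, hd (S v) w = ulim (fun k => hd (moved k T v) w)].

Lemma cexpP T v w : algN T -> hd (cexp T v) w = ulim (fun k => hd (moved k T v) w).
Proof.
move=> NT; move: v w; rewrite /cexp; case: xgetP => [//|none].
have [c c0 Tc] := nb_exists T.
have [S _ SP] := weak_limit_exists (ltW c0) (fun k => moved_nb k NT (ltW c0) Tc).
by case: (none S).
Qed.

Lemma cexp_eq T S : algN T ->
  (forall v w, hd (S v) w = ulim (fun k => hd (moved k T v) w)) -> cexp T = S.
Proof.
move=> NT SP; apply: bopP => v; apply: hd_eq => w.
by rewrite SP cexpP.
Qed.

Lemma cexp_nb T (c : R) : algN T -> 0 <= c -> nb c T -> nb c (cexp T).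
Proof.
move=> NT c0 Tc v; apply: (nrm_le_dual hd_form); first by rewrite mulr_ge0 ?nrm_ge0.
move=> w; rewrite cexpP// (le_trans (ler_norm _))//; apply: ulim_norm_le => k.
by apply: nb_hd => //; exact: moved_nb.
Qed.

Lemma moved_tail (T : bop H) m n k : alg_on [set j | (j < m)%N] T ->
  (m <= k)%N -> (n <= k)%N -> Wstar (variables_from x n) (moved k T).
Proof.
move=> mT mk nk.
have [||U [_ [pU _ _ PU]]] := @permutes_compose [set j | (j < m)%N]
  (swap 0 k k) (swap 0 k k) id T; [by []|exact: mT|].
rewrite (moved_unique pU); apply: alg_on_Wstar; apply: alg_on_mono PU.
move=> _ [j /= jm <-]; have := @swap_l 0 k k j (leq_trans jm mk).
by rewrite add0n => ->; rewrite (leq_trans nk)// leq_addr.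
Qed.

(** For every n, all late translates lie in the von Neumann algebra of the variables from n on,
    which as a commutant is stable under weak limits. *)
Lemma cexp_tail T : algN T -> B (cexp T).
Proof.
move=> NT n _; have aV := variables_selfadj hx (n := n).
rewrite Wstar_bicommutant//.
have [m mT] := alg_on_finite NT.
apply: (commutant_weak_limit (T := fun k => moved k T)).
- by move=> v w; exact: moved_bnd.
- by move=> v w; exact: cexpP.
- exists (maxn m n) => k; rewrite geq_max => /andP[mk nk].
  by rewrite -Wstar_bicommutant//; exact: moved_tail mT mk nk.
Qed.

Lemma moved_fix k (b : bop H) : B b -> moved k b = b.
Proof. by move=> Bb; apply: moved_unique; exact: permutes_b. Qed.

Lemma cexp_fix (b : bop H) : B b -> cexp b = b.
Proof.
move=> Bb; apply: cexp_eq => [|v w]; first exact: alg_on_tail.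
by apply/esym/ulim_near; exists 0%N => k _; rewrite moved_fix.
Qed.

Lemma cexp_lin c S T : algN S -> algN T -> cexp (c *: S + T) = c *: cexp S + cexp T.
Proof.
move=> NS NT; apply: cexp_eq => [|v w].
  by have [_ h _] := sN; exact: h.
rewrite bopD bopZ (ipDl hd_form) hd_conj !cexpP// -ulimD; try exact: moved_bnd.
congr ulim; apply/funext => k.
rewrite (moved_unique (permutes_lin c (movedP k NS) (movedP k NT))).
by rewrite bopD bopZ (ipDl hd_form) hd_conj.
Qed.

Lemma cexp_bimod (b : bop H) T b' : B b -> algN T -> B b' -> cexp (b * T * b') = b * cexp T * b'.
Proof.
move=> Bb NT Bb'; apply: cexp_eq => [|v w].
  by apply: (subalgM sN); [apply: (subalgM sN)|] => //; exact: alg_on_tail.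
rewrite !bopM hd_adj cexpP//; congr ulim; apply/funext => k.
have := permutesM (permutesM (permutes_b _ Bb) (movedP k NT)) (permutes_b _ Bb').
by move=> /moved_unique ->; rewrite !bopM [RHS]hd_adj.
Qed.

(* Past the supports of [y], [z] and [T], all the far translates of [T] give
   the same value, so that the limit defining [cexp] is attained. *)
Lemma phi_cexp y z T : algN y -> algN z -> algN T ->
  exists m, forall k, (m <= k)%N -> phi (y * cexp T * z) = phi (y * moved k T * z).
Proof.
move=> Ny Nz NT.
have [my yP] := alg_on_finite Ny; have [mz zP] := alg_on_finite Nz.
have [mT TP] := alg_on_finite NT.
pose m := maxn mT (maxn my mz); exists m => k mk.
have [my_k mz_k mT_k] : [/\ (my <= k)%N, (mz <= k)%N & (mT <= k)%N] by split; rewrite /m in mk; lia.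
have [c c0 Tc] := nb_exists T.
apply: (normal_weak_limit hM philin phib (ltW c0) (fun j => moved_nb j NT (ltW c0) Tc)).
- by move=> v w; exact: cexpP.
- by move=> j; exact: moved_mem.
- by apply: tail_mem; exact: cexp_tail.
- exact: alg_on_sub Ny.
- exact: alg_on_sub Nz.
exists (k + m)%N => k' kk'.
have km_k' : (k + mT <= k')%N by rewrite /m in kk'; lia.
(* Exchanging [k, k + mT) with [k', k' + mT) fixes y and z, supported below k, and carries the k-th
   translate of T to the k'-th. *)
have fixes (P : set nat) U : (forall j, P j -> (j < k)%N) -> alg_on P U ->
    permutes (swap k k' mT) U U.
  by move=> Pk PU; apply: permutes_fix PU => j /Pk jk; apply: swap_fix; lia.
have py : permutes (swap k k' mT) y y by apply: fixes yP => j /= jm; lia.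
have pz : permutes (swap k k' mT) z z by apply: fixes zP => j /= jm; lia.
have [||U [V [pU pV pUV _]]] := @permutes_compose [set j | (j < mT)%N]
  (swap 0 k k) (swap 0 k' k') (swap k k' mT) T.
- move=> j /= jm; rewrite -[j]add0n (@swap_l 0 k) ?(@swap_l 0 k') ?swap_l//; lia.
- exact: TP.
rewrite (moved_unique pU) (moved_unique pV); apply/esym.
by apply: permutes_phi (swap_finite km_k') _; apply: permutesM => //; exact: permutesM.
Qed.

(** Applying the swap to the whole product undoes the translation of T and puts it on y and z, which
    become far coefficients around an unchanged T. *)
Lemma phi_cexp_moved y z T : algN y -> algN z -> algN T ->
  exists m, forall k, (m <= k)%N ->
    phi (y * cexp T * z) = phi (moved k y * T * moved k z).
Proof.
move=> Ny Nz NT; have [m mP] := phi_cexp Ny Nz NT; exists m => k mk.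
rewrite (mP k mk); have hf := swap_finite (leqnn (0 + k)).
apply: (permutes_phi hf); apply: permutesM; last exact: movedP.
by apply: permutesM; [exact: movedP|apply: permutes_sym (movedP _ _) => //; exact: hf.1].
Qed.

Lemma algN_separation S T : M S -> M T ->
  (forall y z, algN y -> algN z -> phi (y * S * z) = phi (y * T * z)) -> S = T.
Proof.
move=> MS MT ST; apply/eqP; rewrite -subr_eq0; apply/eqP.
have XM : Wstar X = M by [].
have MST : M (S - T) by exact: (subalgB sM).
apply: (normal_separation hM philin phib aX XM phind MST) => y z Xy Xz.
have XN : generated_algebra X `<=` algN.
  apply: generated_min sN _ => _ [c [j [_ ->]]]; exact: alg_on_var.
have Ny : algN (adj y) by apply: alg_on_adj; exact: XN.
have Nz := XN _ Xz.
have M3 U : M U -> M (adj y * U * z).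
  move=> MU; apply: (subalgM sM); last exact: alg_on_sub Nz.
  by apply: (subalgM sM) => //; exact: alg_on_sub Ny.
rewrite mulrBr mulrBl (stB hM philin (M3 _ MS) (M3 _ MT)).
by rewrite (ST _ _ Ny Nz) subrr.
Qed.

(** By bimodularity the claim is that W T and W E(T) have the same expectation. Between far elements
    u and v, E(T) may be replaced by a far translate of T; since T involves the single index j, a
    transposition fixing u, W and v turns that translate back into T. *)
Lemma cexp_factor (W T : bop H) j : alg_on [set i | i <> j] W -> alg_on [set j] T ->
  cexp (W * T) = cexp W * cexp T.
Proof.
move=> PW PT; have NW := alg_on_setT PW; have NT := alg_on_setT PT.
have NWT : algN (W * T) by exact: (subalgM sN).
have BT := cexp_tail NT; have BW := cexp_tail NW.
have NET : algN (cexp T) by exact: alg_on_tail.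
have -> : cexp W * cexp T = cexp (W * cexp T).
  have B1 : B 1 by exact: subalg1 tail_subalgebra.
  by have := cexp_bimod B1 NW BT; rewrite !mul1r => ->.
have NWET : algN (W * cexp T) by exact: (subalgM sN).
apply: algN_separation => [||y z Ny Nz].
- by apply: tail_mem; exact: cexp_tail.
- by apply: tail_mem; exact: cexp_tail.
have [m1 m1P] := phi_cexp_moved Ny Nz NWT.
have [m2 m2P] := phi_cexp_moved Ny Nz NWET.
have [my yP] := alg_on_finite Ny; have [mz zP] := alg_on_finite Nz.
(* Large enough for both limits, for the supports of y and z, and for the block [k, 2k) to miss
   j. *)
pose k := (m1 + m2 + my + mz + j.+1)%N.
rewrite (m1P k) ?(m2P k); try (rewrite /k; lia).
have far (m : nat) u : (m <= k)%N -> alg_on [set i | (i < m)%N] u ->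
    alg_on [set i | (k <= i < k + k)%N] (moved k u).
  move=> mk mu; have [||U [_ [pU _ _ PU]]] := @permutes_compose [set i | (i < m)%N]
    (swap 0 k k) (swap 0 k k) id u; [by []|exact: mu|].
  rewrite (moved_unique pU); apply: alg_on_mono PU => _ [i /= im <-].
  by rewrite -(add0n i) swap_l; lia.
have yk : alg_on [set i | (k <= i < k + k)%N] (moved k y) by apply: far yP; rewrite /k; lia.
have zk : alg_on [set i | (k <= i < k + k)%N] (moved k z) by apply: far zP; rewrite /k; lia.
set u := moved k y in yk *; set v := moved k z in zk *.
have Nu := alg_on_setT yk; have Nv := alg_on_setT zk.
have NuW : algN (u * W) by exact: (subalgM sN).
rewrite !mulrA.
have [m3 m3P] := phi_cexp NuW Nv NT.
have [mW WP] := alg_on_finite_in PW.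
(* The new index j + l must avoid the supports of u and v, below 2k, and of W, below mW; and j < l
   makes the block swap move j to j + l. *)
pose l := (m3 + k + k + mW + j.+1)%N.
rewrite (m3P l); last by rewrite /l; lia.
have jl : (j + 1 <= j + l)%N by rewrite /l; lia.
have [||U [V [pU pV /permutes_id UV _]]] := @permutes_compose [set j]
  (swap 0 l l) (swap j (j + l) 1) id T.
- by move=> _ ->; rewrite /swap; do ?case: ifP; rewrite /l; lia.
- exact: PT.
rewrite (moved_unique pU) UV.
apply: permutes_phi (swap_finite jl) _.
have pfar t : alg_on [set i | (k <= i < k + k)%N] t -> permutes (swap j (j + l) 1) t t.
  by apply: permutes_fix => i /= ik; apply: swap_fix; rewrite /k /l in ik *; lia.
apply: permutesM; last exact: pfar.
apply: permutesM; last exact: pV.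
apply: permutesM; first exact: pfar.
apply: permutes_fix WP => i [/= ij im]; apply: swap_fix; rewrite /l; last lia.
by apply/negP => h; apply: ij; lia.
Qed.

(** * Strong bi-invariance and factorisation of the expectation *)

Definition bletters N n (b : 'I_n.+1 -> bop H) (chi : 'I_n -> face) (J : 'I_n -> 'I_N) :
    seq (letter H N) :=
  flatten [seq [:: inr (b (widen_ord (leqnSn n) i)); inl (chi i, J i)] | i <- enum 'I_n]
  ++ [:: inr (b ord_max)].

Lemma bword_ordS n (b : 'I_n.+2 -> bop H) (chi : 'I_n.+1 -> face) (j : 'I_n.+1 -> nat) :
  bword x b chi j = b ord0 * (x (chi ord0) (j ord0) *
    bword x (fun k => b (lift ord0 k)) (fun k => chi (lift ord0 k)) (fun k => j (lift ord0 k))).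
Proof.
rewrite /bword big_ord_recl /= -!mulrA; congr (b _ * (_ * _)); first exact: val_inj.
congr (_ * b _); last exact: val_inj.
by apply: eq_bigr => i _; congr (b _ * _); exact: val_inj.
Qed.

Lemma bletters_ordS N n (b : 'I_n.+2 -> bop H) (chi : 'I_n.+1 -> face) (J : 'I_n.+1 -> 'I_N) :
  bletters b chi J = inr (b ord0) :: inl (chi ord0, J ord0) ::
    bletters (fun k => b (lift ord0 k)) (fun k => chi (lift ord0 k)) (fun k => J (lift ord0 k)).
Proof.
rewrite /bletters enum_ordSl /= -map_comp; congr (inr (b _) :: _ :: _ ++ [:: inr (b _)]).
- exact: val_inj.
- congr flatten; apply: eq_map => i /=; congr [:: inr (b _); _]; exact: val_inj.
- exact: val_inj.
Qed.

Lemma qsum_bword N n (b : 'I_n.+1 -> bop H) (chi : 'I_n -> face) (J : 'I_n -> 'I_N)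
    (psi : bop H -> R[i]) :
  \sum_(I : {ffun 'I_n -> 'I_N}) psi (bword x b chi (fun i => I i)) *: u_chi (CS N) chi I J
  = qsum x (@qperm_gen _ _ (CS N)) (bletters b chi J) psi.
Proof.
elim: n b chi J psi => [|n ih] b chi J psi.
  have f0 : 'I_0 -> 'I_N by case.
  rewrite (big_pred1 (finfun f0)).
    rewrite /bletters /bword big_ord0 /u_chi /s_chi.
    have -> : enum 'I_0 = [::] by apply: size0nil; rewrite size_enum_ord.
    by rewrite big_nil mul1r /= mulr1.
  by move=> I /=; apply/esym/eqP/ffunP => -[].
rewrite bletters_ordS /=.
pose F (i : 'I_N) (I' : {ffun 'I_n -> 'I_N}) : CS N :=
  psi (b ord0 * (x (chi ord0) i * bword x (fun k => b (lift ord0 k))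
         (fun k => chi (lift ord0 k)) (fun k => I' k))) *:
  (let u := u_chi (CS N) (fun k => chi (lift ord0 k)) I' (fun k => J (lift ord0 k)) in
   if Defs.is_left (chi ord0) then qperm_gen (CS N) i (J ord0) * u
   else u * qperm_gen (CS N) i (J ord0)).
transitivity (\sum_(I : {ffun 'I_n.+1 -> 'I_N}) F (I ord0) [ffun k => I (lift ord0 k)]).
  apply: eq_bigr => I _; rewrite /F u_chi_ordS bword_ordS /=.
  move: [ffun k => I (lift ord0 k)] (ffunE (fun k => I (lift ord0 k))) => I' I'E.
  have -> : (fun k => I (lift ord0 k)) = I' :> ('I_n -> 'I_N) by apply/funext.
  have -> // : (fun k => I (lift ord0 k) : nat) = (fun k => I' k : nat).
  by apply/funext => k; rewrite I'E.
rewrite big_ffun_ordS; apply: eq_bigr => i _; rewrite /F.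
rewrite -(ih _ _ _ (fun T => psi (b ord0 * (x (chi ord0) i * T)))).
case: Defs.is_left => /=.
- by rewrite mulr_sumr; apply: eq_bigr => I _; rewrite scalerAr.
- by rewrite mulr_suml; apply: eq_bigr => I _; rewrite scalerAl.
Qed.

Lemma wval_bletters N n (b : 'I_n.+1 -> bop H) (chi : 'I_n -> face) (J : 'I_n -> 'I_N) :
  wval x (bletters b chi J) = bword x b chi (fun i => J i).
Proof.
elim: n b chi J => [|n ih] b chi J; last first.
  by rewrite bletters_ordS bword_ordS !wval_cons ih.
rewrite /bletters /bword big_ord0.
have -> : enum 'I_0 = [::] by apply: size0nil; rewrite size_enum_ord.
by rewrite wval_cons /wval big_nil mul1r mulr1.
Qed.

Lemma qsum_rcons N (D : algType R[i]) (v : 'I_N -> 'I_N -> D) (w : seq (letter H N)) z psi :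
  qsum x v (w ++ [:: inr z]) psi = qsum x v w (fun T => psi (T * z)).
Proof.
elim: w psi => [|[[c j]|b] w ih] psi /=.
- by rewrite mulr1 mul1r.
- by apply: eq_bigr => i _; rewrite ih; congr (if _ then _ * _ else _ * _);
    apply: qsum_ext => T; rewrite mulrA.
- by rewrite ih; apply: qsum_ext => T; rewrite mulrA.
Qed.

Lemma In_bletters N n (b : 'I_n.+1 -> bop H) (chi : 'I_n -> face) (J : 'I_n -> 'I_N) a :
  List.In (inr a) (bletters b chi J) -> exists i, a = b i.
Proof.
elim: n b chi J => [|n ih] b chi J.
  rewrite /bletters; have -> : enum 'I_0 = [::] by apply: size0nil; rewrite size_enum_ord.
  by move=> [[<-]|[]]; exists ord_max.
rewrite bletters_ordS => -[[<-]|[//|/ih[i ->]]]; first by exists ord0.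
by exists (lift ord0 i).
Qed.

(** Here y and z enter the word as its first and last coefficients, hence the condition that they
    come from variables of index at least N. *)
Lemma quantum_bword N n (b : 'I_n.+1 -> bop H) (chi : 'I_n -> face) (J : 'I_n -> 'I_N) y z :
  Wstar (variables_from x N) y -> Wstar (variables_from x N) z -> (forall i, B (b i)) ->
  \sum_(I : {ffun 'I_n -> 'I_N})
     phi (y * bword x b chi (fun i => I i) * z) *: u_chi (CS N) chi I J
  = phi (y * bword x b chi (fun i => J i) * z) *: 1.
Proof.
move=> Ny Nz Bb; rewrite (qsum_bword b chi J (fun T => phi (y * T * z))).
pose w := inr y :: bletters b chi J ++ [:: inr z] : seq (letter H N).
have wN a : List.In (inr a) w -> Wstar (variables_from x N) a.
  move=> [[<-]//|]; rewrite cats1 => aw.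
  have [e|/In_bletters[i ->]] := In_rcons aw; first by case: e => <-.
  exact: tail_mem.
have := qsum_word hbi hM xM philin phib hx (qperm_magic (CS N)) wN.
rewrite /w wval_cons wval_cat wval_bletters wval_cons /wval big_nil mulr1 mulrA /=.
move=> <-; rewrite qsum_rcons; apply: qsum_ext => T.
by rewrite mulrA.
Qed.

Lemma bword_mem n (b : 'I_n.+1 -> bop H) (chi : 'I_n -> face) (j : 'I_n -> nat) :
  (forall i, B (b i)) -> algN (bword x b chi j).
Proof.
move=> Bb; apply: (subalgM sN); last exact: alg_on_tail.
apply: (subalg_prod sN) => i; apply: (subalgM sN); first exact: alg_on_tail.
exact: alg_on_var.
Qed.

Lemma eventually_finite (T : finType) (P : T -> nat -> Prop) :
  (forall t, exists m, forall k, (m <= k)%N -> P t k) ->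
  exists m, forall t k, (m <= k)%N -> P t k.
Proof.
move=> /choice[m mP]; exists (\max_t m t)%N => t k mk; apply: mP.
by apply: leq_trans mk; exact: leq_bigmax.
Qed.

(** The functionals T -> phi (y T z) separate the left tensor factors, which reduces the identity to
    one in [CS N]; moving y and z far away turns it into [quantum_bword]. *)
Lemma cexp_quantum : quantum_bi_invariant x CS B cexp.
Proof.
move=> N n chi J b Bb.
pose W (I : {ffun 'I_n -> 'I_N}) := bword x b chi (fun i => I i).
have NW I : algN (W I) by exact: bword_mem.
have MW I : M (cexp (W I)) by apply: tail_mem; exact: cexp_tail.
pose F (f : bop H -> R[i]) := exists y z, [/\ algN y, algN z & f = (fun T => phi (y * T * z))].
have M3 y z T : algN y -> algN z -> M T -> M (y * T * z).
  move=> Ny Nz MT; apply: (subalgM sM); last exact: alg_on_sub Nz.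
  by apply: (subalgM sM) => //; exact: alg_on_sub Ny.
have MD (c : R[i]) S T : M S -> M T -> M (c *: S + T) by case: sM => _ h _; exact: h.
have Flin f : F f -> forall (c : R[i]) S T, M S -> M T -> f (c *: S + T) = c * f S + f T.
  move=> [y [z [Ny Nz ->]]] c S T MS MT.
  by rewrite mulrDr mulrDl -bop_scaleAr -bop_scaleAl philin//; exact: M3.
have phi0 : phi 0 = 0 by exact: (st0 hM philin).
have Fsep T : M T -> (forall f, F f -> f T = 0) -> T = 0.
  move=> MT fT; apply: algN_separation => // [|y z Ny Nz]; first exact: (subalg0 sM).
  by rewrite mulr0 mul0r phi0; apply: (fT (fun T => phi (y * T * z))); exists y, z.
apply/eqP; rewrite -subr_eq0; apply/eqP.
pose t : seq (bop H * CS N) := (cexp (W J), 1) ::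
  [seq (- cexp (W K), u_chi (CS N) chi K J) | K <- index_enum {ffun 'I_n -> 'I_N}].
have -> : cexp (bword x b chi (fun i => J i)) ⊗ (1 : CS N)
    - \sum_(I : {ffun 'I_n -> 'I_N}) cexp (bword x b chi (fun i => I i)) ⊗ u_chi (CS N) chi I J
    = \sum_(p <- t) p.1 ⊗ p.2.
  rewrite big_cons big_map /= -sumrN; congr (_ + _).
  by apply: eq_bigr => I _; rewrite tensNl.
apply: (tens_eq0 MD Flin Fsep) => [p|f [y [z [Ny Nz ->]]]].
  rewrite inE => /orP[/eqP ->|/mapP[I _ ->]] /=; first exact: MW.
  by rewrite -scaleN1r; exact: (subalgZ sM).
rewrite big_cons big_map /=.
have [m mP] := eventually_finite (fun I => phi_cexp_moved Ny Nz (NW I)).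
have [my yP] := alg_on_finite Ny; have [mz zP] := alg_on_finite Nz.
(* One k serves all multi-indices I at once, and k >= N puts the translates of y and z beyond the N
   permuted indices. *)
pose k := (m + my + mz + N)%N.
have {}mP I : phi (y * cexp (W I) * z) = phi (moved k y * W I * moved k z).
  by apply: mP; rewrite /k; lia.
have yk : Wstar (variables_from x N) (moved k y) by apply: moved_tail yP _ _; rewrite /k; lia.
have zk : Wstar (variables_from x N) (moved k z) by apply: moved_tail zP _ _; rewrite /k; lia.
rewrite mP -(quantum_bword chi J yk zk Bb) -big_split /=; apply: big1 => I _.
by rewrite mulrN mulNr (stN hM philin) ?mP ?scaleNr ?subrr//; exact: M3.
Qed.

Lemma face_algebra_sub c j : face_algebra x B c j `<=` alg_on [set j].
Proof. by apply: generated_mono => T [BT|->]; [left|right; exists c, j]. Qed.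

(** Induction splits off the last factor, whose index the other factors avoid by injectivity. *)
Lemma cexp_prod n (chi : 'I_n -> face) (j : 'I_n -> nat) (T : 'I_n -> bop H) :
  injective j -> (forall i, face_algebra x B (chi i) (j i) (T i)) ->
  cexp (\prod_(i < n) T i) = \prod_(i < n) cexp (T i).
Proof.
elim: n chi j T => [|n ih] chi j T jI Tj.
  by rewrite !big_ord0; apply: cexp_fix; exact: subalg1 tail_subalgebra.
have Tj' i := face_algebra_sub (Tj i).
rewrite !big_ord_recr /= -(ih (fun i => chi (widen_ord (leqnSn n) i))
  (fun i => j (widen_ord (leqnSn n) i))).
- apply: cexp_factor (Tj' ord_max); apply: (subalg_prod (alg_on_subalgebra _)) => i.
  apply: alg_on_mono (Tj' _) => _ /= -> /jI /(congr1 val) /=; have := ltn_ord i; lia.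
- by move=> i i' /jI /(congr1 val) /= ii; exact: val_inj.
- by move=> i; exact: Tj.
Qed.

Lemma algN_generated : algN = generated_algebra (B `|` X).
Proof.
rewrite /alg_on; congr (generated_algebra (_ `|` _)).
by apply/seteqP; split=> T [c [j [_ ->]]]; exists c, j.
Qed.

Hypothesis phi1 : phi 1 = 1.

Lemma cexp_conditional_expectation :
  conditional_expectation (generated_algebra (B `|` X)) B cexp.
Proof.
rewrite -algN_generated; split.
- exact: cexp_lin.
- exact: cexp_tail.
- exact: cexp_fix.
- exact: cexp_bimod.
- move=> T NT; apply: opnorm_le (opnorm_ge0 _) _.
  by apply: cexp_nb NT (opnorm_ge0 _) _; exact: nb_opnorm.
move=> c; have B1 : B 1 := subalg1 tail_subalgebra.
move=> /(_ 1 (alg_on_tail B1)); rewrite (cexp_fix B1) => le1.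
(* Since phi 1 = 1, the space is nonzero, so the identity, which the expectation fixes, has positive
   norm and forces 1 <= c. *)
have [v v0] : exists v : H, 0 < hn v.
  apply/not_existsP => v0; have H0 : (1 : bop H) = 0.
    apply: bopP => v; apply: hn_eq0; rewrite leNgt; exact/negP.
  by have := oner_neq0 R[i]; rewrite -phi1 H0 (st0 hM philin) eqxx.
have o1 : 1 <= opnorm (1 : bop H).
  by have := nb_opnorm (1 : bop H) v; rewrite bop1 -ler_pdivrMr// divff ?gt_eqF.
have o0 : 0 < opnorm (1 : bop H) by lra.
by rewrite -(ler_pM2r o0) mul1r.
Qed.

End Permutations.

Theorem theorem3p20 (R : realType) (H : hilbertType R)
    (CS : forall N : nat, quantum_permutation_algebra R N)
    (A : set (bop H)) (phi : bop H -> R[i]) (x : face -> nat -> bop H)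
    (hA : von_neumann_algebra A) (hphi : state A phi)
    (hxA : forall c j, A (x c j))
    (hx : forall c j, adj (x c j) = x c j)
    (hnormal : normal_on (Wstar (variables_from x 0)) phi)
    (hnondeg : nondegenerate_on (Wstar (variables_from x 0)) phi)
    (hbi : quantum_bi_exchangeable x CS phi) :
  let B := tail_algebra x in
  let N := generated_algebra (B `|` variables_from x 0) in
  exists E : bop H -> bop H,
    [/\ conditional_expectation N B E,
        quantum_bi_invariant x CS B E
      & forall n (chi : 'I_n -> face) (j : 'I_n -> nat) (X : 'I_n -> bop H),
          injective j ->
          (forall i, face_algebra x B (chi i) (j i) (X i)) ->
          E (\prod_(i < n) X i) = \prod_(i < n) E (X i)].
Proof.
set X := variables_from x 0; move=> B N.
have aX : selfadj X := variables_selfadj hx (n := 0).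
have hM := Wstar_vna hx.
have sM := vna_subalgebra hM.
have MA : Wstar X `<=` A by move=> T; apply; split=> // _ [c [j [_ ->]]].
have [lin pos phi1] := hphi.
have philin (c : R[i]) S T : Wstar X S -> Wstar X T ->
    phi (c *: S + T) = c * phi S + phi T.
  by move=> /MA AS /MA; exact: lin.
have phipos T : Wstar X T -> 0 <= phi (adj T * T) by move=> /MA; exact: pos.
have [s phib] := normal_bound sM philin hnormal.
exists (cexp x); split.
- exact: (cexp_conditional_expectation hbi hx philin phib hnondeg phipos phi1).
- exact: (cexp_quantum hbi hx philin phib hnondeg phipos).
- by move=> n chi j T; exact: (cexp_prod hbi hx philin phib hnondeg phipos).
Qed.
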